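(* Let $(\xi_j)_{j\ge 0}$ be independent, identically distributed random variables taking values in $\{-1,0,1\}$ with \[\max_{x\in\{-1,0,1\}} \mathbb{P}(\xi_0 = x) < \frac{1}{\sqrt{3}},\] and for $n\ge 1$ let $P(z):=\sum_{j=0}^n \xi_j z^j$. Then: (1) $\lim_{n\to\infty} \mathbb{P}(P\text{ has a double root}) = \mathbb{P}(\xi_0 = 0)^2$. (2) If moreover $\mathbb{P}(\xi_0=0)=0$, then \[\mathbb{P}(P\text{ has a double root}) = \frac{L_n}{n^2} + o(n^{-2})\quad\text{as } n\to\infty,\] where $L_n$ is the periodic sequence \[L_n := \begin{cases} \frac{8\sqrt{3}}{\pi \operatorname{Var}(\xi_0)}& \text{if } \mathbb{E}(\xi_0) = 0 \text{ and } n+1 \text{ is divisible by } 4,\\ \frac{4\sqrt{3}}{\pi \operatorname{Var}(\xi_0)}&\text{if } \mathbb{E}(\xi_0) \neq 0 \text{ and } n+1 \text{ is divisible by } 4,\\ 0&\text{if } n+1 \text{ is not divisible by } 4.\end{cases}\]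
   Context: Here $o(n^{-2})$ denotes a term $\delta_n$, where the sequence $(\delta_n)$ depends only on the distribution of $\xi_0$ and satisfies $\lim_{n\to\infty}\delta_n n^{2}=0$. A double root means a root of multiplicity at least $2$. *)

(* Defs.v *)
From HB Require Import structures.
From mathcomp Require Import all_boot all_order all_algebra.
From mathcomp Require Import complex.
From mathcomp Require Import all_classical all_reals all_analysis.
Set Implicit Arguments. Unset Strict Implicit. Unset Printing Implicit Defensive.
Import Order.TTheory GRing.Theory Num.Theory.
Local Open Scope ring_scope.

(* The three values -1, 0, 1 of xi_0 are encoded by i : 'I_3 as i - 1. *)
Definition val3 (i : 'I_3) : int := (i%:Z - 1)%R.

Definition rand_poly (R : rcfType) (n : nat) (x : {ffun 'I_n.+1 -> 'I_3})
  : {poly R[i]} :=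
  \poly_(j < n.+1) ((val3 (x (inord j)))%:~R).

Arguments rand_poly R {n} x.

Definition has_double_root (R : rcfType) (P : {poly R[i]}) : Prop :=
  exists z : R[i], (('X - z%:P) ^+ 2 %| P)%R.

(* P(P has a double root) when xi_0, ..., xi_n are i.i.d. with law p
   (p i = P(xi_0 = val3 i)): sum over all realizations of product weights. *)
Definition prob_double_root (R : realType) (p : 'I_3 -> R) (n : nat) : R :=
  \sum_(x : {ffun 'I_n.+1 -> 'I_3})
     (\prod_(j < n.+1) p (x j)) * (`[< has_double_root (rand_poly R x) >])%:R.

Definition mean3 (R : realType) (p : 'I_3 -> R) : R :=
  \sum_(i < 3) p i * (val3 i)%:~R.

Definition var3 (R : realType) (p : 'I_3 -> R) : R :=
  \sum_(i < 3) p i * ((val3 i)%:~R - mean3 p) ^+ 2.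

Definition L_seq (R : realType) (p : 'I_3 -> R) (n : nat) : R :=
  if (4 %| n.+1)%N then
    (if mean3 p == 0 then 8 else 4) * Num.sqrt 3 / (pi * var3 p)
  else 0.

(* Main.v *)
(* Idea. A double root z of P other than 0, 1, -1 has a monic minimal polynomial f
   over the integers with f^2 | P. Fix d of order log n. If deg f >= d, a Landau-type
   inequality makes f(3) large, so P(3) is divisible by a large square; reducing P(3)
   modulo that square determines its lowest digits, and the sum over all squares of the
   corresponding probabilities converges because max p < 1 / sqrt 3. If deg f < d and f
   is not cyclotomic, a quantitative Kronecker theorem gives a root a of f of modulus at
   least 1 + 1/(16 d^2); then P(a) = 0 determines the coefficients of P along an
   arithmetic progression, and there are few such f. If f is cyclotomic, P vanishes to
   second order at two distinct k-th roots of unity, which fixes two independent sums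
   sum_i i * xi_(r + k i), each of small concentration. All this costs o(n^-2).
   A double root at 0 means xi_0 = xi_1 = 0. When P(xi_0 = 0) = 0, a double root at -1
   means sum_j (-1)^j xi_j = sum_j (-1)^j j xi_j = 0: impossible by parity unless
   4 | n + 1, and otherwise of probability ~ 4 sqrt 3 / (pi Var n^2) by a local limit
   theorem, proved by dominated convergence in the Fourier integral. The root 1 has the
   same probability as -1 if E xi_0 = 0, and an exponentially small one otherwise. *)
Require Import Defs.
From HB Require Import structures.
From mathcomp Require Import all_boot all_order all_algebra all_field.
From mathcomp Require Import complex.
From mathcomp Require Import all_classical all_reals all_analysis.
From mathcomp Require Import measurable_realfun.
From mathcomp Require Import zify ring lra.
Import Order.TTheory GRing.Theory Num.Theory.
Import numFieldNormedType.Exports.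
Set Implicit Arguments. Unset Strict Implicit. Unset Printing Implicit Defensive.
Local Open Scope classical_set_scope.
Local Open Scope ring_scope.

(** * Euler's totient *)

(** The bound max p < 1 / sqrt 3 has a precise source: about 3^(m/2) integers k satisfy 3^m <= k^2 <
    3^(m+1), and each k^2 divides P(3) with probability at most q^m, where q = max p, so the union
    bound is a geometric series of ratio q sqrt 3. The point 3 serves twice. Differences of
    coefficients lie in [-2, 2], hence are digits in base 3; and all roots a of P satisfy |a| < 2,
    where (3 - |a|) max(1, |a|) >= 2, so that |f(3)| is at least 2^(deg f) divided by the Mahler
    measure of f. The obstacle is that one weighted sum of N independent terms has concentration of
    order N^(-3/2), which is not o(n^(-2)). A cyclotomic factor of order k > 2 therefore has to
    supply two independent sums, from two conjugate roots. The weaker concentration N^(-5/4) is what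
    gets proved: its square N^(-5/2) still leaves a power of n to pay for the steps k < 2 d^2 of the
    progressions and for the number of such k. The roots 1 and -1 do not come in pairs, which is why
    they alone contribute at order n^(-2) when zero coefficients are excluded. *)

Lemma odd_le_totient_sq k : odd k -> (k <= totient k ^ 2)%N.
Proof.
elim/ltn_ind: k => k IH ko; have [k1|k1] := leqP k 1.
  by case: k k1 ko {IH} => [|[|]].
set p := pdiv k; have pp : prime p := pdiv_prime k1.
have k0 : (0 < k)%N by case: k ko {IH k1 p pp}.
have pk : (p %| k)%N := pdiv_dvd k.
have p2 : (2 < p)%N.
  have : p != 2 by apply: contraTneq ko => p2; move: pk; rewrite p2 dvdn2.
  by have := prime_gt1 pp; lia.
rewrite -(partnC p k0).
have cop : coprime k`_p k`_(negn p) by exact: coprime_partC.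
have lp : (0 < logn p k)%N by rewrite logn_gt0 mem_primes pp k0.
rewrite totient_coprime // p_part totient_pfactor // expnMn.
apply: leq_mul; last first.
  apply: IH; last by apply: dvdn_odd ko; rewrite dvdn_part.
  rewrite -{2}(partnC p k0) ltn_Pmull ?part_gt0 // p_part.
  by rewrite -(exp1n (logn p k)) ltn_exp2r // prime_gt1.
rewrite -(prednK lp) expnS /= expnMn -expnM.
have h1 : (p <= p.-1 ^ 2)%N by rewrite expnS expn1; nia.
by apply: leq_mul => //; rewrite leq_exp2l ?prime_gt1 // leq_pmulr.
Qed.

(** Converts the bound [totient k < d] on the degree of ['Phi_k] into k < 2 d^2, so that the
    cyclotomic case is a union of O(d^2) events. The factor 2 comes from the prime 2 alone; odd
    primes satisfy p <= (p - 1)^2. *)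
Lemma le_totient_sq k : (k <= 2 * totient k ^ 2)%N.
Proof.
have [->//|k0] := posnP k.
rewrite -{1 2}(partnC 2%N k0) totient_coprime ?coprime_partC // expnMn.
have o2 : odd k`_(negn 2%N) by rewrite odd_2'nat part_pnat.
have h2 : (k`_2 <= 2 * totient k`_2 ^ 2)%N.
  rewrite p_part; case: (logn 2 k) => [//|e]; rewrite totient_pfactor // mul1n /=.
  by rewrite -expnM expnS leq_pmul2l // leq_exp2l // leq_pmulr.
by rewrite mulnA leq_mul // odd_le_totient_sq.
Qed.

(** * Product measures on finite words *)

Section Product.
Variables (R : realType) (I T : finType) (p : T -> R).
Hypotheses (p_ge0 : forall a, 0 <= p a) (p_sum1 : \sum_a p a = 1).
Implicit Types (x y : {ffun I -> T}) (E F : {ffun I -> T} -> Prop) (S : {set I}).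

Definition weight x : R := \prod_i p (x i).

Definition Pr E : R := \sum_x weight x * (`[< E x >])%:R.

Definition merge S x y : {ffun I -> T} := [ffun i => if i \in S then x i else y i].

Lemma weight_ge0 x : 0 <= weight x.
Proof. by apply: prodr_ge0. Qed.

Lemma sum_weight_prod (g : I -> T -> R[i]) :
  \sum_x (weight x)%:C%C * \prod_i g i (x i) = \prod_i \sum_a (p a)%:C%C * g i a.
Proof.
rewrite bigA_distr_bigA; apply: eq_bigr => x _.
by rewrite /weight rmorph_prod -big_split.
Qed.

Lemma sum_weight : \sum_x weight x = 1.
Proof.
rewrite /weight -(bigA_distr_bigA (fun (_ : I) a => p a)) /=.
by rewrite big1.
Qed.

Lemma Pr_ge0 E : 0 <= Pr E.
Proof. by apply: sumr_ge0 => x _; rewrite mulr_ge0 ?weight_ge0. Qed.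

Lemma Pr_le_supp E F : (forall x, weight x != 0 -> E x -> F x) -> Pr E <= Pr F.
Proof.
move=> EF; apply: ler_sum => x _; have [->|w0] := eqVneq (weight x) 0.
  by rewrite !mul0r.
apply: ler_wpM2l; first exact: weight_ge0.
have := EF x w0; case: (asboolP (E x)) => // Ex; case: asboolP => // nF H.
by case: nF; apply: H.
Qed.

Lemma Pr_le E F : (forall x, E x -> F x) -> Pr E <= Pr F.
Proof. by move=> EF; apply: Pr_le_supp => x _; exact: EF. Qed.

Lemma eq_Pr_supp E F : (forall x, weight x != 0 -> E x <-> F x) -> Pr E = Pr F.
Proof.
by move=> EF; apply/eqP; rewrite eq_le !Pr_le_supp // => x /EF[].
Qed.

Lemma eq_Pr E F : (forall x, E x <-> F x) -> Pr E = Pr F.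
Proof. by move=> EF; apply: eq_Pr_supp => x _; exact: EF. Qed.

Lemma Pr_false E : (forall x, ~ E x) -> Pr E = 0.
Proof. by move=> nE; apply: big1 => x _; rewrite asboolF ?mulr0. Qed.

Lemma Pr_or_and E F :
  Pr (fun x => E x \/ F x) + Pr (fun x => E x /\ F x) = Pr E + Pr F.
Proof.
rewrite /Pr -!big_split /=; apply: eq_bigr => x _; rewrite -!mulrDr; congr (_ * _).
rewrite asbool_or asbool_and.
by case: `[< E x >]; case: `[< F x >]; rewrite /= ?addr0 ?add0r.
Qed.

Lemma Pr_or E F : Pr (fun x => E x \/ F x) <= Pr E + Pr F.
Proof. by rewrite -Pr_or_and lerDl Pr_ge0. Qed.

Lemma Pr_exists (J : finType) (E : J -> {ffun I -> T} -> Prop) :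
  Pr (fun x => exists j, E j x) <= \sum_j Pr (E j).
Proof.
rewrite /Pr exchange_big /=; apply: ler_sum => x _; rewrite -mulr_sumr.
apply: ler_wpM2l; first exact: weight_ge0.
case: asboolP => [[j Ej]|_]; last by apply: sumr_ge0 => j _.
by rewrite (bigD1 j) //= asboolT //= lerDl sumr_ge0.
Qed.

(* The involution [(x, y) |-> (merge S x y, merge S y x)] preserves the product
   weight of a pair. *)
Lemma Pr_resample S E :
  Pr E = \sum_y weight y * Pr (fun x => E (merge S x y)).
Proof.
pose f (z : {ffun I -> T} * {ffun I -> T}) := (merge S z.1 z.2, merge S z.2 z.1).
have fK : involutive f.
  move=> [x y]; rewrite /f /=; congr (_, _); apply/ffunP => i; rewrite !ffunE;
  by case: ifP => // ->.
transitivity (\sum_y \sum_x weight y * (weight x * (`[< E (merge S x y) >])%:R)); last first.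
  by apply: eq_bigr => y _; rewrite mulr_sumr.
rewrite exchange_big pair_bigA /= (reindex f) /=; last first.
  by apply: onW_bij; exact: inv_bij.
transitivity (\sum_x \sum_y weight y * (weight x * (`[< E x >])%:R)).
  apply: eq_bigr => x _; rewrite -mulr_suml sum_weight; ring.
rewrite pair_bigA /=; apply: eq_bigr => -[x y] _ /=.
have -> : merge S (merge S x y) (merge S y x) = x.
  by apply/ffunP => i; rewrite !ffunE; case: ifP => // ->.
rewrite !mulrA; congr (_ * _); rewrite /weight -!big_split /=.
by apply: eq_bigr => i _; rewrite !ffunE; case: ifP; rewrite mulrC.
Qed.

Lemma Pr_le_resample S E c :
  (forall y, Pr (fun x => E (merge S x y)) <= c) -> Pr E <= c.
Proof.
move=> H; rewrite (Pr_resample S) -[leRHS]mul1r -sum_weight mulr_suml.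
by apply: ler_sum => y _; rewrite ler_wpM2l ?weight_ge0.
Qed.

(** The hypotheses express that [E] depends only on the coordinates in [S] and [F] only on the
    others. *)
Lemma Pr_and_indep S E F :
    (forall x y, E (merge S x y) <-> E x) -> (forall x y, F (merge S y x) <-> F x) ->
  Pr (fun x => E x /\ F x) = Pr E * Pr F.
Proof.
move=> HE HF; rewrite (Pr_resample S) /Pr mulr_sumr; apply: eq_bigr => y _.
rewrite mulrCA; congr (_ * _); rewrite mulr_suml; apply: eq_bigr => x _.
rewrite asbool_and (asbool_equiv_eq (HE x y)) (asbool_equiv_eq (HF y x)).
by case: `[< E x >]; rewrite /= ?mulr1 ?mulr0 ?mul1r ?mul0r // mulrC.
Qed.

Lemma Pr_cylinder S (a : I -> T) :
  Pr (fun x => forall i, i \in S -> x i = a i) = \prod_(i in S) p (a i).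
Proof.
pose g i b := if i \in S then (b == a i)%:R else 1 : R.
transitivity (\sum_(x : {ffun I -> T}) \prod_i (p (x i) * g i (x i))).
  apply: eq_bigr => x _; rewrite big_split /=; congr (_ * _).
  case: asboolP => [H|/existsNP[i /not_implyP[iS /eqP xi]]].
    by rewrite big1 // => i _; rewrite /g; case: ifP => // /H ->; rewrite eqxx.
  by rewrite (bigD1 i) //= /g iS (negPf xi) mul0r.
rewrite -(bigA_distr_bigA (fun i b => p b * g i b)) [RHS]big_mkcond /=.
apply: eq_bigr => i _; rewrite /g /=; case: ifP => iS; last first.
  by under eq_bigr do rewrite mulr1.
rewrite (bigD1 (a i)) //= eqxx mulr1 big1 ?addr0 // => b /negPf ->.
by rewrite mulr0.
Qed.

(** Once the coordinates outside [S] are frozen, at most one pattern on [S] realizes [E], and its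
    probability is a product of |S| atoms. *)
Lemma Pr_determined S E q : (forall a, p a <= q) ->
    (forall x y, E x -> E y -> (forall i, i \notin S -> x i = y i) ->
       forall i, i \in S -> x i = y i) ->
  Pr E <= q ^+ #|S|.
Proof.
move=> pq HE.
have [a0 _|nT] := pickP (@predT T); last first.
  by have := p_sum1; rewrite big_pred0 // => /eqP; rewrite eq_sym oner_eq0.
have q0 : 0 <= q by apply: le_trans (pq a0).
apply: (@Pr_le_resample S) => y.
have [[z Ez]|nE] := pselect (exists z, E (merge S z y)); last first.
  by rewrite Pr_false ?exprn_ge0 // => x Ex; apply: nE; exists x.
apply: (@le_trans _ _ (Pr (fun x => forall i, i \in S -> x i = z i))).
  apply: Pr_le => x Ex i iS; have := HE _ _ Ex Ez _ i iS; rewrite !ffunE iS; apply.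
  by move=> j /negPf jS; rewrite !ffunE jS.
rewrite Pr_cylinder -prodr_const; apply: ler_prod => i _.
by rewrite p_ge0 pq.
Qed.

End Product.

(** * A quantitative Kronecker theorem *)

Section PowerSums.
Variable C : numClosedFieldType.
Implicit Types (rs : seq C) (r : {poly int}).

Definition recprod rs : {poly C} := \prod_(a <- rs) (1 - a *: 'X).
Definition psum rs t : C := \sum_(a <- rs) a ^+ t.

Lemma recprod_cons a rs : recprod (a :: rs) = recprod rs - a *: ('X * recprod rs).
Proof. by rewrite /recprod big_cons mulrBl mul1r -scalerAl. Qed.

Lemma coef_recprod_consS a rs i :
  (recprod (a :: rs))`_i.+1 = (recprod rs)`_i.+1 - a * (recprod rs)`_i.
Proof. by rewrite recprod_cons coefB coefZ coefXM. Qed.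

Lemma coef_recprod0 rs : (recprod rs)`_0 = 1.
Proof.
elim: rs => [|a rs IH]; first by rewrite /recprod big_nil coefC.
by rewrite recprod_cons coefB coefZ coefXM IH mulr0 subr0.
Qed.

Lemma size_recprod rs : (size (recprod rs) <= (size rs).+1)%N.
Proof.
elim: rs => [|a rs IH]; first by rewrite /recprod big_nil size_poly1.
apply/leq_sizeP => -[//|i] il; rewrite coef_recprod_consS.
by rewrite !nth_default ?mulr0 ?subr0 //; apply: leq_trans IH _; rewrite // ltnW.
Qed.

(** Newton's identities, by induction on the list of roots: a new root a adds a^t to the power sums,
    and the additional terms telescope in [tele]. *)
Lemma newton rs i :
  \sum_(t < i) (recprod rs)`_t * psum rs (i - t) = - (i%:R * (recprod rs)`_i).
Proof.
elim: rs i => [|a rs IH] i.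
  rewrite /recprod big_nil coefC big1 => [|t _]; last by rewrite /psum big_nil mulr0.
  by case: i => [|i] /=; rewrite ?mulr0 ?mul0r oppr0.
have [->|/prednK <-] := posnP i; first by rewrite big_ord0 mul0r oppr0.
move: i.-1 => {}i.
have psumE t : psum (a :: rs) t = psum rs t + a ^+ t.
  by rewrite /psum big_cons addrC.
rewrite big_ord_recl coef_recprod0 mul1r subn0 psumE.
have key : \sum_(t < i) (recprod (a :: rs))`_t.+1 * psum (a :: rs) (i - t)
   = \sum_(t < i) (recprod rs)`_t.+1 * psum rs (i - t)
     - a * (\sum_(t < i) (recprod rs)`_t * psum rs (i - t))
     + \sum_(t < i) (recprod (a :: rs))`_t.+1 * a ^+ (i - t).
  rewrite mulr_sumr -sumrB -big_split /=; apply: eq_bigr => t _.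
  rewrite psumE mulrDr; congr (_ + _).
  by rewrite coef_recprod_consS mulrBl mulrA.
have tele : \sum_(t < i) (recprod (a :: rs))`_t.+1 * a ^+ (i - t)
   = a * (recprod rs)`_i - a ^+ i.+1.
  elim: i {IH key} => [|i IHi].
    by rewrite big_ord0 coef_recprod0 mulr1 expr1 subrr.
  rewrite big_ord_recr /= coef_recprod_consS subSnn expr1.
  have -> : \sum_(t < i) (recprod (a :: rs))`_t.+1 * a ^+ (i.+1 - t)
     = a * \sum_(t < i) (recprod (a :: rs))`_t.+1 * a ^+ (i - t).
    rewrite mulr_sumr; apply: eq_bigr => t _.
    by rewrite subSn ?exprS 1?ltnW // mulrCA.
  rewrite IHi [in RHS]exprS; ring.
under eq_bigr do rewrite subSS.
rewrite key tele IH; have := IH i.+1.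
rewrite big_ord_recl coef_recprod0 mul1r subn0.
under eq_bigr do rewrite subSS.
move=> /eqP; rewrite addrC -subr_eq0 => /eqP H.
rewrite coef_recprod_consS; apply/eqP; rewrite -subr_eq0; apply/eqP.
rewrite -[RHS]H -natr1; ring.
Qed.

(** Newton's identities solved for the coefficients, dividing by i in characteristic 0. Coefficients
    beyond the number of roots vanish, so finitely many power sums suffice. *)
Lemma recprod_inj_psum rs rs' : size rs = size rs' ->
    (forall t, (0 < t <= size rs)%N -> psum rs t = psum rs' t) ->
  recprod rs = recprod rs'.
Proof.
move=> ss E; apply/polyP => i.
elim/ltn_ind: i => i IH; have [->|i0] := posnP i; first by rewrite !coef_recprod0.
have [ile|ilt] := leqP i (size rs); last first.
  by rewrite !nth_default // (leq_trans (size_recprod _)) // -ss.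
have iN : i%:R != 0 :> C by rewrite pnatr_eq0 -lt0n.
apply: (mulfI iN); apply: oppr_inj; rewrite -!newton.
apply: eq_bigr => t _; rewrite IH // E // subn_gt0 ltn_ord /=.
by rewrite (leq_trans (leq_subr _ _)).
Qed.

Definition pcong (M : int) r r' := exists s : {poly int}, r = r' + M *: s.

(** Solving Newton's identities for the power sums takes no division, because the constant
    coefficient is 1. By induction the power sums are integers and inherit the congruence of the
    coefficients. *)
Lemma psum_cong M rs rs' r r' : map_poly intr r = recprod rs ->
    map_poly intr r' = recprod rs' -> pcong M r r' ->
  forall t, (0 < t)%N -> exists s s' : int,
    [/\ psum rs t = s%:~R, psum rs' t = s'%:~R & (M %| s - s')%Z].
Proof.
move=> Er Er' [u ru].
have coefE i : (recprod rs)`_i = (r`_i)%:~R by rewrite -Er coef_map.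
have coefE' i : (recprod rs')`_i = (r'`_i)%:~R by rewrite -Er' coef_map.
have rr i : (M %| r`_i - r'`_i)%Z.
  by rewrite ru coefD coefZ addrC addKr dvdz_mulr.
suff H n : exists s s' : nat -> int, forall t, (0 < t < n)%N ->
    [/\ psum rs t = (s t)%:~R, psum rs' t = (s' t)%:~R & (M %| s t - s' t)%Z].
  move=> t t0; have [s [s' /(_ t)]] := H t.+1; rewrite t0 ltnSn => /(_ isT) E.
  by exists (s t), (s' t).
elim: n => [|n [s [s' IH]]]; first by exists (fun=> 0), (fun=> 0) => t; rewrite ltn0 andbF.
case: n s s' IH => [|m] s s' IH; first by exists (fun=> 0), (fun=> 0) => -[|t].
set n := m.+1 in IH *.
pose val (r : {poly int}) (s : nat -> int) : int :=
  - (n%:R * r`_n) - \sum_(t < m) r`_t.+1 * s (m - t)%N.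
have psE rs0 r0 s0 : map_poly intr r0 = recprod rs0 ->
    (forall t, (0 < t < n)%N -> psum rs0 t = (s0 t)%:~R) -> psum rs0 n = (val r0 s0)%:~R.
  move=> E0 H0; have := newton rs0 n; rewrite big_ord_recl coef_recprod0.
  rewrite mul1r subn0 => /eqP; rewrite eq_sym -subr_eq => /eqP <-.
  rewrite /val -E0 !coef_map rmorphB rmorphN rmorphM /= rmorph_nat; congr (_ - _).
  rewrite rmorph_sum; apply: eq_bigr => t _; rewrite coef_map rmorphM /=.
  have tn := ltn_ord t.
  by rewrite subSS H0 //; lia.
exists (fun t => if t == n then val r s else s t),
       (fun t => if t == n then val r' s' else s' t) => t /andP[t0].
rewrite ltnS leq_eqVlt; case: eqVneq => [-> _|_ /= tn]; last by apply: IH; rewrite t0.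
split; [by apply: psE => // u0 /IH[]|by apply: psE => // u0 /IH[]|].
have -> : val r s - val r' s' = - (n%:R * (r`_n - r'`_n))
  - (\sum_(t < m) ((r`_t.+1 - r'`_t.+1) * s (m - t)%N
      + r'`_t.+1 * (s (m - t)%N - s' (m - t)%N))).
  rewrite /val.
  have -> : \sum_(t < m) ((r`_t.+1 - r'`_t.+1) * s (m - t)%N
      + r'`_t.+1 * (s (m - t)%N - s' (m - t)%N)) =
    \sum_(t < m) r`_t.+1 * s (m - t)%N - \sum_(t < m) r'`_t.+1 * s' (m - t)%N.
    by rewrite -sumrB; apply: eq_bigr => i _; ring.
  ring.
apply: rpredB; first by rewrite rpredN; apply: dvdz_mull.
apply: rpred_sum => i _; have il := ltn_ord i; apply: rpredD; first exact: dvdz_mulr.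
by apply: dvdz_mull; have [] := IH (m - i)%N; [lia|].
Qed.

(** Graeffe's root-squaring transform: writing r = e(X^2) + X o(X^2), the result G satisfies G(X^2)
    = r(X) r(-X), so each factor 1 - a X becomes 1 - a^2 X. *)
Definition graeffe r : {poly int} := even_poly r ^+ 2 - 'X * odd_poly r ^+ 2.

Lemma even_poly_map (A B : nzRingType) (f : {rmorphism A -> B}) (q : {poly A}) :
  even_poly (map_poly f q) = map_poly f (even_poly q).
Proof. by apply/polyP => i; rewrite coef_map !coef_even_poly coef_map. Qed.

Lemma odd_poly_map (A B : nzRingType) (f : {rmorphism A -> B}) (q : {poly A}) :
  odd_poly (map_poly f q) = map_poly f (odd_poly q).
Proof. by apply/polyP => i; rewrite coef_map !coef_odd_poly coef_map. Qed.

Lemma map_graeffe r rs : map_poly intr r = recprod rs ->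
  map_poly intr (graeffe r) = recprod [seq a ^+ 2 | a <- rs].
Proof.
move=> Er; rewrite /graeffe !expr2 rmorphB !rmorphM -!expr2 /= map_polyX.
rewrite -even_poly_map -odd_poly_map Er; set P := recprod rs.
apply/eqP; rewrite -subr_eq0.
rewrite -(@comp_poly_eq0 _ _ 'X^2) ?size_polyXn // comp_polyB subr_eq0; apply/eqP.
rewrite !expr2 comp_polyB !comp_polyM comp_polyX -!expr2.
set Ev := even_poly P \Po 'X^2; set Od := odd_poly P \Po 'X^2.
have PE : P = Ev + Od * 'X by rewrite /Ev /Od poly_even_odd.
have PN : P \Po (- 'X) = Ev - Od * 'X.
  rewrite [in LHS]PE comp_polyD comp_polyM comp_polyX mulrN; congr (_ - _ * _);
  by rewrite -comp_polyA expr2 comp_polyM comp_polyX mulrNN.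
have -> : Ev ^+ 2 - 'X^2 * Od ^+ 2 = P * (P \Po (- 'X)).
  by rewrite PN {1}PE; ring.
rewrite /P /recprod big_map !rmorph_prod -big_split /=; apply: eq_bigr => a _.
rewrite !(comp_polyB, comp_polyZ, comp_polyX) (comp_polyC 1) polyC1.
by rewrite scalerN -!mul_polyC; ring.
Qed.

Lemma pcong_sq2 (q : {poly int}) : pcong 2 (q ^+ 2) (q \Po 'X^2).
Proof.
elim/poly_ind: q => [|q c [s IH]]; first by exists 0; rewrite comp_poly0 expr0n scaler0 addr0.
rewrite comp_poly_MXaddC.
have [k kE] : exists k : int, c ^+ 2 = c + 2 * k.
  have [k [->|->]] : exists k, c = 2 * k \/ c = 2 * k + 1 by exists (c %/ 2)%Z; lia.
    by exists (2 * k ^+ 2 - k); ring.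
  by exists (2 * k ^+ 2 + k); ring.
exists (s * 'X^2 + c *: (q * 'X) + k%:P).
rewrite -!mul_polyC; have := congr1 polyC kE; rewrite polyCD rmorphXn /= polyCM => E.
rewrite -!mul_polyC in IH; set c2 := 2%:P in IH E *.
have -> : (q * 'X + c%:P) ^+ 2 = q ^+ 2 * 'X^2 + 2%:R * (c%:P * (q * 'X)) + c%:P ^+ 2 by ring.
rewrite IH E /c2.
have -> : (2 : int)%:P = 2%:R by rewrite rmorphMn.
ring.
Qed.

(** Modulo 2, squaring amounts to substituting X^2 and signs disappear, so e^2 - X o^2 becomes
    e(X^2) + X o(X^2) = r. *)
Lemma graeffe_cong2 r : pcong 2 (graeffe r) r.
Proof.
have [u Eu] := pcong_sq2 (even_poly r); have [v Ev] := pcong_sq2 (odd_poly r).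
exists (u - 'X * v - 'X * (odd_poly r \Po 'X^2)).
rewrite -{2}(poly_even_odd r) /graeffe Eu Ev -!mul_polyC.
have -> : (2 : int)%:P = 2%:R by rewrite rmorphMn.
ring.
Qed.

(** In the square of r' + 2^k s the cross term gains a factor 2, and the last term carries 2^(2k), a
    multiple of 2^(k+1) for k > 0. *)
Lemma graeffe_cong_lift k r r' : (0 < k)%N -> pcong (2 ^+ k) r r' ->
  pcong (2 ^+ k.+1) (graeffe r) (graeffe r').
Proof.
case: k => // k _ [s ->]; rewrite /graeffe even_polyD odd_polyD even_polyZ odd_polyZ.
set e := even_poly s; set o := odd_poly s.
set E := even_poly r'; set O := odd_poly r'.
exists (E * e - 'X * (O * o) + 2 ^+ k *: (e ^+ 2 - 'X * o ^+ 2)).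
rewrite -!mul_polyC !rmorphXn /= !exprS.
have -> : (2 : int)%:P = 2%:R by rewrite rmorphMn.
ring.
Qed.

Lemma iter_graeffe_cong r k : pcong (2 ^+ k.+1) (iter k.+1 graeffe r) (iter k graeffe r).
Proof.
elim: k => [|k IH]; first exact: graeffe_cong2.
exact: graeffe_cong_lift IH.
Qed.

Lemma map_iter_graeffe r rs k : map_poly intr r = recprod rs ->
  map_poly intr (iter k graeffe r) = recprod [seq a ^+ (2 ^ k) | a <- rs].
Proof.
move=> Er; elim: k => [|k IH] /=; first by rewrite Er (eq_map (@expr1 _)) map_id.
rewrite (map_graeffe IH) -map_comp; congr recprod; apply: eq_map => a /=.
by rewrite -exprM -expnSr.
Qed.

Lemma bernoulli_le (x : C) n : 0 <= x <= 1 -> 1 - n%:R * x <= (1 - x) ^+ n.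
Proof.
move=> /andP[x0 x1]; elim: n => [|n IH]; first by rewrite mul0r subr0.
have y0 : 0 <= 1 - x by rewrite subr_ge0.
rewrite exprS; apply: le_trans (ler_wpM2l y0 IH).
rewrite -subr_ge0 -natr1.
have -> : (1 - x) * (1 - n%:R * x) - (1 - (n%:R + 1) * x) = n%:R * (x * x) by ring.
by rewrite mulr_ge0 ?ler0n ?mulr_ge0.
Qed.

(* [recprod rs] is the reciprocal polynomial, with constant term 1. The k-th Graeffe
   iterate has roots raised to the power 2^k and agrees with the next one modulo
   2^(k + 1); as the power sums stay below the modulus, Newton's identities make them equal for
   a suitable k, so that squaring permutes the k-th roots. *)
Lemma kronecker_house r rs :
    map_poly intr r = recprod rs -> 0 \notin rs ->
    (forall a, a \in rs -> `|a| <= 1 + (16 * (size rs) ^ 2)%:R^-1) ->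
  forall a, a \in rs -> exists2 m, (0 < m)%N & a ^+ m = 1.
Proof.
move=> Er rs0 ale a ars; set d := size rs in ale *.
have d0 : (0 < d)%N by rewrite /d; case: (rs) ars.
(* The choice 2 d < 2^k <= 4 d meets two demands. Two power sums bounded by 2 d and congruent modulo
   2^(k+1) > 4 d are equal; and the exponents t 2^(k+1) with t <= d stay below 8 d^2, where powers
   of 1 + 1/(16 d^2) do not exceed 2. *)
set k := (trunc_log 2 d).+2.
have [klt kge] : (2 ^ k <= 4 * d /\ 2 * d < 2 ^ k)%N.
  have := trunc_log_bounds (isT : (1 < 2)%N) d0; rewrite /k !expnS; lia.
have dC : (16 * d ^ 2)%:R != 0 :> C by rewrite pnatr_eq0 -lt0n muln_gt0 expn_gt0 d0.
set del := (16 * d ^ 2)%:R^-1 in ale.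
have del0 : 0 < del :> C by rewrite invr_gt0 lt_def dC ler0n.
have del1 : del <= 1 :> C.
  by rewrite invf_le1 ?ler1n ?lt_def ?dC ?ler0n // muln_gt0 expn_gt0 d0.
have pow2 b j : b \in rs -> (j <= 8 * d ^ 2)%N -> `|b| ^+ j <= 2.
  move=> brs jle; apply: (@le_trans _ _ ((1 + del) ^+ j)).
    by apply: lerXn2r; rewrite ?nnegrE ?normr_ge0 ?addr_ge0 ?(ltW del0) ?ale.
  apply: (@le_trans _ _ ((1 + del) ^+ (8 * d ^ 2))).
    by apply: ler_weXn2l => //; rewrite lerDl ltW.
  (* With m = 8 d^2 we have m del = 1/2, so (1 - del)^m >= 1/2; since (1 + del)^m (1 - del)^m <= 1,
     it follows that (1 + del)^m <= 2. *)
  have h := @bernoulli_le del (8 * d ^ 2) _.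
  have {h} : (1 - del) ^+ (8 * d ^ 2) >= 2^-1.
    apply: le_trans (h _); last by rewrite ltW.
    rewrite /del; have -> : (16 * d ^ 2 = 2 * (8 * d ^ 2))%N by lia.
    rewrite (natrM _ 2 (8 * d ^ 2)) invfM mulrCA mulfV ?mulr1; last first.
      by rewrite pnatr_eq0 -lt0n muln_gt0 expn_gt0 d0.
    have -> : 1 - 2^-1 = 2^-1 :> C by field.
    by [].
  move=> h; have h2 : (1 + del) ^+ (8 * d ^ 2) * (1 - del) ^+ (8 * d ^ 2) <= 1.
    rewrite -exprMn; apply: exprn_ile1.
      by apply: mulr_ge0; rewrite ?subr_ge0 ?addr_ge0 ?(ltW del0).
    have -> : (1 + del) * (1 - del) = 1 - del * del by ring.
    by rewrite gerBl mulr_ge0 ?(ltW del0).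
  have p0 : 0 <= (1 + del) ^+ (8 * d ^ 2) by rewrite exprn_ge0 ?addr_ge0 ?(ltW del0).
  have := le_trans (ler_wpM2l p0 h) h2.
  by rewrite ler_pdivrMr ?ltr0n // mul1r.
pose rk j := [seq b ^+ (2 ^ j) | b <- rs].
have EK : recprod (rk k.+1) = recprod (rk k).
  apply: recprod_inj_psum; first by rewrite !size_map.
  rewrite size_map -/d => t /andP[t0 td].
  have [s [s' [Es Es' /dvdzP[c cE]]]] := psum_cong (map_iter_graeffe k.+1 Er)
    (map_iter_graeffe k Er) (iter_graeffe_cong r k) t0.
  rewrite Es Es'; congr (_%:~R).
  have bnd j : (j <= k.+1)%N -> `|psum (rk j) t| <= (2 * d)%:R.
    move=> jk; rewrite /psum /rk big_map; apply: le_trans (ler_norm_sum _ _ _) _.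
    rewrite big_seq; apply: (@le_trans _ _ (\sum_(i <- rs | i \in rs) 2)).
      apply: ler_sum => b brs; rewrite -exprM normrX; apply: pow2 => //.
      have : (2 ^ j <= 8 * d)%N.
        by apply: leq_trans (leq_pexp2l _ jk) _ => //; rewrite expnS; lia.
      rewrite expnS expn1 => h; apply: leq_trans (leq_mul h td) _; lia.
    by rewrite -big_seq big_const_seq count_predT iter_addr_0 -/d mulrnA.
  have bs : (`|s| <= (2 * d)%:Z)%R.
    have := bnd k.+1 (leqnn _); rewrite Es -intr_norm -[(2*d)%:R]/((2 * d)%:Z%:~R).
    by rewrite ler_int.
  have bs' : (`|s'| <= (2 * d)%:Z)%R.
    have := bnd k (leqnSn _); rewrite Es' -intr_norm -[(2*d)%:R]/((2 * d)%:Z%:~R).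
    by rewrite ler_int.
  have [c0|cn] := eqVneq c 0; first by move: cE; rewrite c0 mul0r => /subr0_eq.
  have kZ : 4 * d%:Z < 2 ^+ k.+1 :> int.
    have -> : (2 : int) ^+ k.+1 = (2 ^ k.+1)%N%:Z by rewrite -[RHS]natz natrX.
    rewrite expnS; lia.
  have : `|s - s'| = `|c| * 2 ^+ k.+1 :> int.
    by rewrite cE normrM normrX.
  have : 1 * 2 ^+ k.+1 <= `|c| * 2 ^+ k.+1 :> int.
    by apply: ler_wpM2r; rewrite ?exprn_ge0 //; lia.
  lia.
have sq b : b \in rk k -> b ^+ 2 \in rk k.
  move=> brk.
  have b0 : b != 0.
    move: brk => /mapP[x xrs ->]; rewrite expf_neq0 //.
    by apply: contraNneq rs0 => <-.
  have rootE (l : seq C) x : root (recprod l) x = has (fun c => 1 - c * x == 0) l.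
    elim: l => [|c l IHl]; first by rewrite /recprod big_nil rootC oner_eq0.
    rewrite /recprod big_cons rootM -/(recprod l) IHl /=; congr (_ || _).
    by rewrite /root !hornerE.
  have : root (recprod (rk k.+1)) (b ^- 2).
    rewrite rootE; apply/hasP; exists (b ^+ 2); last by rewrite mulfV ?subrr ?expf_neq0.
    move: brk => /mapP[x xrs ->]; apply/mapP; exists x => //.
    by rewrite -exprM -expnSr.
  rewrite EK rootE => /hasP[c crk]; rewrite subr_eq0 => /eqP h.
  suff -> : b ^+ 2 = c by [].
  apply/eqP; rewrite -[eqbLHS]mul1r h -mulrA mulVf ?mulr1 ?eqxx //.
  by rewrite expf_neq0.
pose b := a ^+ (2 ^ k).
have itr j : b ^+ (2 ^ j) \in rk k.
  elim: j => [|j IH]; first by rewrite expr1; apply: map_f.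
  by rewrite expnSr exprM; apply: sq.
(* Pigeonhole: the d + 1 iterated squares of [b] lie in a list of d elements, so two of them
   coincide, and [b] is nonzero. *)
have : ~~ injectiveb (fun j : 'I_d.+1 => b ^+ (2 ^ j)).
  apply/negP => /injectiveP inj; have : (d.+1 <= d)%N; last by rewrite ltnn.
  rewrite -{1}(size_enum_ord d.+1) -(size_map (fun j : 'I_d.+1 => b ^+ (2 ^ j))).
  rewrite -[X in (_ <= X)%N](size_map (fun b => b ^+ (2 ^ k)) rs).
  apply: uniq_leq_size; first by rewrite map_inj_uniq // enum_uniq.
  by move=> _ /mapP[j _ ->].
move=> /injectivePn[i [j]].
wlog ij : i j / (i < j)%N => [hw|ne E].
  have [|lt|/val_inj ->] := ltngtP i j; last by rewrite eqxx.
    exact: hw.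
  by rewrite eq_sym => ne /esym; exact: hw.
exists (2 ^ k * (2 ^ j - 2 ^ i))%N.
  by rewrite muln_gt0 expn_gt0 subn_gt0 ltn_exp2l.
have b0 : b != 0 by rewrite expf_neq0 //; apply: contraNneq rs0 => <-.
apply: (mulfI (expf_neq0 (2 ^ i) b0)).
by rewrite mulr1 exprM -/b -exprD subnKC ?E // leq_exp2l // ltnW.
Qed.

End PowerSums.

(** * Double roots of integer polynomials *)

Section MinimalPolynomial.
Variable C : numClosedFieldType.
Implicit Types (P f g q : {poly int}) (z : C).

Definition iroot q z := root (map_poly intr q) z.

Lemma size_map_intr q : size (map_poly (intr : int -> C) q) = size q.
Proof.
have [->|q0] := eqVneq q 0; first by rewrite map_poly0 !size_poly0.
by rewrite size_map_poly_id0 // intr_eq0 lead_coef_eq0.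
Qed.

Lemma map_intr_eq0 q : (map_poly (intr : int -> C) q == 0) = (q == 0).
Proof. by rewrite -!size_poly_eq0 size_map_intr. Qed.

Lemma irootM q r z : iroot (q * r) z = iroot q z || iroot r z.
Proof. by rewrite /iroot rmorphM rootM. Qed.

Lemma iroot_size q z : q != 0 -> iroot q z -> (1 < size q)%N.
Proof.
move=> q0 qz; rewrite -size_map_intr; apply: root_size_gt1 qz.
by rewrite map_intr_eq0.
Qed.

(** A nonzero integer polynomial of least degree vanishing at z, made primitive. Pseudo-division
    leaves a remainder of smaller degree that vanishes at z, hence is 0; Gauss's lemma for primitive
    polynomials then gives a quotient with integer coefficients. *)
Lemma exists_int_minpoly P z : P != 0 -> iroot P z ->
  exists f, [/\ f != 0, iroot f z,
    (forall q, iroot q z -> exists r, q = f * r) &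
    (forall q, q != 0 -> iroot q z -> (size f <= size q)%N)].
Proof.
move=> P0 Pz.
have ex : exists n, `[< exists q, [/\ q != 0, iroot q z & size q = n] >].
  by exists (size P); apply/asboolP; exists P.
case: (ex_minnP ex) => n /asboolP[f0 [f00 f0z <-]] min.
have min' q : q != 0 -> iroot q z -> (size f0 <= size q)%N.
  by move=> q0 qz; apply: min; apply/asboolP; exists q.
have dv q : iroot q z -> exists r, q = zprimitive f0 * r.
  move=> qz; suff : f0 %| q by case/dvdpP_int => r ->; exists r.
  rewrite /dvdp; apply/negP => /negP rem0.
  have := Pdiv.Idomain.divp_eq q f0.
  move=> E; have : iroot (q %% f0) z.
    rewrite /iroot /root.
    have -> : q %% f0 = lead_coef f0 ^+ scalp q f0 *: q - q %/ f0 * f0 by rewrite E addrC addKr.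
    rewrite rmorphB rmorphM /= linearZ_LR /= hornerD hornerN hornerM hornerZ.
    by rewrite (eqP qz) (eqP f0z) !mulr0 subr0.
  by move/(min' _ rem0); rewrite leqNgt ltn_modp f00.
exists (zprimitive f0); split=> //.
- by rewrite zprimitive_eq0.
- move: f0z; rewrite {1}(zpolyEprim f0) /iroot /root linearZ_LR /= hornerZ mulf_eq0.
  by rewrite intr_eq0 zcontents_eq0 (negPf f00).
- by move=> q q0 qz; rewrite size_zprimitive; exact: min'.
Qed.

Lemma monic_scale_unit f : lead_coef f \is a GRing.unit -> lead_coef f *: f \is monic.
Proof.
rewrite monicE lead_coefZ -[_ \is a _]/(lead_coef f \in intUnitRing.unitz) /=.
by move=> /orP[]/eqP ->.
Qed.

(** Write P = f g with f minimal. By minimality f'(z) is nonzero, so P'(z) = 0 forces g(z) = 0 and f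
    divides g. The leading coefficient of f is a sign; normalizing it to 1 does not affect f^2. *)
Lemma double_root_factor P z : lead_coef P \is a GRing.unit ->
    ('X - z%:P) ^+ 2 %| map_poly intr P ->
  exists f h, [/\ f \is monic, P = f ^+ 2 * h, iroot f z,
    (forall q, iroot q z -> exists r, q = f * r) &
    (forall q, q != 0 -> iroot q z -> (size f <= size q)%N)].
Proof.
move=> Pu /dvdpP[h0 PE].
have P0 : P != 0 by apply: contraTneq Pu => ->; rewrite lead_coef0 unitr0.
have Pz : iroot P z by rewrite /iroot PE /root hornerM horner_exp hornerXsubC subrr expr0n mulr0.
have [f [f0 fz fdv fmin]] := exists_int_minpoly P0 Pz.
have [g Pg] := fdv _ Pz.
have f'z : ~~ iroot f^`() z.
  apply/negP => /(fmin _) h; have : f^`() != 0.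
    have := iroot_size f0 fz; case E : (size f) => [|[|n]]// _.
    apply/eqP => /(congr1 (fun q : {poly int} => q`_n)); rewrite coef_deriv coef0.
    move/eqP; rewrite mulrn_eq0 /= => /eqP fn; have := lead_coef_eq0 f.
    by rewrite lead_coefE E /= fn eqxx (negPf f0).
  by move/h; rewrite leqNgt lt_size_deriv.
have gz : iroot g z.
  have : root (map_poly intr P)^`() z.
    have := hornerXsubC z z; rewrite subrr PE; move: ('X - _) => u u0.
    by rewrite expr2 /root !derivM !(hornerD,hornerM) u0 !(mulr0,mul0r,addr0).
  rewrite Pg deriv_map derivM rmorphD /= /root hornerD !rmorphM !hornerM /=.
  rewrite (eqP fz) mul0r addr0 mulf_eq0 => /orP[fr|//].
  by move: f'z; rewrite /iroot /root fr.
have [h gh] := fdv _ gz.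
have fu : lead_coef f \is a GRing.unit.
  by move: Pu; rewrite Pg lead_coefM unitrM => /andP[].
have ll : lead_coef f * lead_coef f = 1.
  by move: fu; rewrite -[_ \is a _]/(lead_coef f \in intUnitRing.unitz) => /orP[]/eqP ->.
exists (lead_coef f *: f), h; split.
- exact: monic_scale_unit.
- by rewrite expr2 -scalerAl -scalerAr scalerA ll scale1r Pg gh mulrA.
- by rewrite /iroot /root linearZ_LR /= hornerZ (eqP fz) mulr0.
- move=> q /fdv[r ->]; exists (lead_coef f *: r).
  by rewrite -scalerAl -scalerAr scalerA ll scale1r.
- move=> q q0 /(fmin _ q0); rewrite size_scale //.
  by rewrite lead_coef_eq0.
Qed.

Lemma size_Cyclotomic_le_iroot k q (w : algC) : k.-primitive_root w ->
  q != 0 -> root (map_poly intr q) w -> (size 'Phi_k <= size q)%N.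
Proof.
move=> wk q0 qw; have [p [Ep _ pdv]] := minCpolyP w.
have /esym := pdv (map_poly intr q).
rewrite -map_poly_comp (eq_map_poly (g := intr)) => [|x /=]; last by rewrite ratr_int.
rewrite qw => /dvdp_leq h.
have sq : size (map_poly intr q : {poly rat}) = size q.
  by rewrite size_map_poly_id0 // intr_eq0 lead_coef_eq0.
rewrite -sq; apply: leq_trans (h _); last by rewrite -size_poly_eq0 sq size_poly_eq0.
rewrite -(size_map_poly (ratr : rat -> algC)) -Ep (minCpoly_cyclotomic wk).
by rewrite -(Cintr_Cyclotomic wk) size_map_poly_id0 // (monicP (Cyclotomic_monic k)) oner_neq0.
Qed.

(** X^m - 1 is the product of the ['Phi_d] with d dividing m, so f divides some ['Phi_k] = f h. The
    degree of a primitive root is known in [algC], while z lives in an arbitrary field: a primitive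
    k-th root in [algC] is a root of f or of h, and that factor then has full degree. It cannot be
    h, as f is not constant. *)
Lemma root_unity_cyclotomic f z m : (0 < m)%N -> z ^+ m = 1 -> f \is monic ->
    iroot f z -> (forall q, iroot q z -> exists r, q = f * r) ->
  exists2 k, (0 < k)%N & f = 'Phi_k.
Proof.
move=> m0 zm fm fz fdv.
have : iroot (\prod_(d <- divisors m) 'Phi_d) z.
  by rewrite prod_Cyclotomic // /iroot rmorphB /= map_polyXn rmorph1 /root !hornerE zm subrr.
have H (s : seq nat) : iroot (\prod_(d <- s) 'Phi_d) z -> exists2 d, d \in s & iroot 'Phi_d z.
  elim: s => [|d s IH]; first by rewrite big_nil /iroot rmorph1 (negPf (root1 _)).
  rewrite big_cons irootM => /orP[hd|/IH[e es ez]]; first by exists d; rewrite ?mem_head.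
  by exists e; rewrite ?inE ?es ?orbT.
move=> /H[k]; rewrite -dvdn_divisors // => kd kz.
have k0 : (0 < k)%N := dvdn_gt0 m0 kd.
exists k => //; have [h hE] := fdv _ kz.
have [w wk] := C_prim_root_exists k0.
have Phi0 : 'Phi_k != 0 := monic_neq0 (Cyclotomic_monic k).
have h0 : h != 0 by apply: contraNneq Phi0; rewrite hE => ->; rewrite mulr0.
have f0 := monic_neq0 fm.
have lh : lead_coef h = 1.
  by have := Cyclotomic_monic k; rewrite hE monicE lead_coefM (monicP fm) mul1r => /eqP.
have : root (map_poly intr (f * h)) w.
  by rewrite -hE (Cintr_Cyclotomic wk) root_cyclotomic.
have sz : size 'Phi_k = (size f + size h).-1 by rewrite hE size_mul.
have f1 := iroot_size f0 fz.
have h1 : (0 < size h)%N by rewrite size_poly_gt0.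
rewrite rmorphM rootM => /orP[] /(size_Cyclotomic_le_iroot wk) => /(_ _) hs.
  have {}hs := hs f0; rewrite hE.
  have s1 : size h = 1%N by lia.
  by rewrite (size1_polyC (eq_leq s1)) -(lead_coefC h`_0) -(size1_polyC (eq_leq s1)) lh mulr1.
by have := hs h0; lia.
Qed.

End MinimalPolynomial.

(** * Location of roots, Landau's inequality and the value at 3 *)

Section RootLocation.
Variable C : numClosedFieldType.
Implicit Types (P f g q : {poly int}) (z a : C) (rs : seq C).

Lemma geo_sum_lt (x : C) n : 2 <= x -> \sum_(i < n) x ^+ i < x ^+ n.
Proof.
move=> x2; have x0 : 0 <= x by apply: le_trans x2.
elim: n => [|n IH]; first by rewrite big_ord0 expr0 ltr01.
rewrite big_ord_recr /= exprS; apply: lt_le_trans (ler_wpM2r (exprn_ge0 n x0) x2).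
by rewrite mulr_natl mulr2n ltrD2r.
Qed.

(** The leading coefficient is a sign, and for |z| >= 2 the leading term outweighs the sum of all
    the lower ones. *)
Lemma root_norm_lt2 P z : (forall i, `|P`_i| <= 1) -> P != 0 -> iroot P z -> `|z| < 2.
Proof.
move=> P1 P0 Pz; rewrite real_ltNge ?normr_real ?realn //; apply/negP => z2.
have sP : size P = (size P).-1.+1 by rewrite prednK // size_poly_gt0.
set n := (size P).-1 in sP.
have lead1 : `|P`_n| = 1.
  have : P`_n != 0 by rewrite /n -lead_coefE lead_coef_eq0.
  by have := P1 n; lia.
have := Pz; rewrite /iroot /root horner_coef size_map_intr sP big_ord_recr /=.
rewrite addr_eq0 => /eqP E.
have : `|\sum_(i < n) (map_poly intr P)`_i * z ^+ i| <= \sum_(i < n) `|z| ^+ i.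
  apply: le_trans (ler_norm_sum _ _ _) _; apply: ler_sum => i _.
  rewrite normrM normrX coef_map /= -intr_norm.
  by rewrite ler_piMl ?exprn_ge0 // -[1]/(1%:~R) ler_int.
rewrite E normrN normrM normrX coef_map /= -intr_norm lead1 mul1r.
by apply/negP; rewrite -real_ltNge ?geo_sum_lt ?rpred_sum ?rpredX ?normr_real // => i _;
  rewrite rpredX ?normr_real.
Qed.

Definition l2 N (q : {poly C}) : C := \sum_(i < N) `|q`_i| ^+ 2.

(** The analytic reason is that |w - a| and |1 - a^* w| agree on the unit circle. Here it is a
    telescoping sum: the i-th squared coefficients differ by (1 - |a|^2) (|q_(i-1)|^2 - |q_i|^2). *)
Lemma l2_flip N (q : {poly C}) a : (size q < N)%N ->
  l2 N (('X - a%:P) * q) = l2 N ((1 - a^* *: 'X) * q).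
Proof.
move=> sq; apply/eqP; rewrite -subr_eq0 /l2 -sumrB; apply/eqP.
pose u i := (1 - `|a| ^+ 2) * `|q`_i| ^+ 2.
have E (i : nat) : `|(('X - a%:P) * q)`_i| ^+ 2 - `|((1 - a^* *: 'X) * q)`_i| ^+ 2
   = (if i is j.+1 then u j else 0) - u i.
  rewrite /u !mulrBl mul1r -scalerAl !(coefB, coefZ, coefXM, coefCM).
  case: i => [|i] /=; rewrite ?mulr0 ?subr0 ?sub0r ?normrN ?normrM ?exprMn; first by ring.
  rewrite !normCK !rmorphB !rmorphM /= conjCK; ring.
transitivity (\sum_(i < N) ((if i : nat is j.+1 then u j else 0) - u i)).
  by apply: eq_bigr => i _; exact: E.
rewrite sumrB; case: N sq {E} => // N sq.
rewrite big_ord_recl big_ord_recr /= add0r /u (nth_default _ (sq : (size q <= N)%N)).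
by rewrite normr0 expr0n mulr0 addr0 subrr.
Qed.

Definition max1 a : C := if `|a| <= 1 then 1 else `|a|.

(** Landau's inequality. Factors X - a with |a| > 1 are exchanged for 1 - a^* X, which preserves the
    norm; the top coefficient of the new product then has modulus |q_m| times the product of the
    [max1 a], and its square is one term of the norm. The cofactor [q] collects the factors already
    treated, with [m] its formal degree. *)
Lemma l2_landau N rs (q : {poly C}) m : (size q <= m.+1)%N -> (m + size rs < N)%N ->
  (\prod_(a <- rs) max1 a) ^+ 2 * `|q`_m| ^+ 2 <= l2 N (\prod_(a <- rs) ('X - a%:P) * q).
Proof.
elim: rs q m => [|a rs IH] q m sq mN.
  rewrite !big_nil expr1n !mul1r /l2; rewrite addn0 in mN.
  by rewrite (bigD1 (Ordinal mN)) //= lerDl sumr_ge0 // => i _; rewrite exprn_ge0.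
have sq1 (u : {poly C}) : (size u <= 2)%N -> (size (u * q)%R <= m.+2)%N.
  move=> su; have [->|u0] := eqVneq u 0; first by rewrite mul0r size_poly0.
  by apply: leq_trans (size_polyMleq u q) _; lia.
have mN' : (m.+1 + size rs < N)%N by move: mN => /=; lia.
rewrite !big_cons -mulrA (mulrCA ('X - a%:P)).
have topq : q`_m.+1 = 0 by rewrite nth_default.
rewrite /max1; case: ifPn => a1.
  rewrite mul1r; apply: le_trans (IH (('X - a%:P) * q) m.+1 _ mN').
    by rewrite mulrBl coefB coefXM coefCM topq mulr0 subr0.
  by rewrite sq1 // size_XsubC.
rewrite [X in l2 N X]mulrCA l2_flip; last first.
  have := size_prod_XsubC rs id; move=> Es.
  apply: leq_ltn_trans (size_polyMleq _ _) _; rewrite Es; lia.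
rewrite [X in l2 N X]mulrCA; apply: le_trans (IH ((1 - a^* *: 'X) * q) m.+1 _ mN').
  rewrite mulrBl mul1r -(scalerAl a^* 'X q) coefB coefZ coefXM topq sub0r /=
    normrN normrM norm_conjC.
  by rewrite le_eqVlt; apply/orP; left; apply/eqP; ring.
apply: sq1; rewrite -scaleN1r scalerA addrC.
apply: leq_trans (size_polyD _ _) _; rewrite size_poly1 geq_max andbT.
by apply: leq_trans (size_scale_leq _ _) _; rewrite size_polyX.
Qed.

(** The product is the Mahler measure of the monic f. The squared norm of P is at most n + 1, and
    the leading coefficient of g is a nonzero integer. *)
Lemma landau_factor P f g rs n : (forall i, `|P`_i| <= 1) -> (size P <= n.+1)%N ->
    P != 0 -> P = f * g -> map_poly intr f = \prod_(a <- rs) ('X - a%:P) ->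
  (\prod_(a <- rs) max1 a) ^+ 2 <= n.+1%:R.
Proof.
move=> P1 Pn P0 PE fE.
have g0 : g != 0 by apply: contraNneq P0; rewrite PE => ->; rewrite mulr0.
have f0 : f != 0 by apply: contraNneq P0; rewrite PE => ->; rewrite mul0r.
have sf : size f = (size rs).+1 by rewrite -(size_map_intr C) fE size_prod_XsubC.
have sg : size g = (size g).-1.+1 by rewrite prednK // size_poly_gt0.
have sP : size P = (size rs + size g)%N by rewrite PE size_mul // sf.
have : (\prod_(a <- rs) max1 a) ^+ 2 <=
   (\prod_(a <- rs) max1 a) ^+ 2 * `|(map_poly intr g)`_(size g).-1| ^+ 2.
  rewrite ler_peMr //; first by rewrite exprn_ge0 // prodr_ge0 // => a; rewrite /max1; case: ifP.
  rewrite exprn_ege1 // coef_map /= -intr_norm -[1]/(1%:~R) ler_int -lead_coefE.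
  by rewrite -gtz0_ge1 normr_gt0 lead_coef_eq0.
move=> h; apply: (le_trans h); apply: le_trans (@l2_landau n.+1 rs _ _ _ _) _.
- by rewrite size_map_intr -sg.
- lia.
rewrite -fE -rmorphM -PE /l2; apply: (@le_trans _ _ (\sum_(i < n.+1) 1)).
  apply: ler_sum => i _; rewrite coef_map /= -intr_norm exprn_ile1 ?ler0z //.
  by rewrite -[1]/(1%:~R) ler_int.
by rewrite sumr_const card_ord.
Qed.

(** Each root satisfies |3 - a| max(1, |a|) >= 2: clear for |a| <= 1, and for 1 <= t = |a| <= 2
    because (3 - t) t - 2 = (t - 1)(2 - t). Multiplying over the roots gives 2^(deg f) <= |f(3)| M
    with M the Mahler measure, and M^2 <= n + 1. *)
Lemma horner3_lower P f g rs n : (forall i, `|P`_i| <= 1) -> (size P <= n.+1)%N ->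
    P != 0 -> P = f * g -> map_poly intr f = \prod_(a <- rs) ('X - a%:P) ->
  (4 ^ (size rs) <= `|f.[3]| ^ 2 * n.+1)%N.
Proof.
move=> P1 Pn P0 PE fE; have L := landau_factor P1 Pn P0 PE fE.
have alt a : a \in rs -> `|a| <= 2.
  move=> ars; apply/ltW/(root_norm_lt2 P1 P0); rewrite PE irootM /iroot fE.
  by rewrite root_prod_XsubC ars.
have max0 a : 0 <= max1 a by rewrite /max1; case: ifP.
have key : 2 ^+ size rs <= `|(map_poly intr f).[3]| * \prod_(a <- rs) max1 a.
  rewrite fE horner_prod normr_prod -big_split /=.
  have -> : 2 ^+ size rs = \prod_(a <- rs) (2 : C) by elim: (rs) => [|b l IHl];
    rewrite ?big_nil ?big_cons ?expr0 //= exprS IHl.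
  rewrite !big_seq; apply: ler_prod => a /alt a2; rewrite ler0n /= hornerXsubC.
  have h3 : 3 - `|a| <= `|3 - a|.
    by have := lerB_dist 3 a; rewrite (ger0_norm (ler0n C 3)).
  have h31 : 1 <= 3 - `|a| by rewrite lerBrDr (natrD _ 1 2) lerD2l.
  rewrite /max1; case: ifPn => a1.
    rewrite mulr1; apply: le_trans h3; by rewrite lerBrDr (natrD _ 2 1) lerD2l.
  have a1' : 1 <= `|a| by apply: ltW; rewrite real_ltNge ?normr_real ?realn.
  apply: (@le_trans _ _ ((3 - `|a|) * `|a|)); last by rewrite ler_wpM2r.
  rewrite -subr_ge0; have -> : (3 - `|a|) * `|a| - 2 = (`|a| - 1) * (2 - `|a|) by ring.
  by rewrite mulr_ge0 // subr_ge0.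
have : (4 ^ size rs)%:R <= (`|f.[3]| ^ 2 * n.+1)%N%:R :> C.
  have -> : (4 ^ size rs)%N = ((2 ^ size rs) ^ 2)%N by rewrite -expnM mulnC expnM.
  rewrite natrX natrX natrM.
  have k0 : 0 <= 2 ^+ size rs :> C by rewrite exprn_ge0.
  apply: le_trans (lerXn2r 2 _ _ key) _; rewrite ?nnegrE //.
    by rewrite mulr_ge0 // prodr_ge0.
  rewrite exprMn; apply: ler_pM => //; rewrite ?exprn_ge0 ?prodr_ge0 //.
  rewrite -[3]/(3%:~R) horner_map /= -intr_norm natrX.
  by rewrite -[_%:~R]/(`|f.[3]|%N%:R) .
by rewrite ler_nat.
Qed.

Lemma coef_prod_XsubC_bound rs : (forall a, a \in rs -> `|a| <= 2) ->
  forall i, `|(\prod_(a <- rs) ('X - a%:P))`_i| <= 3 ^+ size rs.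
Proof.
elim: rs => [|a rs IH] H i.
  by rewrite big_nil coefC; case: ifP => _; rewrite ?normr1 ?normr0.
have {}IH : forall i, `|(\prod_(a <- rs) ('X - a%:P))`_i| <= 3 ^+ size rs.
  by apply: IH => b brs; apply: H; rewrite inE brs orbT.
rewrite big_cons mulrBl coefB coefXM coefCM /= exprS.
have -> : 3 * 3 ^+ size rs = 3 ^+ size rs + 2 * 3 ^+ size rs :> C by ring.
apply: le_trans (ler_normB _ _) _; apply: lerD.
  by case: i => [|i] /=; [rewrite normr0 exprn_ge0|exact: IH].
by rewrite normrM ler_pM // H // mem_head.
Qed.

(* The trichotomy behind the union bound: large degree, small degree with a root well
   outside the unit circle, cyclotomic. *)
Theorem double_root_cases P z n d0 : (forall i, `|P`_i| <= 1) -> (size P <= n.+1)%N ->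
    P != 0 -> ('X - z%:P) ^+ 2 %| map_poly intr P -> z != 0 -> z != 1 -> z != -1 ->
    (0 < d0)%N ->
  [\/ exists k : nat, ((k ^ 2)%N%:Z %| P.[3])%Z /\ (4 ^ d0 <= k ^ 2 * n.+1)%N,
      exists f, [/\ (size f <= d0)%N, forall i, `|f`_i| <= 3 ^+ d0,
         exists g, P = f * g &
         exists2 a : C, iroot f a & 1 + (16 * d0 ^ 2)%:R^-1 < `|a| ]
    | exists k, [/\ (2 < k)%N, (totient k < d0)%N & exists g, P = 'Phi_k ^+ 2 * g]].
Proof.
move=> P1 Pn P0 dbl z0 z1 zN1 d00.
have Pu : lead_coef P \is a GRing.unit.
  have : lead_coef P != 0 by rewrite lead_coef_eq0.
  have := P1 (size P).-1; rewrite -lead_coefE => h1 h2.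
  rewrite -[_ \is a _]/(lead_coef P \in intUnitRing.unitz) /intUnitRing.unitz /=.
  lia.
have [f [h [fm PE fz fdv fmin]]] := double_root_factor Pu dbl.
have f0 := monic_neq0 fm.
have PE' : P = f * (f * h) by rewrite PE expr2 mulrA.
have [rs fE] := closed_field_poly_normal (map_poly intr f : {poly C}).
have fE' : map_poly intr f = \prod_(a <- rs) ('X - a%:P) :> {poly C}.
  by rewrite fE lead_coef_map_eq ?(monicP fm) ?oner_eq0 // scale1r.
have sf : size f = (size rs).+1 by rewrite -(size_map_intr C) fE' size_prod_XsubC.
have [dle|dlt] := leqP d0 (size rs).
  constructor 1; exists `|f.[3]|%N; split.
    rewrite PE hornerM horner_exp; apply: dvdz_mulr.
    by rewrite dvdzE /= abszX.
  apply: leq_trans (horner3_lower P1 Pn P0 PE' fE').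
  by rewrite leq_exp2l.
have alt a : a \in rs -> `|a| < 2.
  move=> ars; apply/(root_norm_lt2 P1 P0); rewrite PE' irootM /iroot fE'.
  by rewrite root_prod_XsubC ars.
have [/hasP[a ars ag]|nobig] := boolP (has (fun a => 1 + (16 * d0 ^ 2)%:R^-1 < `|a|) rs).
  constructor 2; exists f; split.
  - by rewrite sf.
  - move=> i; have := coef_prod_XsubC_bound (fun a ars => ltW (alt a ars)) i.
    rewrite -fE' coef_map /= -intr_norm => hb.
    have : (`|f`_i|)%:~R <= (3 ^+ d0 : int)%:~R :> C.
      apply: (le_trans hb); rewrite rmorphXn /=; apply: ler_weXn2l; first by rewrite ler1n.
      exact: ltnW.
    by rewrite ler_int.
  - by exists (f * h).
  - by exists a => //; rewrite /iroot fE' root_prod_XsubC.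
(* If f = X u, then u vanishes at the nonzero z and has smaller degree than f, against
   minimality. *)
have frs0 : 0 \notin rs.
  apply/negP; rewrite -root_prod_XsubC -fE' => f_0.
  have f_0' : f`_0 = 0.
    by move: f_0; rewrite /root horner_coef0 coef_map /= intr_eq0 => /eqP.
  have [u fu] : exists u, f = 'X * u.
    exists (drop_poly 1 f); apply/polyP => -[|i]; rewrite coefXM //=.
    by rewrite coef_drop_poly addn1.
  have u0 : u != 0 by apply: contraNneq f0; rewrite fu => ->; rewrite mulr0.
  have := fz; rewrite fu irootM => /orP[|uz]; first by rewrite /iroot map_polyX rootX (negPf z0).
  have := fmin _ u0 uz; by rewrite fu mulrC size_mulX // ltnn.
constructor 3.
(* The coefficients of f in reverse order: this is the reciprocal polynomial that [kronecker_house]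
   takes as input. *)
pose r : {poly int} := \poly_(i < size f) f`_(size rs - i).
have rE : map_poly intr r = recprod rs.
  have rev (l : seq C) i : (i <= size l)%N ->
      (recprod l)`_i = (\prod_(a <- l) ('X - a%:P))`_(size l - i).
    elim: l i => [|a l IHl] i; first by rewrite leqn0 => /eqP ->; rewrite /recprod !big_nil coefC.
    have sz : (\prod_(a <- l) ('X - a%:P))`_(size l).+1 = 0.
      by rewrite nth_default // size_prod_XsubC.
    rewrite big_cons mulrBl coefB coefXM coefCM.
    case: i => [|i] /=; first by rewrite coef_recprod0 subn0 /=
      sz mulr0 subr0 -(coef_recprod0 l) IHl // subn0.
    rewrite ltnS subSS coef_recprod_consS => il; rewrite (IHl i il).
    have [/eqP ->|ne] := boolP (i == size l).
      by rewrite subnn nth_default ?size_recprod.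
    have lt : (i < size l)%N by rewrite ltn_neqAle ne.
    by rewrite -[(size l - i)%N]prednK ?subn_gt0 //= IHl // subnS.
  apply/polyP => i; rewrite coef_map coef_poly sf ltnS.
  have [il|il] := leqP i (size rs); last by rewrite nth_default // (leq_trans (size_recprod _)).
  by rewrite rev // -fE' coef_map.
have zrs : z \in rs by rewrite -root_prod_XsubC -fE'.
have [m m0 zm] : exists2 m, (0 < m)%N & z ^+ m = 1.
  apply: (kronecker_house rE frs0) zrs => a ars.
  have /hasPn /(_ _ ars) := nobig;
    rewrite -real_leNgt ?normr_real ?ger0_real ?addr_ge0 ?invr_ge0 // => h0.
  apply: (le_trans h0); rewrite lerD2l.
  have s0 : (0 < size rs)%N by case: (rs) ars.
  rewrite lef_pV2 ?posrE ?ltr0n ?muln_gt0 ?expn_gt0 ?d00 ?s0 //.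
  by rewrite ler_nat leq_pmul2l // leq_sqr ltnW.
have [k k0 fk] := root_unity_cyclotomic m0 zm fm fz fdv.
exists k; split; last by exists h; rewrite -fk.
  rewrite ltnNge; apply/negP => k2.
  have : iroot (\prod_(d <- divisors k) 'Phi_d) z.
    rewrite (big_rem k) -?dvdn_divisors ?dvdnn //= irootM -fk.
    by rewrite fz.
  rewrite prod_Cyclotomic // /iroot rmorphB /= map_polyXn rmorph1 /root !hornerE.
  case: k k0 k2 {fk} => [|[|[|]]]// _ _; rewrite subr_eq0 ?expr1 ?(negPf z1) //.
  by rewrite sqrf_eq1 (negPf z1) (negPf zN1).
by rewrite -ltnS -size_Cyclotomic -fk sf.
Qed.
End RootLocation.

(** * Random polynomials with small coefficients *)

Section Digits.
Variable C : numDomainType.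

Lemma geo_sum3 (y : C) r : 3 <= y -> \sum_(i < r) 2 * y ^+ i < y ^+ r.
Proof.
move=> y3; have y0 : 0 <= y by apply: le_trans y3.
elim: r => [|r IH]; first by rewrite big_ord0 expr0 ltr01.
rewrite big_ord_recr /= exprS; apply: lt_le_trans (ler_wpM2r (exprn_ge0 r y0) y3).
by rewrite (natrD _ 1 2) [ltRHS]mulrDl mul1r ltrD2r.
Qed.

Lemma digits_unique (b : C) r (c : nat -> int) : 3 <= `|b| ->
  (forall i, `|c i| <= 2) -> \sum_(i < r) (c i)%:~R * b ^+ i = 0 ->
  forall i, (i < r)%N -> c i = 0.
Proof.
move=> b3 c2; elim: r => [|r IH]; first by [].
rewrite big_ord_recr /= => E.
have cr : c r = 0.
  apply/eqP; rewrite -[_ == _]negbK; apply/negP => cr.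
  have h1 : `|b| ^+ r <= `|(c r)%:~R * b ^+ r|.
    rewrite normrM normrX -intr_norm ler_peMl ?exprn_ge0 // -[1]/(1%:~R) ler_int.
    by rewrite -gtz0_ge1 normr_gt0.
  have := lt_le_trans (geo_sum3 r b3) h1.
  move/eqP: E; rewrite addrC addr_eq0 => /eqP ->; rewrite normrN.
  have h2 : `|\sum_(i < r) (c i)%:~R * b ^+ i| <= \sum_(i < r) 2 * `|b| ^+ i.
    apply: le_trans (ler_norm_sum _ _ _) _; apply: ler_sum => i _.
    rewrite normrM normrX ler_wpM2r ?exprn_ge0 // -intr_norm.
    by rewrite -[2]/(2%:~R) ler_int.
  by move/(le_lt_trans h2); rewrite ltxx.
move: E; rewrite cr mul0r addr0 => /IH H i.
by rewrite ltnS leq_eqVlt => /orP[/eqP ->|/H].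
Qed.

End Digits.

Section RandomPolynomial.
Variables (n : nat).
Implicit Types x y : {ffun 'I_n.+1 -> 'I_3}.

Definition ipoly x : {poly int} := \poly_(j < n.+1) val3 (x (inord j)).

Lemma coef_ipoly x (j : 'I_n.+1) : (ipoly x)`_j = val3 (x j).
Proof. by rewrite coef_poly ltn_ord inord_val. Qed.

Lemma size_ipoly x : (size (ipoly x) <= n.+1)%N.
Proof. exact: size_poly. Qed.

Lemma val3_le1 (i : 'I_3) : `|val3 i| <= 1.
Proof. by case: i => [[|[|[|]]]]. Qed.

Lemma val3_inj : injective val3.
Proof. by move=> i j /addIr[] /val_inj. Qed.

Lemma coef_ipoly_le1 x i : `|(ipoly x)`_i| <= 1.
Proof. by rewrite coef_poly; case: ifP => // _; rewrite ?normr0 ?val3_le1. Qed.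

Lemma rand_polyE (R : rcfType) x : rand_poly R x = map_poly intr (ipoly x).
Proof.
apply/polyP => i; rewrite coef_map !coef_poly; by case: ifP.
Qed.

Lemma horner_ipoly (A : comNzRingType) x (z : A) :
  (map_poly intr (ipoly x)).[z] = \sum_(j < n.+1) (val3 (x j))%:~R * z ^+ j.
Proof.
rewrite (@horner_coef_wide _ n.+1) ?(leq_trans (size_poly _ _)) ?size_ipoly //.
by apply: eq_bigr => j _; rewrite coef_map coef_ipoly.
Qed.

Section Bounds.
Variables (R : realType) (p : 'I_3 -> R) (q : R).
Hypotheses (p_ge0 : forall i, 0 <= p i) (p_sum1 : \sum_(i < 3) p i = 1).
Hypothesis (p_le : forall i, p i <= q).

Let q0 : 0 <= q. Proof. by apply: le_trans (p_le ord0). Qed.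

(* Differences of coefficients lie in [-2, 2], and representations in base b with
   |b| >= 3 and such digits are unique. *)
Lemma Pr_progression (A : numDomainType) (b : A) h r (E : {ffun 'I_n.+1 -> 'I_3} -> Prop) :
    (0 < h)%N -> (h * r.-1 <= n)%N -> 3 <= `|b| ->
    (forall x y, E x -> E y ->
       (forall j : 'I_n.+1, (forall i, (i < r)%N -> j != (h * i)%N :> nat) -> x j = y j) ->
       \sum_(i < r) (val3 (x (inord (h * i)%N)) - val3 (y (inord (h * i)%N)))%:~R * b ^+ i = 0) ->
  Pr p E <= q ^+ r.
Proof.
move=> h0 hr b3 HE.
have inordE (i : 'I_r) : (inord (h * i)%N : 'I_n.+1) = (h * i)%N :> nat.
  rewrite inordK // ltnS (leq_trans _ hr) // leq_pmul2l //.
  have := ltn_ord i; by case: r {HE hr} i => // r i; rewrite ltnS.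
pose g (i : 'I_r) : 'I_n.+1 := inord (h * i)%N.
have ginj : injective g.
  move=> i j /(congr1 val); rewrite /= !inordE => /eqP.
  by rewrite eqn_pmul2l // => /eqP /val_inj.
pose S : {set 'I_n.+1} := (g @: 'I_r).
have -> : r = #|S| by rewrite card_imset // card_ord.
apply: Pr_determined => // x y Ex Ey xy _ /imsetP[i _ ->].
have off (j : 'I_n.+1) : (forall i, (i < r)%N -> j != (h * i)%N :> nat) -> x j = y j.
  move=> H; apply: xy; apply/negP => /imsetP[k _ jk].
  by have := H k (ltn_ord k); rewrite jk inordE eqxx.
have := @digits_unique A b r (fun i =>
  val3 (x (inord (h * i)%N)) - val3 (y (inord (h * i)%N))) b3 _ (HE x y Ex Ey off).
move=> /(_ _ i (ltn_ord i)) D; apply: val3_inj; apply/eqP; rewrite -subr_eq0.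
apply/eqP; apply: D => k; apply: le_trans (ler_normB _ _) _.
by rewrite -[2]/(1 + 1) lerD ?val3_le1.
Qed.

(** Freezing all coefficients except those at the r multiples of h turns P(a) = 0 into an expansion
    in base a^h, of modulus at least 3. *)
Lemma Pr_root_outside (A : numDomainType) (a : A) h r : (0 < h)%N -> (h * r.-1 <= n)%N ->
    3 <= `|a| ^+ h ->
  Pr p (fun x => (map_poly intr (ipoly x)).[a] = 0) <= q ^+ r.
Proof.
move=> h0 hr a3; apply: (@Pr_progression A (a ^+ h) h) => //; first by rewrite normrX.
move=> x y Ex Ey off; have E : \sum_(j < n.+1) ((val3 (x j))%:~R * a ^+
  j - (val3 (y j))%:~R * a ^+ j) = 0.
  by rewrite sumrB -!horner_ipoly Ex Ey subrr.
apply: (etrans _ E) => {E}.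
have inordE (i : 'I_r) : (inord (h * i)%N : 'I_n.+1) = (h * i)%N :> nat.
  rewrite inordK // ltnS (leq_trans _ hr) // leq_pmul2l //.
  have := ltn_ord i; by case: r {hr off} i => // r i; rewrite ltnS.
pose g (i : 'I_r) : 'I_n.+1 := inord (h * i)%N.
have ginj : injective g.
  move=> i j /(congr1 val); rewrite /= !inordE => /eqP.
  by rewrite eqn_pmul2l // => /eqP /val_inj.
transitivity (\sum_(j in (g @: 'I_r))
    (val3 (x j) - val3 (y j))%:~R * a ^+ j : A).
  rewrite big_imset /=; last by move=> ? ? _ _; exact: ginj.
  by apply: eq_big => // i _; rewrite /g inordE -exprM.
rewrite [LHS]big_mkcond /=; apply: eq_bigr => j _; rewrite -mulrBl -rmorphB /=.
case: ifPn => // jS; rewrite off ?subrr ?mul0r // => i ir.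
apply: contraNneq jS => ji; apply/imsetP; exists (Ordinal ir) => //.
by apply/ord_inj; rewrite ji; exact: esym (inordE (Ordinal ir)).
Qed.

(** Freeze all but the m lowest coefficients. Two realizations then have values at 3 that differ by
    a multiple of k of modulus less than 3^m <= k, hence by 0. *)
Lemma Pr_dvd_horner3 k m : (m <= n.+1)%N -> (3 ^ m <= k)%N ->
  Pr p (fun x => (k%:Z %| (ipoly x).[3])%Z) <= q ^+ m.
Proof.
move=> mn mk; apply: (@Pr_progression int 3 1) => //; first by rewrite mul1n; lia.
move=> x y Ex Ey off.
have E : (k%:Z %| \sum_(i < m) (val3 (x (inord (1 * i)%N)) - val3 (y (inord (1 * i)%N)))%:~R * 3 ^+ i)%Z.
  have -> : \sum_(i < m) (val3 (x (inord (1 * i)%N)) - val3 (y (inord (1 * i)%N)))%:~R * 3 ^+ i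
     = (ipoly x).[3] - (ipoly y).[3] :> int.
    have hE z : (ipoly z).[3] = \sum_(j < n.+1) val3 (z j) * 3 ^+ j.
      have := @horner_ipoly int z 3; rewrite map_poly_id => [->|c _]; last by rewrite intz.
      by apply: eq_bigr => j _; rewrite intz.
    rewrite !hE -sumrB (big_ord_widen n.+1 (fun i =>
      (val3 (x (inord (1 * i)%N)) - val3 (y (inord (1 * i)%N)))%:~R * 3 ^+ i) mn).
    rewrite big_mkcond /=; apply: eq_bigr => j _; rewrite mul1n inord_val intz -mulrBl.
    case: ifPn => // jm; rewrite off ?subrr ?mul0r // => i im.
    by rewrite mul1n; apply: contraNneq jm => ->.
  exact: rpredB.
apply/eqP; rewrite -[_ == _]negbK; apply/negP => n0.
move/dvdzP: E => [c cE]; move: n0; rewrite cE mulf_eq0 negb_or => /andP[c0 _].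
have : `|\sum_(i < m) (val3 (x (inord (1 * i)%N)) - val3 (y (inord (1 * i)%N)))%:~R * 3 ^+ i|
  < 3 ^+ m :> int.
  apply: le_lt_trans (ler_norm_sum _ _ _) _.
  apply: le_lt_trans (geo_sum3 m (lexx (3 : int))); apply: ler_sum => i _.
  rewrite normrM normrX ler_wpM2r ?exprn_ge0 // intz.
  apply: le_trans (ler_normB _ _) _.
  by rewrite -[2]/(1 + 1) lerD ?val3_le1.
rewrite cE normrM.
have -> : (3 : int) ^+ m = (3 ^ m)%N%:Z by rewrite -[RHS]natz natrX.
have : 1 <= `|c| by rewrite -gtz0_ge1 normr_gt0.
move=> c1 h; have : `|k%:Z| <= `|c| * `|k%:Z| by rewrite ler_peMl.
lia.
Qed.

Lemma horner3_eq0 x : (ipoly x).[3] = 0 -> x = [ffun=> inord 1].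
Proof.
have hE : (ipoly x).[3] = \sum_(j < n.+1) (val3 (x j))%:~R * 3 ^+ j.
  have := @horner_ipoly int x 3; rewrite map_poly_id => [->|c _]; last by rewrite intz.
  by apply: eq_bigr => j _; rewrite intz.
rewrite hE => E; apply/ffunP => j; rewrite ffunE.
have := @digits_unique int 3 n.+1 (fun i => val3 (x (inord i))) isT _ _ j (ltn_ord j).
rewrite inord_val => D; apply: val3_inj; rewrite {}D; first by rewrite /val3 inordK.
  by move=> i; apply: le_trans (val3_le1 _) _.
by rewrite -[RHS]E; apply: eq_bigr => i _; rewrite inord_val.
Qed.

Lemma horner3_lt x : `|(ipoly x).[3]| < 3 ^+ n.+1.
Proof.
have -> : (ipoly x).[3] = \sum_(j < n.+1) (val3 (x j)) * 3 ^+ j.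
  have := @horner_ipoly int x 3; rewrite map_poly_id => [->|c _]; last by rewrite intz.
  by apply: eq_bigr => j _; rewrite intz.
apply: le_lt_trans (ler_norm_sum _ _ _) _.
apply: le_lt_trans (geo_sum3 n.+1 (lexx (3 : int))); apply: ler_sum => i _.
rewrite normrM normrX ler_wpM2r ?exprn_ge0 //.
by apply: le_trans (val3_le1 _) _.
Qed.

Lemma Pr_single x0 : Pr p (fun x => x = x0) <= q ^+ n.+1.
Proof.
rewrite -[X in q ^+ X](card_ord n.+1) -cardsT; apply: Pr_determined => //.
by move=> x y -> ->.
Qed.

(** The k are sorted by m, the integer part of log_3 (k^2). With s = sqrt 3, at most s^(m+1) + 1 <=
    4 s^m values of k fall in class m, each of probability at most q^m, and the sum over m >= m0 is
    geometric. If k^2 >= 3^(n+1), divisibility forces P(3) = 0, so P = 0; this is the term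
    q^(n+1). *)
Lemma Pr_square_dvd_horner3 m0 : q * Num.sqrt 3 < 1 ->
  Pr p (fun x => exists k : nat, ((k ^ 2)%N%:Z %| (ipoly x).[3])%Z /\ (3 ^ m0 <= k ^ 2)%N)
    <= q ^+ n.+1 + 4 / (1 - q * Num.sqrt 3) * (q * Num.sqrt 3) ^+ m0.
Proof.
move=> rho1; set s := Num.sqrt 3; set rho := q * s in rho1 *.
have s0 : 0 <= s by exact: sqrtr_ge0.
have ss : s ^+ 2 = 3 by rewrite sqr_sqrtr.
have s1 : 1 <= s by rewrite -(ler_pXn2r (ltn0Sn 1)) ?nnegrE // expr1n ss ler1n.
have s2 : s <= 2 by rewrite -(ler_pXn2r (ltn0Sn 1)) ?nnegrE // ss -natrX ler_nat.
have rho0 : 0 <= rho by rewrite mulr_ge0.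
pose N m := (Num.trunc (s ^+ m.+1)).+1.
pose E (m : 'I_n.+1) x := exists k : 'I_(N m),
   [&& (m0 <= m)%N, (3 ^ m <= k ^ 2)%N & ((k ^ 2)%N%:Z %| (ipoly x).[3])%Z].
have cover x : (exists k : nat, ((k ^ 2)%N%:Z %| (ipoly x).[3])%Z /\ (3 ^ m0 <= k ^ 2)%N) ->
   x = [ffun=> inord 1] \/ exists m, E m x.
  move=> [k [kd mk]]; have [kn|kn] := leqP (3 ^ n.+1) (k ^ 2).
    left; apply: horner3_eq0; apply/eqP; rewrite -[_ == _]negbK; apply/negP => n0.
    move/dvdzP: kd n0 (horner3_lt x) => [c ->]; rewrite mulf_eq0 negb_or => /andP[c0 _].
    have -> : (3 : int) ^+ n.+1 = (3 ^ n.+1)%N%:Z by rewrite -[RHS]natz natrX.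
    have : 1 <= `|c| by rewrite -gtz0_ge1 normr_gt0.
    rewrite normrM => c1; have : `|(k ^ 2)%N%:Z| <= `|c| * `|(k ^ 2)%N%:Z| by rewrite ler_peMl.
    lia.
  right; have k20 : (0 < k ^ 2)%N by apply: leq_trans mk; rewrite expn_gt0.
  have /andP[lo hi] := trunc_log_bounds (isT : (1 < 3)%N) k20.
  set m := trunc_log 3 (k ^ 2) in lo hi.
  have mn : (m < n.+1)%N by rewrite -(ltn_exp2l _ _ (isT : (1 < 3)%N)) (leq_ltn_trans lo).
  have m0m : (m0 <= m)%N by rewrite /m; apply: trunc_log_max.
  have kN : (k < N (Ordinal mn))%N.
    rewrite /N; have k_le : k%:R <= s ^+ m.+1.
      rewrite -(ler_pXn2r (ltn0Sn 1)) ?nnegrE ?exprn_ge0 ?ler0n //.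
      rewrite -exprM mulnC exprM ss -!natrX ler_nat; exact: ltnW.
    by rewrite -(@ltr_nat R); apply: le_lt_trans k_le (truncnS_gt _).
  exists (Ordinal mn), (Ordinal kN) => /=.
  by apply/and3P.
apply: le_trans (Pr_le p_ge0 cover) _; apply: le_trans (Pr_or p_ge0 _ _) _.
apply: lerD; first exact: Pr_single.
apply: le_trans (Pr_exists p_ge0 _) _.
have bm (m : 'I_n.+1) : Pr p (E m) <= if (m0 <= m)%N then 4 * rho ^+ m else 0.
  case: ifPn => m0m; last first.
    by rewrite Pr_false // => x [k /and3P[]]; rewrite (negPf m0m).
  apply: le_trans (Pr_exists p_ge0 _) _.
  apply: (@le_trans _ _ (\sum_(k < N m) q ^+ m)).
    apply: ler_sum => k _; have [km|km] := boolP (3 ^ m <= k ^ 2)%N.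
      apply: le_trans (Pr_dvd_horner3 (ltnW (ltn_ord m)) km).
      by apply: Pr_le => // x /and3P[].
    by rewrite Pr_false ?exprn_ge0 // => x /and3P[].
  rewrite sumr_const card_ord -[leLHS]mulr_natl /rho exprMn.
  have -> : 4 * (q ^+ m * s ^+ m) = 4 * s ^+ m * q ^+ m by ring.
  apply: ler_wpM2r; first by rewrite exprn_ge0.
  have sm1 : 1 <= s ^+ m.+1 by rewrite exprn_ege1.
  apply: (@le_trans _ _ (s ^+ m.+1 + s ^+ m.+1)).
    rewrite /N -natr1; apply: lerD => //.
    by have /andP[] := truncn_itv (exprn_ge0 m.+1 s0).
  rewrite exprS -mulrDl ler_wpM2r ?exprn_ge0 //; lra.
apply: le_trans (ler_sum _ (fun m _ => bm m)) _.
have geo N0 : (1 - rho) * (\sum_(m < N0) if (m0 <= m)%N then 4 * rho ^+ m else 0)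
    = 4 * (rho ^+ m0 - rho ^+ (maxn m0 N0)).
  elim: N0 => [|N0 IH]; first by rewrite big_ord0 maxn0 subrr !mulr0.
  rewrite big_ord_recr /= mulrDr IH.
  have [h|h] := leqP m0 N0.
    by rewrite (maxn_idPr (leqW h)) exprS; ring.
  by rewrite (maxn_idPl h); ring.
have r1 : 0 < 1 - rho by rewrite subr_gt0.
rewrite mulrAC ler_pdivlMr // [leLHS]mulrC geo.
have : 0 <= rho ^+ maxn m0 n.+1 by rewrite exprn_ge0.
lra.
Qed.

End Bounds.
End RandomPolynomial.

(** * Double roots at two distinct roots of unity *)

Section TwoRoots.
Variables (n : nat) (R : realType) (p : 'I_3 -> R).
Hypotheses (p_ge0 : forall i, 0 <= p i) (p_sum1 : \sum_(i < 3) p i = 1).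
Implicit Types x y : {ffun 'I_n.+1 -> 'I_3}.

Definition wsum N (g : 'I_N -> 'I_n.+1) x : int := \sum_(i < N) i%:Z * val3 (x (g i)).

(** Stated for every injection [g], so that one bound covers all arithmetic progressions of N
    indices, whatever their step and offset. *)
Definition concentration N : R -> Prop := fun s =>
  forall (g : 'I_N -> 'I_n.+1), injective g -> forall b, Pr p (fun x => wsum g x = b) <= s.

Variable A : numClosedFieldType.
Definition iroot2 (z : A) (P : {poly int}) : Prop := iroot P z /\ iroot P^`() z.

Lemma iroot2P x z : iroot2 z (ipoly x) ->
  \sum_(j < n.+1) (val3 (x j))%:~R * z ^+ j = 0 /\
  \sum_(j < n.+1) (val3 (x j))%:~R * j%:R * z ^+ j = 0.
Proof.
rewrite /iroot2 /iroot => -[]; rewrite {1}/root horner_ipoly => /eqP -> h; split=> //.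
have : ('X * (map_poly intr (ipoly x))^`()).[z] = 0.
  by rewrite hornerM deriv_map (eqP h) mulr0.
rewrite (@horner_coef_wide _ n.+1) => [E|].
  apply: (etrans _ E); apply: eq_bigr => j _; rewrite coefXM coef_deriv.
  case: j => -[|j] jn /=; first by rewrite mulr0 !mul0r.
  by rewrite coef_map /= (coef_ipoly x (Ordinal jn)) mulr_natr.
apply: leq_trans (size_polyMleq _ _) _; rewrite size_polyX add2n /= ltnS.
apply/leq_sizeP => i ni; rewrite coef_deriv nth_default ?mul0rn //.
by apply: leq_trans (size_poly _ _) _; apply: leq_trans (size_ipoly x) _.
Qed.

(** Only the indices in the residue classes 0 and 1 modulo m are left random, and everything is
    compared with one reference realization [w]. As z^m = 1, the conditions on P and z P' at z read
    a + z b = 0, with a and b sums over the two classes; having them at z1 and at z2 gives a = b =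
    0. The two weighted sums are thus both prescribed, and they are independent because the classes
    are disjoint. *)
Lemma Pr_two_double_roots (z1 z2 : A) m N s : (1 < m)%N -> (m * N <= n.+1)%N ->
    z1 ^+ m = 1 -> z2 ^+ m = 1 -> z1 != z2 -> concentration N s ->
  Pr p (fun x => iroot2 z1 (ipoly x) /\ iroot2 z2 (ipoly x)) <= s ^+ 2.
Proof.
move=> m1 mN z1m z2m z12 conc.
have gK (r i : nat) : (r < 2)%N -> (i < N)%N -> (inord (r + m * i)%N : 'I_n.+1) = (r +
  m * i)%N :> nat.
  by move=> r2 iN; rewrite inordK //; apply: leq_trans mN; nia.
pose g (r : nat) (i : 'I_N) : 'I_n.+1 := inord (r + m * i)%N.
have g2inj r r' i i' : (r < 2)%N -> (r' < 2)%N -> g r i = g r' i' -> r = r' /\ i = i'.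
  move=> r2 r2' /(congr1 (@nat_of_ord _)); rewrite !gK // => E.
  have rr' : r = r'.
    have : (r + m * i = r' + m * i' %[mod m])%N by rewrite E.
    rewrite !(addnC _ (m * _)%N) !(mulnC m) !modnMDl !modn_small //; lia.
  split=> //; apply/ord_inj; move: E; rewrite rr' => /addnI/eqP.
  by rewrite eqn_pmul2l ?(ltnW m1) // => /eqP.
have ginj r : (r < 2)%N -> injective (g r).
  by move=> r2 i j /g2inj[].
pose S r : {set 'I_n.+1} := g r @: 'I_N.
have gS r i : g r i \in S r by apply: imset_f.
have S01 r r' i : (r < 2)%N -> (r' < 2)%N -> (g r i \in S r') = (r == r').
  move=> r2 r2'; apply/imsetP/eqP => [[j _ /g2inj[]]//|->]; by exists i.
pose T := S 0%N :|: S 1%N.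
apply: (@Pr_le_resample _ _ _ _ p_ge0 p_sum1 T) => y.
have [[w [Ew1 Ew2]]|nE] := pselect (exists w, iroot2 z1 (ipoly (merge T w y)) /\
   iroot2 z2 (ipoly (merge T w y))); last first.
  by rewrite Pr_false ?sqr_ge0 // => x Ex; apply: nE; exists x.
apply: (@le_trans _ _ (Pr p (fun x => wsum (g 0%N) x = wsum (g 0%N) w /\
                                     wsum (g 1%N) x = wsum (g 1%N) w))).
  apply: Pr_le => // x [Ex1 Ex2].
  pose d j : A := (val3 (x j) - val3 (w j))%:~R.
  have key z (c : nat -> A) : z ^+ m = 1 ->
     \sum_(j < n.+1) (val3 (merge T x y j))%:~R * c j * z ^+ j = 0 ->
     \sum_(j < n.+1) (val3 (merge T w y j))%:~R * c j * z ^+ j = 0 ->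
     \sum_(i < N) d (g 0%N i) * c (m * i)%N + z * \sum_(i < N) d (g 1%N i) * c (1 + m * i)%N = 0.
    move=> zm e1 e2.
    have : \sum_(j in T) d j * c j * z ^+ j = 0.
      have := congr2 (fun u v => u - v) e1 e2; rewrite /= subrr -sumrB => E.
      apply: (etrans _ E); rewrite big_mkcond /=; apply: eq_bigr => j _.
      rewrite !ffunE /d; case: ifP => _; last by rewrite subrr.
      by rewrite rmorphB -!mulrBl.
    have dis : fintype.disjoint (mem (S 0%N)) (mem (S 1%N)).
      rewrite finset.disjoints_subset; apply/fintype.subsetP => j /imsetP[i _ ->].
      by rewrite finset.in_setC S01.
    rewrite (eq_bigl [in [predU S 0%N & S 1%N]]) => [|j]; last by rewrite !inE.
    rewrite (bigU _ _ _ dis) /=.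
    rewrite !big_imset /=; try by move=> ? ? _ _; apply: ginj.
    move=> E; apply: (etrans _ E); rewrite mulr_sumr; congr (_ + _).
      apply: eq_big => // i _; rewrite /g gK // exprM zm expr1n mulr1.
      by rewrite add0n.
    apply: eq_big => // i _; rewrite /g gK // exprD exprM zm expr1n expr1; ring.
  have lin (a b : A) : a + z1 * b = 0 -> a + z2 * b = 0 -> a = 0 /\ b = 0.
    move=> e1 e2; have : (z1 - z2) * b = 0.
      have := congr2 (fun u v => u - v) e1 e2; rewrite /= subrr => E.
      by apply: (etrans _ E); ring.
    move/eqP; rewrite mulf_eq0 subr_eq0 (negPf z12) => /eqP b0.
    by move: e1; rewrite b0 mulr0 addr0.
  have [x10 x11] := iroot2P Ex1; have [x20 x21] := iroot2P Ex2.
  have [w10 w11] := iroot2P Ew1; have [w20 w21] := iroot2P Ew2.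
  have c1 u z : \sum_(j < n.+1) (val3 (u j))%:~R * z ^+ j =
    \sum_(j < n.+1) (val3 (u j))%:~R * 1 * z ^+ j :> A.
    by apply: eq_bigr => j _; rewrite mulr1.
  rewrite !c1 in x10 x20 w10 w20.
  have [a0 a1] := lin _ _ (key _ (fun=> 1) z1m x10 w10) (key _ (fun=> 1) z2m x20 w20).
  have [b0 b1] := lin _ _ (key _ (fun j => j%:R) z1m x11 w11) (key _ (fun j => j%:R) z2m x21 w21).
  (* The weight r + m i becomes i after subtracting r times the unweighted relation and cancelling
     m. *)
  have fin r : \sum_(i < N) d (g r i) * 1 = 0 ->
      \sum_(i < N) d (g r i) * (r + m * i)%N%:R = 0 -> wsum (g r) x = wsum (g r) w.
    move=> e0 e1; apply/eqP; rewrite -subr_eq0 -(intr_eq0 A) /wsum -sumrB.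
    have mA : m%:R != 0 :> A by rewrite pnatr_eq0 -lt0n ltnW.
    apply/eqP/(mulfI mA); rewrite mulr0.
    have e2 : \sum_(i < N) d (g r i) * (r + m * i)%N%:R - r%:R * \sum_(i < N) d (g r i) * 1 = 0.
      by rewrite e0 e1 mulr0 subrr.
    apply: (etrans _ e2); rewrite rmorph_sum !mulr_sumr -sumrB; apply: eq_bigr => i _ /=.
    rewrite -mulrBr rmorphM /= -/(d _) natrD natrM; ring.
  by split; apply: fin => //; rewrite ?b0.
rewrite (@Pr_and_indep _ _ _ _ p_sum1 (S 0%N)).
- by rewrite expr2; apply: ler_pM; rewrite ?Pr_ge0 // conc //; apply: ginj.
- move=> x v; rewrite /wsum; under eq_bigr do rewrite ffunE gS.
  by [].
- move=> x v; rewrite /wsum; under eq_bigr do rewrite ffunE S01 //.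
  by [].
Qed.

End TwoRoots.

(** * Concentration of weighted sums *)

Section Trigonometry.
Variable R : realType.
Implicit Types x y : R.

Lemma ge0_derive_nondecr (f f' : R -> R) : (forall x, is_derive x 1 f (f' x)) ->
  (forall x, 0 <= x -> 0 <= f' x) -> forall x, 0 <= x -> f 0 <= f x.
Proof.
move=> fD f0 x x0.
have dv z : derivable f z 1 by case: (fD z).
apply: (@ger0_derive1_ndecry _ f 0) => //.
- by move=> z; rewrite in_itv /= andbT => z0; rewrite derive1E; have := fD z => fDz;
  rewrite derive_val f0 // ltW.
- by apply: continuous_subspaceT => z; exact/differentiable_continuous/derivable1_diffP.
Qed.

Lemma sin_le_id x : 0 <= x -> sin x <= x.
Proof.
move=> x0; have := @ge0_derive_nondecr (fun z => z - sin z) (fun z => 1 - cos z) _ _ x x0.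
rewrite sin0 subrr subr_ge0; apply => // z z0; by rewrite subr_ge0 cos_le1.
Qed.

Lemma cos_ge_taylor x : 0 <= x -> 1 - x ^+ 2 / 2 <= cos x.
Proof.
move=> x0; have := @ge0_derive_nondecr (fun z => cos z + z ^+ 2 / 2) (fun z => z - sin z) _ _ x x0.
rewrite cos0 expr0n mul0r addr0 lerBlDr; apply.
  by move=> z; apply: is_derive_eq; rewrite /GRing.scale /=; field.
by move=> z z0; rewrite subr_ge0 sin_le_id.
Qed.

Lemma sin_ge_taylor x : 0 <= x -> x - x ^+ 3 / 6 <= sin x.
Proof.
move=> x0; have := @ge0_derive_nondecr (fun z => sin z - z + z ^+ 3 / 6) (fun z => cos z - 1 +
  z ^+ 2 / 2) _ _ x x0.
rewrite sin0 expr0n mul0r addr0 subr0 => h; suff : 0 <= sin x - x + x ^+ 3 / 6 by lra.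
apply: h.
  by move=> z; apply: is_derive_eq; rewrite /GRing.scale /=; field.
by move=> z z0; have := cos_ge_taylor z0; lra.
Qed.

Lemma cos_le_taylor x : 0 <= x -> cos x <= 1 - x ^+ 2 / 2 + x ^+ 4 / 24.
Proof.
move=> x0; have := @ge0_derive_nondecr (fun z => z ^+ 4 / 24 - z ^+ 2 / 2 - cos z) (fun z => z ^+
  3 / 6 - z + sin z) _ _ x x0.
rewrite cos0 !expr0n !mul0r => h; suff : 0 - 0 - 1 <= x ^+ 4 / 24 - x ^+ 2 / 2 - cos x by lra.
apply: h.
  by move=> z; apply: is_derive_eq; rewrite /GRing.scale /=; field.
by move=> z z0; have := sin_ge_taylor z0; lra.
Qed.

Lemma sin_ge_third x : 0 <= x <= 2 -> x / 3 <= sin x.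
Proof.
move=> /andP[x0 x2]; apply: le_trans (sin_ge_taylor x0).
have h : 0 <= 4 - x ^+ 2 by nra.
by have := mulr_ge0 x0 h; lra.
Qed.

Lemma sqr_sin_diff x y : sin (y - x) ^+ 2 <= 2 * (sin x ^+ 2 + sin y ^+ 2).
Proof.
rewrite sinB.
have hx := cos2Dsin2 x; have hy := cos2Dsin2 y.
have cx : cos x ^+ 2 = 1 - sin x ^+ 2 by lra.
have cy : cos y ^+ 2 = 1 - sin y ^+ 2 by lra.
apply: (@le_trans _ _ (2 * (sin y ^+ 2 * cos x ^+ 2 + cos y ^+ 2 * sin x ^+ 2))).
  have := sqr_ge0 (sin y * cos x + cos y * sin x); lra.
rewrite cx cy; have := mulr_ge0 (sqr_ge0 (sin x)) (sqr_ge0 (sin y)); lra.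
Qed.

(** Terms at distance h are paired: their phases differ by h y, so [sqr_sin_diff] removes the
    unknown offset [x0]. *)
Lemma sum_sqr_sin_shift (x0 y : R) N h : (h <= N)%N ->
  (N - h)%:R * sin (h%:R * y) ^+ 2 <= 4 * \sum_(i < N) sin (x0 + i%:R * y) ^+ 2.
Proof.
move=> hN; pose S (i : nat) := sin (x0 + i%:R * y) ^+ 2.
apply: (@le_trans _ _ (\sum_(i < N - h) 2 * (S i + S (i + h)%N))).
  rewrite -[(N - h)%:R]mulr1 -mulrA mul1r mulr_natl -[X in _ *+ X](card_ord (N - h)) -sumr_const.
  apply: ler_sum => i _; apply: le_trans (sqr_sin_diff _ _).
  by rewrite le_eqVlt; apply/orP; left; apply/eqP; congr (sin _ ^+ 2); rewrite natrD; ring.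
rewrite -mulr_sumr big_split /= mulrDr.
have S0 i : 0 <= S i by exact: sqr_ge0.
have h1 : \sum_(i < N - h) S i <= \sum_(i < N) S i.
  rewrite -!(big_mkord xpredT S) [leRHS](big_cat_nat (leq0n (N - h)) (leq_subr h N)) /=.
  by rewrite lerDl sumr_ge0.
have h2 : \sum_(i < N - h) S (i + h)%N <= \sum_(i < N) S i.
  rewrite -(big_mkord xpredT (fun i => S (i + h)%N)) -(big_mkord xpredT S).
  rewrite [leRHS](big_cat_nat (leq0n h) hN) /= -(big_addn 0 N h xpredT S) add0n.
  by rewrite lerDr sumr_ge0.
rewrite -/S; move: h1 h2; lra.
Qed.

(** The gap h is chosen so that h y is as large as sin allows: about N / 2 while N y <= pi, and the
    integer part of pi / (2 y) beyond, where pi / 4 <= h y <= pi / 2. The minimum records these two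
    regimes. *)
Lemma sum_sqr_sin_ge (x0 y : R) N : (1 < N)%N -> 0 <= y <= pi / 2 ->
  N%:R / 1000 * Num.min 1 ((N%:R * y) ^+ 2) <= \sum_(i < N) sin (x0 + i%:R * y) ^+ 2.
Proof.
move=> N1 /andP[y0 ypi].
have pi2 := pihalf_lt2 R; have pi1 := pihalf_ge1 R.
have N0 : 2 <= N%:R :> R by rewrite ler_nat.
have [Ny|Ny] := leP (N%:R * y) pi.
  set h := (N./2)%N.
  have hN : (h <= N)%N by rewrite /h; lia.
  have h3 : (N <= 3 * h)%N by rewrite /h; lia.
  have h2 : (2 * h <= N)%N by rewrite /h; lia.
  have {}h3 : N%:R <= 3 * h%:R :> R by rewrite -natrM ler_nat.
  have {}h2 : 2 * h%:R <= N%:R :> R by rewrite -natrM ler_nat.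
  have hy : 0 <= h%:R * y by rewrite mulr_ge0.
  have := @sin_ge_third (h%:R * y); rewrite hy /= => /(_ _) s3.
  have {s3} s3 : N%:R * y / 9 <= sin (h%:R * y).
    apply: le_trans (s3 _); last by nra.
    have := ler_wpM2r y0 h3; lra.
  have := sum_sqr_sin_shift x0 y hN; rewrite natrB // => shift.
  have sq : (N%:R * y / 9) ^+ 2 <= sin (h%:R * y) ^+ 2.
    apply: lerXn2r => //; rewrite nnegrE ?divr_ge0 ?mulr_ge0 //.
    by apply: le_trans s3; rewrite divr_ge0 ?mulr_ge0.
  have min2 : Num.min 1 ((N%:R * y) ^+ 2) <= (N%:R * y) ^+ 2 by rewrite ge_min lexx orbT.
  set Z := N%:R * (N%:R * y) ^+ 2.
  have Z0 : 0 <= Z by rewrite mulr_ge0 ?sqr_ge0.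
  have fin (z u v w : R) : 0 <= z -> z / 162 <= u -> v <= z / 1000 -> u <= 4 * w -> v <= w.
    by clear; lra.
  apply: (fin Z _ _ _ Z0 _ _ shift).
    have -> : Z / 162 = N%:R / 2 * (N%:R * y / 9) ^+ 2 by rewrite /Z; field.
    by apply: ler_pM; rewrite ?sqr_ge0 ?divr_ge0 //; lra.
  have -> : Z / 1000 = N%:R / 1000 * (N%:R * y) ^+ 2 by rewrite /Z; field.
  by apply: ler_wpM2l min2; apply: divr_ge0; exact: ler0n.
have yp : 0 < y by rewrite lt_def y0 andbT; apply: contraTneq Ny => ->; rewrite mulr0 -leNgt pi_ge0.
set h := Num.trunc (pi / (2 * y)).
have q1 : 1 <= pi / (2 * y) by rewrite ler_pdivlMr ?mulr_gt0 //; lra.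
have /andP[hle hlt] : h%:R <= pi / (2 * y) < h.+1%:R by apply: truncn_itv; apply: le_trans q1.
have h1 : (1 <= h)%N by rewrite -ltnS -(@ltr_nat R); apply: le_lt_trans hlt.
have hyle : h%:R * y <= pi / 2.
  by move: hle; rewrite ler_pdivlMr ?mulr_gt0 //; lra.
have hygt : pi / 4 <= h%:R * y.
  move: hlt; rewrite ltr_pdivrMr ?mulr_gt0 // -natr1.
  have : y <= h%:R * y by rewrite -[leLHS]mul1r ler_wpM2r // ler1n.
  lra.
have hN2 : 2 * h%:R <= N%:R :> R.
  have : 2 * (h%:R * y) <= N%:R * y by lra.
  by rewrite mulrA ler_pM2r.
have hN : (h <= N)%N by rewrite -(@ler_nat R); have := ler0n R h; lra.
have s6 : 1 / 6 <= sin (h%:R * y).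
  by apply: le_trans (sin_ge_third _); [lra|apply/andP; split; lra].
have := sum_sqr_sin_shift x0 y hN; rewrite natrB //.
have sq : (1 / 6) ^+ 2 <= sin (h%:R * y) ^+ 2 by apply: lerXn2r => //; rewrite nnegrE //; lra.
have : N%:R / 2 * (1 / 6) ^+ 2 <= (N%:R - h%:R) * sin (h%:R * y) ^+ 2.
  by apply: ler_pM; rewrite ?sqr_ge0 ?divr_ge0 //; lra.
have : N%:R / 1000 * Num.min 1 ((N%:R * y) ^+ 2) <= N%:R / 1000 * 1.
  by apply: ler_wpM2l; [apply: divr_ge0; exact: ler0n|rewrite ge_min lexx].
move: N0; clear; lra.
Qed.

End Trigonometry.

(** * Characteristic functions and discrete Fourier inversion *)

Section CharacteristicFunction.
Variable R : realType.
Implicit Types (t : R).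

Definition cis t : R[i] := (cos t +i* sin t)%C.

Lemma cis0 : cis 0 = 1. Proof. by rewrite /cis cos0 sin0. Qed.

Lemma cisD (x y : R) : cis (x + y) = cis x * cis y.
Proof.
by rewrite /cis cosD sinD; apply/eqP; rewrite eq_complex /= eqxx /= addrC [cos x * _]mulrC mulrC.
Qed.

Lemma cis_sum (I : finType) (f : I -> R) : cis (\sum_i f i) = \prod_i cis (f i).
Proof. by elim/big_rec2: _ => [|i u v _ <-]; rewrite ?cis0 ?cisD. Qed.

Lemma norm_cis t : `|cis t| = 1.
Proof. by rewrite normc_def /= cos2Dsin2 sqrtr1. Qed.

Lemma cisX t n : cis t ^+ n = cis (n%:R * t).
Proof.
elim: n => [|n IH]; first by rewrite mul0r cis0.
by rewrite exprS IH -cisD -natr1 mulrDl mul1r addrC.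
Qed.

Lemma cis_2pi : cis (2 * pi) = 1.
Proof. by rewrite mulr_natl /cis cos2pi sin2pi. Qed.

Lemma cis_2piz (k : int) : cis (2 * pi * k%:~R) = 1.
Proof.
have H (n : nat) : cis (2 * pi * n%:R) = 1 by rewrite mulrC -cisX cis_2pi expr1n.
case: k => n; first exact: H.
have -> : (Negz n)%:~R = - n.+1%:R :> R by rewrite NegzE mulrNz.
have : cis (2 * pi * - n.+1%:R) * cis (2 * pi * n.+1%:R) = 1.
  by rewrite -cisD mulrN addNr cis0.
by rewrite H mulr1.
Qed.

(** The sum is M if M divides a and 0 otherwise. Only an inequality is claimed because a may be a
    nonzero multiple of M; the order on complex numbers also asserts that the sum is real. *)
Lemma sum_cis_ge0 (M : nat) (a : int) : (0 < M)%N ->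
  (M%:R * (a == 0)%:R : R[i]) <= \sum_(k < M) cis (2 * pi * (k%:R * a%:~R) / M%:R).
Proof.
move=> M0; pose w := cis (2 * pi * a%:~R / M%:R).
have M0' : M%:R != 0 :> R by rewrite pnatr_eq0 -lt0n.
have wM : w ^+ M = 1.
  rewrite cisX -[RHS](cis_2piz a); congr cis; field.
  by rewrite M0'.
rewrite (eq_bigr (fun k : 'I_M => w ^+ k)); last first.
  by move=> k _; rewrite cisX; congr cis; ring.
have [w1|w1] := eqVneq w 1.
  rewrite w1 (eq_bigr (fun=> 1)) => [|k _]; last by rewrite expr1n.
  rewrite sumr_const card_ord ler_piMr ?ler0n //.
  by case: (a == 0).
have [a0|_] := eqVneq a 0.
  by move: w1; rewrite /w a0 mulr0 mul0r cis0 eqxx.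
rewrite mulr0; suff -> : \sum_(k < M) w ^+ k = 0 by [].
have := subrX1 w M; rewrite wM subrr => /esym/eqP.
by rewrite mulf_eq0 subr_eq0 (negPf w1) => /eqP.
Qed.

Lemma sum3E (V : nmodType) (F : 'I_3 -> V) :
  \sum_(i < 3) F i = F (inord 0) + F (inord 1) + F (inord 2).
Proof.
rewrite !big_ord_recl big_ord0 addr0 addrA; congr (F _ + F _ + F _);
by apply/ord_inj; rewrite inordK.
Qed.

Variable p : 'I_3 -> R.
Hypotheses (p_ge0 : forall i, 0 <= p i) (p_sum1 : \sum_(i < 3) p i = 1).

Definition charfun t : R[i] := \sum_(a < 3) (p a)%:C%C * cis (t * (val3 a)%:~R).

(* The quantity with |charfun t|^2 <= exp (- spread * sin^2 t); it is the variance when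
   [p (inord 1) = 0]. *)
Definition spread : R :=
  p (inord 1) * (p (inord 0) + p (inord 2)) + 4 * p (inord 0) * p (inord 2).

Lemma charfunE t : charfun t =
  ((p (inord 1) + (p (inord 0) + p (inord 2)) * cos t) +i*
    ((p (inord 2) - p (inord 0)) * sin t))%C.
Proof.
have v0 : val3 (inord 0) = -1 by rewrite /val3 inordK.
have v1 : val3 (inord 1) = 0 by rewrite /val3 inordK.
have v2 : val3 (inord 2) = 1 by rewrite /val3 inordK.
rewrite /charfun sum3E v0 v1 v2 /cis mulr0 mulrN1 mulr1 cosN sinN cos0 sin0.
by apply/eqP; rewrite eq_complex /=; apply/andP; split; apply/eqP; ring.
Qed.

(** With a, b, c the three atoms, |charfun t|^2 = 1 - 2 b (a + c)(1 - cos t) - 4 a c sin^2 t, and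
    sin^2 t <= 2 (1 - cos t). The decay is in sin^2 t, not t^2, since without an atom at 0 the
    modulus returns to 1 at t = pi. *)
Lemma charfun_norm_le t : `|charfun t| <= (expR (- (spread / 2) * sin t ^+ 2))%:C%C.
Proof.
have sq : `|charfun t| ^+ 2 <= ((expR (- (spread / 2) * sin t ^+ 2)) ^+ 2)%:C%C.
  rewrite -expRM_natl -mulr_natl charfunE -add_Re2_Im2 lecR /=.
  set a := p (inord 0); set b := p (inord 1); set c := p (inord 2).
  have abc : a + b + c = 1 by rewrite -p_sum1 sum3E.
  have a0 : 0 <= a := p_ge0 _; have b0 : 0 <= b := p_ge0 _; have c0 : 0 <= c := p_ge0 _.
  apply: (@le_trans _ _ (1 - spread * sin t ^+ 2)); last first.
    apply: le_trans (expR_ge1Dx _); rewrite le_eqVlt; apply/orP; left; apply/eqP; by field.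
  have -> : (b + (a + c) * cos t) ^+ 2 + ((c - a) * sin t) ^+ 2 =
     1 - 2 * b * (a + c) * (1 - cos t) - 4 * a * c * sin t ^+ 2.
    have -> : b = 1 - a - c by rewrite -abc; ring.
    by rewrite exprMn sin2cos2; ring.
  have h : sin t ^+ 2 <= 2 * (1 - cos t).
    rewrite sin2cos2; have := sqr_ge0 (1 - cos t); lra.
  have bac : 0 <= b * (a + c) by rewrite mulr_ge0 ?addr_ge0.
  rewrite /spread -/a -/b -/c; have := ler_wpM2l bac h; lra.
have e0 : 0 <= (expR (- (spread / 2) * sin t ^+ 2))%:C%C :> R[i] by rewrite ler0c expR_ge0.
by move: sq; rewrite rmorphXn /= ler_pXn2r // nnegrE.
Qed.

Lemma expectation_cis (I : finType) (th : I -> R) :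
  \sum_(x : {ffun I -> 'I_3}) (weight p x)%:C%C * cis (\sum_i th i * (val3 (x i))%:~R)
   = \prod_i charfun (th i).
Proof.
rewrite /charfun -(sum_weight_prod p (fun i a => cis (th i * (val3 a)%:~R))).
by apply: eq_bigr => x _; rewrite cis_sum.
Qed.

Lemma prod_charfun_le (I : finType) (th : I -> R) (P : pred I) :
  `|\prod_(i | P i) charfun (th i)|
     <= (expR (- (spread / 2) * \sum_(i | P i) sin (th i) ^+ 2))%:C%C.
Proof.
rewrite normr_prod mulr_sumr expR_sum rmorph_prod /=; apply: ler_prod => i _.
by rewrite normr_ge0 charfun_norm_le.
Qed.

Lemma charfun0 : charfun 0 = 1.
Proof.
rewrite charfunE cos0 sin0 mulr0 mulr1; have := p_sum1; rewrite sum3E => e.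
by apply/eqP; rewrite eq_complex /= eqxx andbT -e; apply/eqP; ring.
Qed.

Lemma Pr_wsum_le n N (g : 'I_N -> 'I_n.+1) (b : int) (M : nat) : injective g -> (0 < M)%N ->
  M%:R * Pr p (fun x => wsum g x = b) <=
  \sum_(k < M) expR (- (spread / 2) * \sum_(i < N) sin (2 * pi * (k%:R * i%:R) / M%:R) ^+ 2).
Proof.
move=> ginj M0; rewrite -lecR.
have -> : (M%:R * Pr p (fun x => wsum g x = b))%:C%C =
    \sum_(x : {ffun 'I_n.+1 -> 'I_3}) (weight p x)%:C%C * (M%:R * (`[< wsum g x = b >])%:R) :> R[i].
  rewrite rmorphM /= rmorph_nat /Pr rmorph_sum mulr_sumr /=; apply: eq_bigr => x _.
  by rewrite rmorphM /= rmorph_nat mulrCA.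
apply: (@le_trans _ _ (\sum_(x : {ffun 'I_n.+1 -> 'I_3}) (weight p x)%:C%C *
    \sum_(k < M) cis (2 * pi * (k%:R * (wsum g x - b)%:~R) / M%:R))).
  apply: ler_sum => x _; apply: ler_wpM2l.
    by rewrite ler0c weight_ge0.
  apply: le_trans (sum_cis_ge0 _ M0); rewrite ler_wpM2l // subr_eq0.
  case: asboolP => [->|_]; first by rewrite eqxx.
  by case: eqP.
set V := (X in X <= _).
have V0 : 0 <= V.
  apply: sumr_ge0 => x _; apply: mulr_ge0; first by rewrite ler0c weight_ge0.
  apply: le_trans (sum_cis_ge0 _ M0); by rewrite mulr_ge0 ?ler0n.
have VS : V = \sum_(k < M) \sum_(x : {ffun 'I_n.+1 -> 'I_3}) (weight p x)%:C%C *
    cis (2 * pi * (k%:R * (wsum g x - b)%:~R) / M%:R).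
  by rewrite exchange_big /=; apply: eq_bigr => x _; rewrite mulr_sumr.
rewrite {}VS in V0 *.
set S := \sum_(k < M) _.
have Sreal : `|S| <= (\sum_(k < M) expR (- (spread / 2) * \sum_(i < N) sin (2 * pi * (k%:R * i%:R) / M%:R) ^+ 2))%:C%C.
  apply: le_trans (ler_norm_sum _ _ _) _; rewrite rmorph_sum /=; apply: ler_sum => k _.
  pose u : R := 2 * pi * k%:R / M%:R.
  pose th (j : 'I_n.+1) : R := \sum_(i < N | g i == j) u * i%:R.
  have thg i : th (g i) = u * i%:R.
    rewrite /th (bigD1 i) //= big1 ?addr0 // => i' /andP[/eqP/ginj -> ]; by rewrite eqxx.
  have -> : \sum_(x : {ffun 'I_n.+1 -> 'I_3}) (weight p x)%:C%C *
       cis (2 * pi * (k%:R * (wsum g x - b)%:~R) / M%:R) =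
       cis (- (u * b%:~R)) * \prod_j charfun (th j).
    rewrite -expectation_cis mulr_sumr; apply: eq_bigr => x _.
    rewrite [RHS]mulrCA -cisD; congr (_ * cis _).
    have -> : \sum_j th j * (val3 (x j))%:~R = u * (wsum g x)%:~R.
      rewrite /wsum rmorph_sum mulr_sumr /th.
      under eq_bigr do rewrite mulr_suml.
      rewrite (exchange_big_dep xpredT) //=; apply: eq_bigr => i _.
      by rewrite (big_pred1 (g i)) ?rmorphM /= ?mulrA // => j; rewrite eq_sym.
    by rewrite rmorphB /u /=; ring.
  rewrite normrM norm_cis mul1r.
  rewrite (bigID [pred j | j \in g @: 'I_N]) /= normrM.
  have h1 : `|\prod_(j | j \in g @: 'I_N) charfun (th j)| <=
     (expR (- (spread / 2) * \sum_(i < N) sin (2 * pi * (k%:R * i%:R) / M%:R) ^+ 2))%:C%C.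
    apply: le_trans (prod_charfun_le _ _) _.
    rewrite big_imset /=; last by move=> ? ? _ _; apply: ginj.
    rewrite le_eqVlt; apply/orP; left; apply/eqP; congr (expR (_ * _))%:C%C.
    by apply: eq_big => // i _; rewrite thg /u; congr (sin _ ^+ 2); ring.
  rewrite [X in _ * `|X|]big1 ?normr1 ?mulr1 // => j jg.
  rewrite /th big_pred0 ?charfun0 // => i; apply/negbTE; apply: contraNneq jg => <-.
  exact: imset_f.
by apply: le_trans Sreal; rewrite ger0_norm.
Qed.

Lemma sqr_sinDpin t n : sin (t + n%:R * pi) ^+ 2 = sin t ^+ 2.
Proof.
elim: n => [|n IH]; first by rewrite mul0r addr0.
by rewrite -natr1 mulrDl mul1r addrA sinDpi sqrrN.
Qed.

(** sin^2 is even and has period pi, so only the distance u from 2 k to the nearest multiple of M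
    matters. It is nonzero because M is odd. *)
Lemma sqr_sin_residue (M k : nat) : odd M -> (0 < k < M)%N ->
  exists2 u : nat, (0 < u)%N && (2 * u <= M)%N &
    forall i, sin (2 * pi * (k%:R * i%:R) / M%:R) ^+ 2 = sin (0 + i%:R * (pi * u%:R / M%:R)) ^+
      2 :> R.
Proof.
move=> Mo kM.
have M0 : M%:R != 0 :> R by rewrite pnatr_eq0; lia.
have [k1|k1] := leqP (4 * k) M.
  exists (2 * k)%N; first by apply/andP; split; lia.
  by move=> j; congr (sin _ ^+ 2); rewrite natrM add0r; ring.
have [k2|k2] := leqP (2 * k) M.
  exists (M - 2 * k)%N; first by apply/andP; split; lia.
  move=> j; rewrite -[LHS]sqrrN -sinN -[LHS](sqr_sinDpin _ j) add0r; congr (sin _ ^+ 2).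
  by rewrite natrB // natrM; field.
have [k3|k3] := leqP (4 * k) (3 * M).
  exists (2 * k - M)%N; first by apply/andP; split; lia.
  move=> j; rewrite add0r -[RHS](sqr_sinDpin _ j); congr (sin _ ^+ 2).
  by rewrite natrB ?natrM; [field|lia].
exists (2 * M - 2 * k)%N; first by apply/andP; split; lia.
move=> j; rewrite -[LHS]sqrrN -sinN -[LHS](sqr_sinDpin _ (2 * j)) add0r; congr (sin _ ^+ 2).
by rewrite natrB ?natrM; [field|lia].
Qed.

Lemma spread_ge0 : 0 <= spread.
Proof. by rewrite /spread addr_ge0 ?mulr_ge0 ?addr_ge0. Qed.

(* Discrete Fourier inversion modulo the odd number 2 K^5 + 1. *)
Lemma concentrationP n K : (1 < K)%N ->
  @concentration n R p (K ^ 4) (K%:R ^- 5 + expR (- (spread / 4500) * K%:R ^+ 2)).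
Proof.
move=> K1 g ginj b; pose M := (2 * K ^ 5).+1.
have K0 : 0 < K%:R :> R by rewrite ltr0n ltnW.
have MK : K%:R ^+ 5 <= M%:R :> R by rewrite -natrX ler_nat /M; lia.
have M0 : 0 < M%:R :> R by rewrite ltr0n.
have := Pr_wsum_le b ginj (ltn0Sn _ : (0 < M)%N).
rewrite -ler_pdivlMl // => h; apply: (le_trans h) => {h}.
set c := - (spread / 4500) * _.
have bound (k : 'I_M) : expR (- (spread / 2) * \sum_(i < K ^ 4) sin (2 * pi * (k%:R * i%:R) / M%:R) ^+ 2)
    <= (k == ord0)%:R + expR c.
  have [->|k0] := eqVneq k ord0.
    apply: (@le_trans _ _ 1); last by rewrite lerDl expR_ge0.
    rewrite expR_le1 mulNr oppr_le0 mulr_ge0 ?divr_ge0 ?spread_ge0 //.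
    by apply: sumr_ge0 => i _; exact: sqr_ge0.
  rewrite add0r ler_expR /c !mulNr lerN2.
  have [u /andP[u0 uM] uE] : exists2 u : nat, (0 < u)%N && (2 * u <= M)%N &
    forall i, sin (2 * pi * (k%:R * i%:R) / M%:R) ^+ 2 = sin (0 + i%:R * (pi * u%:R / M%:R)) ^+
      2 :> R.
    apply: sqr_sin_residue; rewrite ?ltn_ord ?andbT ?lt0n //.
    by rewrite /M oddS oddM.
  under eq_bigr do rewrite uE.
  set y := pi * u%:R / M%:R.
  have N1 : (1 < K ^ 4)%N by rewrite -[1%N](exp1n 4) ltn_exp2r.
  have y0 : 0 <= y by rewrite /y divr_ge0 ?mulr_ge0 ?pi_ge0 ?ler0n.
  have ypi : y <= pi / 2.
    have uM' : 2 * u%:R <= M%:R :> R by rewrite -natrM ler_nat.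
    by rewrite /y ler_pdivrMr //; have := ler_wpM2l (pi_ge0 R) uM'; clear; lra.
  have := @sum_sqr_sin_ge R 0 y (K ^ 4)%N N1; rewrite y0 ypi => /(_ isT) h.
  apply: (@le_trans _ _ (spread / 2 * ((K ^ 4)%N%:R / 1000 * Num.min 1 (((K ^ 4)%N%:R * y) ^+
    2)))); last first.
    by apply: ler_wpM2l h; rewrite divr_ge0 ?spread_ge0.
  have s0 := spread_ge0.
  (* A nonzero frequency satisfies y >= 2 / M and M <= 3 K^5. So (K^4 y)^2 >= 4 / (9 K^2), and the
     exponent is at least spread / 2 times K^4 / 1000 times 4 / (9 K^2): this is the origin of
     4500. *)
  have Ky : 2 / (3 * K%:R) <= (K ^ 4)%N%:R * y.
    have ylb : 2 / M%:R <= y.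
      rewrite /y ler_pM2r ?invr_gt0 //; apply: (@le_trans _ _ (2 * 1)); first by rewrite mulr1.
      by apply: ler_pM => //; [exact: pi_ge2|rewrite ler1n].
    apply: le_trans (ler_wpM2l (ler0n R (K ^ 4)) ylb).
    rewrite mulrA ler_pdivrMr ?mulr_gt0 // mulrAC ler_pdivlMr //.
    have -> : (K ^ 4)%N%:R * 2 * (3 * K%:R) = 2 * (3 * K%:R ^+ 5) :> R by rewrite natrX; ring.
    rewrite ler_pM2l // /M -natrX -natrM ler_nat.
    have : (0 < K ^ 5)%N by rewrite expn_gt0 (ltnW K1).
    by move: (K ^ 5)%N => k5; clear; lia.
  have sqKy : 4 / (9 * K%:R ^+ 2) <= ((K ^ 4)%N%:R * y) ^+ 2.
    have -> : 4 / (9 * K%:R ^+ 2) = (2 / (3 * K%:R)) ^+ 2 :> R.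
      by field; rewrite gt_eqF.
    apply: lerXn2r Ky; rewrite nnegrE; last by rewrite mulr_ge0 ?ler0n.
    by rewrite divr_ge0 ?mulr_ge0 ?ler0n.
  have minb : 4 / (9 * K%:R ^+ 2) <= Num.min 1 (((K ^ 4)%N%:R * y) ^+ 2).
    rewrite le_min sqKy andbT ler_pdivrMr ?mulr_gt0 ?exprn_gt0 // mul1r.
    have : 1 <= K%:R ^+ 2 :> R by apply: exprn_ege1; rewrite ler1n; exact: ltnW.
    lra.
  have c0 : 0 <= spread / 2 * ((K ^ 4)%N%:R / 1000) by apply: mulr_ge0; apply: divr_ge0;
    rewrite ?ler0n.
  rewrite [leRHS]mulrA; apply: le_trans (ler_wpM2l c0 minb).
  rewrite le_eqVlt; apply/orP; left; apply/eqP; rewrite natrX; field.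
  by rewrite gt_eqF.
apply: (@le_trans _ _ (M%:R^-1 * (1 + M%:R * expR c))).
  rewrite ler_pM2l ?invr_gt0 //; apply: le_trans (ler_sum _ (fun k _ => bound k)) _.
  rewrite big_split /= sumr_const card_ord -[X in _ + X]mulr_natl lerD2r.
  by rewrite (bigD1 ord0) //= big1 ?addr0 // => k /negPf ->.
rewrite mulrDr mulr1 mulKf ?gt_eqF // lerD2r lef_pV2 // posrE exprn_gt0 //.
Qed.

End CharacteristicFunction.

(** * The local limit theorem *)

Section GaussianApproximation.
Variable R : realType.
Implicit Types (t w : R).

Lemma norm_complex_le (z : R[i]) : `|z| <= (`|complex.Re z| + `|complex.Im z|)%:C%C.
Proof.
rewrite normc_def lecR; set a := complex.Re z; set b := complex.Im z.
rewrite -(ler_pXn2r (ltn0Sn 1)) ?nnegrE ?sqrtr_ge0 ?addr_ge0 //.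
rewrite sqr_sqrtr ?addr_ge0 ?sqr_ge0 // sqrrD !real_normK ?num_real //.
by rewrite addrAC lerDl mulrn_wge0 // mulr_ge0.
Qed.

Lemma norm_Re_le (z : R[i]) r : `|z| <= r%:C%C -> `|complex.Re z| <= r.
Proof. by move=> zr; rewrite -lecR; apply: le_trans zr; exact: normc_ge_Re. Qed.

(** Factors are exchanged one at a time, the remaining ones having modulus at most 1. *)
Lemma prod_diff_le (I : finType) (a b : I -> R[i]) (e : I -> R) :
    (forall i, `|a i| <= 1) -> (forall i, `|b i| <= 1) ->
    (forall i, `|a i - b i| <= (e i)%:C%C) ->
  `|\prod_i a i - \prod_i b i| <= (\sum_i e i)%:C%C.
Proof.
move=> a1 b1 abe.
suff [] : `|\prod_i a i - \prod_i b i| <= (\sum_i e i)%:C%C /\ `|\prod_i b i| <= 1 by [].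
elim/big_rec3: _ => [|i u v s _ [IH v1]]; first by rewrite subrr normr0 normr1.
split; last by rewrite normrM mulr_ile1.
have -> : a i * s - b i * v = (a i - b i) * v + a i * (s - v) by ring.
rewrite rmorphD /=; apply: le_trans (ler_normD _ _) _; rewrite !normrM.
apply: lerD.
  by apply: le_trans (abe i); rewrite ler_piMr.
by apply: le_trans IH; rewrite ler_piMl.
Qed.

Lemma expRN_bounds w : 0 <= w -> 1 - w <= expR (- w) /\ expR (- w) <= 1 - w + w ^+ 2.
Proof.
move=> w0; split; first by have := expR_ge1Dx (- w).
have h := expR_ge1Dx w; rewrite expRN.
have e0 : 0 < expR w := expR_gt0 w.
rewrite -[leLHS]mul1r ler_pdivrMr //.
have h2 : 0 <= 1 - w + w ^+ 2 by nra.
have := ler_wpM2l h2 h.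
have := mulr_ge0 w0 (sqr_ge0 w).
have -> : (1 - w + w ^+ 2) * (1 + w) = 1 + w * w ^+ 2 by ring.
lra.
Qed.

Lemma sin_le_taylor t : 0 <= t -> `|sin t - t| <= t ^+ 3 / 6.
Proof.
move=> t0; rewrite ler_norml; have := sin_ge_taylor t0; have := sin_le_id t0.
have : 0 <= t ^+ 3 by rewrite exprn_ge0.
by move=> h1 h2 h3; apply/andP; split; lra.
Qed.

(** Real and imaginary parts of the comparison between a random sign of mean mu and the Gaussian
    with the same mean and with variance 1 - mu^2. For t >= 0 the Taylor bounds of sin and cos apply
    directly; negative t follows by conjugation. *)
Lemma charfun_approx_ge0 (mu t : R) : `|mu| <= 1 -> 0 <= t <= 1 ->
  `|cos t - cos (mu * t) * expR (- ((1 - mu ^+ 2) * t ^+ 2 / 2))| <= t ^+ 3 /\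
  `|mu * sin t - sin (mu * t) * expR (- ((1 - mu ^+ 2) * t ^+ 2 / 2))| <= t ^+ 3.
Proof.
move=> mu1 /andP[t0 t1]; set w := (1 - mu ^+ 2) * t ^+ 2 / 2; set E := expR (- w).
have m2 : mu ^+ 2 <= 1 by rewrite -real_normK ?num_real // expr_le1.
have m0 : 0 <= mu ^+ 2 by exact: sqr_ge0.
have T2 : 0 <= t ^+ 2 by exact: sqr_ge0.
have w0 : 0 <= w by rewrite /w divr_ge0 ?mulr_ge0 // subr_ge0.
have [El Eu] := expRN_bounds w0; rewrite -/E in El Eu.
have wt : w <= t ^+ 2 / 2 by rewrite /w ler_pM2r ?invr_gt0 // ler_piMl // lerBlDr lerDl.
have E0 : 0 <= E by exact: expR_ge0.
have E1 : E <= 1 by rewrite expR_le1 oppr_le0.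
have t43 : t ^+ 4 <= t ^+ 3 by rewrite exprSr ler_piMr // exprn_ge0.
have t40 : 0 <= t ^+ 4 by rewrite exprn_ge0.
have w2 : w ^+ 2 <= t ^+ 4 / 4.
  have -> : t ^+ 4 / 4 = (t ^+ 2 / 2) ^+ 2 by field.
  by rewrite lerXn2r // nnegrE ?divr_ge0.
set s := `|mu| * t.
have s0 : 0 <= s by rewrite mulr_ge0.
have st : s <= t by rewrite ler_piMl.
have cmu : cos (mu * t) = cos s by rewrite /s -(ger0_norm t0) -normrM cos_norm (ger0_norm t0).
have s2 : s ^+ 2 = mu ^+ 2 * t ^+ 2 by rewrite exprMn real_normK ?num_real.
have s4 : s ^+ 4 <= t ^+ 4 by rewrite lerXn2r // nnegrE.
have s3 : s ^+ 3 <= t ^+ 3 by rewrite lerXn2r // nnegrE.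
split.
  have := cos_ge_taylor t0; have := cos_le_taylor t0.
  rewrite cmu; have := cos_ge_taylor s0; have := cos_le_taylor s0; rewrite s2.
  set C := cos t; set D := cos s => Du Dl Cu Cl.
  have Dl' : 0 <= D - (1 - mu ^+ 2 * t ^+ 2 / 2) by lra.
  have Du' : D - (1 - mu ^+ 2 * t ^+ 2 / 2) <= t ^+ 4 / 24 by lra.
  set r2 := D - (1 - mu ^+ 2 * t ^+ 2 / 2) in Dl' Du'.
  set r3 := E - (1 - w).
  have r30 : 0 <= r3 by rewrite /r3; lra.
  have r31 : r3 <= t ^+ 4 / 4 by rewrite /r3; lra.
  (* With w = (1 - mu^2) t^2 / 2 the second-order terms cancel, as t^2 / 2 = mu^2 t^2 / 2 + w; each
     of the four pieces left is O(t^4). *)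
  have -> : C - D * E = (C - (1 - t ^+ 2 / 2)) - mu ^+ 2 * t ^+ 2 / 2 * w - r2 * E
     - (1 - mu ^+ 2 * t ^+ 2 / 2) * r3.
    have -> : D = r2 + (1 - mu ^+ 2 * t ^+ 2 / 2) by rewrite /r2; ring.
    have -> : E = r3 + (1 - w) by rewrite /r3; ring.
    by rewrite /w; field.
  have mt : mu ^+ 2 * t ^+ 2 <= 1 by rewrite mulr_ile1 // expr_le1.
  have mt0 : 0 <= mu ^+ 2 * t ^+ 2 by rewrite mulr_ge0.
  have b1 : 0 <= mu ^+ 2 * t ^+ 2 / 2 * w by rewrite mulr_ge0 // divr_ge0.
  have b2 : mu ^+ 2 * t ^+ 2 / 2 * w <= t ^+ 4 / 4.
    have -> : t ^+ 4 / 4 = (t ^+ 2 / 2) * (t ^+ 2 / 2) by field.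
    apply: ler_pM => //; first by rewrite divr_ge0.
    by rewrite ler_pM2r ?invr_gt0 // ler_piMl.
  have b3 : 0 <= r2 * E by rewrite mulr_ge0.
  have b4 : r2 * E <= t ^+ 4 / 24 by apply: le_trans Du'; rewrite ler_piMr.
  have b5 : 0 <= (1 - mu ^+ 2 * t ^+ 2 / 2) * r3 by rewrite mulr_ge0 //; lra.
  have b6 : (1 - mu ^+ 2 * t ^+ 2 / 2) * r3 <= t ^+ 4 / 4.
    by apply: le_trans r31; rewrite ler_piMl //; lra.
  move: b1 b2 b3 b4 b5 b6 Cl Cu t43 t40; clear.
  move: (mu ^+ 2 * t ^+ 2 / 2 * w) (r2 * E) ((1 - mu ^+ 2 * t ^+ 2 / 2) * r3) (t ^+ 4) (t ^+
    3) (t ^+ 2).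
  by move=> a b c T4 T3 T2 *; rewrite ler_norml; apply/andP; split; lra.
have sgE : sin (mu * t) = Num.sg mu * sin s.
  by rewrite -sin_sg /s mulrA -numEsg.
have muE : mu = Num.sg mu * `|mu| by rewrite -numEsg.
have r4 := sin_le_taylor t0; have r5 := sin_le_taylor s0.
have -> : mu * sin t - sin (mu * t) * E =
   mu * (sin t - t) - Num.sg mu * ((sin s - s) * E) + mu * t * (1 - E).
  rewrite sgE; have -> : mu * t * (1 - E) = mu * t - Num.sg mu * s * E.
    by rewrite /s [Num.sg _ * _]mulrA -numEsg; ring.
  ring.
have sg1 : `|Num.sg mu| <= 1 by rewrite normr_sg; case: (_ == _).
have c1 : `|mu * (sin t - t)| <= t ^+ 3 / 6.
  by rewrite normrM; apply: le_trans r4; rewrite ler_piMl.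
have c2 : `|Num.sg mu * ((sin s - s) * E)| <= t ^+ 3 / 6.
  rewrite !normrM (ger0_norm E0); apply: le_trans (_ : `|sin s - s| <= _).
    by apply: le_trans (_ : `|sin s - s| * E <= _); rewrite ?ler_piMl ?ler_piMr ?mulr_ge0.
  by apply: le_trans r5 _; rewrite ler_pM2r ?invr_gt0.
have c3 : `|mu * t * (1 - E)| <= t ^+ 3 / 2.
  have -> : t ^+ 3 / 2 = 1 * t * (t ^+ 2 / 2) by field.
  rewrite !normrM (ger0_norm t0); apply: ler_pM; rewrite ?mulr_ge0 ?ler_wpM2r //.
  by rewrite ger0_norm ?subr_ge0 //; lra.
apply: le_trans (ler_normD _ _) _; apply: le_trans (lerD (ler_normB _ _) (lexx _)) _.
have : 0 <= t ^+ 3 by rewrite exprn_ge0.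
lra.
Qed.

Lemma charfun_approx (mu t : R) : `|mu| <= 1 -> `|t| <= 1 ->
  `|(cos t +i* (mu * sin t))%C - cis (mu * t) * (expR (- ((1 - mu ^+ 2) * t ^+ 2 / 2)))%:C%C|
    <= (2 * `|t| ^+ 3)%:C%C.
Proof.
move=> mu1 t1; apply: le_trans (norm_complex_le _) _; rewrite lecR.
have h01 : 0 <= `|t| <= 1 by rewrite normr_ge0.
have [hr hi] := charfun_approx_ge0 mu1 h01.
have nt2 : `|t| ^+ 2 = t ^+ 2 by rewrite real_normK ?num_real.
rewrite nt2 in hr hi; set E := expR _ in hr hi *.
have -> : (cos t +i* (mu * sin t))%C - cis (mu * t) * E%:C%C =
    ((cos t - cos (mu * t) * E) +i* (mu * sin t - sin (mu * t) * E))%C.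
  by apply/eqP; rewrite eq_complex /= !mulr0 subr0 add0r !eqxx.
rewrite /= mulr_natl mulr2n; case: (lerP 0 t) => t0.
  by rewrite (ger0_norm t0) in hr hi *; apply: lerD.
rewrite (ltr0_norm t0) in hr hi *; apply: lerD.
  by move: hr; rewrite mulrN !cosN.
by move: hi; rewrite mulrN !sinN mulrN mulNr -opprD normrN.
Qed.

End GaussianApproximation.

(** * Gaussian integrals, orthogonality of cosines, dominated convergence *)

Section Integrals.
Variable R : realType.
Let mu := @lebesgue_measure R.
Implicit Types (f g : R -> R).

Definition gaussian (k : R) (x : R) : R := expR (- (k * x ^+ 2)).

Lemma gaussian_normal_pdf k : 0 < k ->
  gaussian k = fun x => Num.sqrt (pi / k) * normal_pdf 0 (Num.sqrt (k *+ 2)^-1) x.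
Proof.
move=> k0; apply/funext => x.
have k2 : 0 < (k *+ 2)^-1 by rewrite invr_gt0 mulrn_wgt0.
have s0 : Num.sqrt (k *+ 2)^-1 != 0 by rewrite gt_eqF // sqrtr_gt0.
rewrite normal_pdfE // /normal_peak /normal_fun sqr_sqrtr ?(ltW k2) // subr0.
have -> : pi / k = (k *+ 2)^-1 * pi *+ 2 by field; rewrite gt_eqF.
rewrite mulrA mulfV ?mul1r; last first.
  by rewrite gt_eqF // sqrtr_gt0 mulrn_wgt0 // mulr_gt0 // pi_gt0.
by rewrite /gaussian; congr expR; field; rewrite gt_eqF.
Qed.

Lemma integrable_gaussian k : 0 < k -> mu.-integrable setT (EFin \o gaussian k).
Proof.
move=> k0; rewrite (gaussian_normal_pdf k0).
have := @integrableZl _ _ R mu setT measurableT (Num.sqrt (pi / k)) _ (integrable_normal_pdf 0 (Num.sqrt (k *+ 2)^-1)).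
by congr integrable; apply/funext => x /=.
Qed.

Lemma integral_gaussian k : 0 < k -> \int[mu]_x gaussian k x = Num.sqrt (pi / k).
Proof.
move=> k0; rewrite (gaussian_normal_pdf k0) RintegralZl //; last exact: integrable_normal_pdf.
by rewrite /Rintegral integral_normal_pdf /= mulr1.
Qed.

Lemma dominated_cvg_Rintegral (f_ : nat -> R -> R) f g :
    (forall n, measurable_fun setT (f_ n)) -> measurable_fun setT f ->
    (forall x, f_ n x @[n --> \oo] --> f x) ->
    mu.-integrable setT (EFin \o g) -> (forall n x, `|f_ n x| <= g x) ->
  \int[mu]_x f_ n x @[n --> \oo] --> \int[mu]_x f x.
Proof.
move=> mf_ mf ff ig fg.
have [] := @dominated_convergence _ _ _ mu setT measurableT (fun n =>
  EFin \o f_ n) (EFin \o f) (EFin \o g).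
- by move=> n; apply/measurable_EFinP; exact: mf_.
- exact/measurable_EFinP.
- by apply: aeW => x _; apply: cvg_EFin; [exact: nearW|exact: ff].
- exact: ig.
- by apply: aeW => x k _; rewrite /= lee_fin; exact: fg.
move=> ifin _ h.
have h' : (fun n => (\int[mu]_x (f_ n x)%:E)%E) @ \oo --> (\int[mu]_x f x)%:E.
  by rewrite /Rintegral fineK //; exact: integrable_fin_num.
exact: (fine_cvg h').
Qed.

Lemma continuous_segment_integrable f (a b : R) : continuous f ->
  mu.-integrable `[a, b] (EFin \o f).
Proof.
move=> cf; apply: continuous_compact_integrable; first exact: segment_compact.
exact: continuous_subspaceT.
Qed.

Lemma continuous_sum (I : finType) (F : I -> R -> R) :
  (forall i, continuous (F i)) -> continuous (fun x => \sum_i F i x).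
Proof.
move=> cF; apply: continuous_big => [|i _]; [exact: add_continuous|exact: cF].
Qed.

Lemma Rintegral_sum (I : finType) (F : I -> R -> R) (a b : R) :
  (forall i, continuous (F i)) ->
  \int[mu]_(x in `[a, b]) (\sum_i F i x) = \sum_i \int[mu]_(x in `[a, b]) F i x.
Proof.
move=> cF.
suff H (s : seq I) : \int[mu]_(x in `[a, b]) (\sum_(i <- s) F i x) =
  \sum_(i <- s) \int[mu]_(x in `[a, b]) F i x.
  exact: H.
elim: s => [|i s IH].
  rewrite big_nil; under eq_Rintegral do rewrite big_nil.
  by rewrite Rintegral_cst // mul0r.
rewrite big_cons -IH; under eq_Rintegral do rewrite big_cons.
rewrite RintegralD //; first exact: continuous_segment_integrable.
by apply: continuous_segment_integrable; apply: continuous_big => [|j _];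
  [exact: add_continuous|exact: cF].
Qed.

Lemma is_derive_continuous f f' : (forall x : R, is_derive x 1 f (f' x)) -> continuous f.
Proof.
move=> D x; apply/differentiable_continuous/derivable1_diffP; by case: (D x).
Qed.

Lemma integral_cos (T c : R) (m : int) : 0 < T ->
  \int[mu]_(x in `[- (T / 2), T / 2]) cos (2 * pi * m%:~R / T * x + c)
   = if m == 0 then T * cos c else 0.
Proof.
move=> T0; have ab : - (T / 2) < T / 2 by lra.
case: eqVneq => [->|m0].
  under eq_Rintegral do rewrite mulr0 !mul0r add0r.
  rewrite Rintegral_cst // mulrC; congr (_ * _).
  have e : mu [set` `[- (T / 2), T / 2]] = (T / 2 - - (T / 2))%:E.
    by have := @lebesgue_measure_itv R `[- (T / 2), T / 2]; rewrite /= lte_fin ab -EFinB.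
  by apply: etrans (congr1 fine e) _; rewrite /=; field.
set al := 2 * pi * m%:~R / T.
have al0 : al != 0.
  by rewrite /al !mulf_eq0 invr_eq0 intr_eq0 (negPf m0) !gt_eqF ?pi_gt0.
have D (x : R) : is_derive x 1 (fun x => al^-1 * sin (al * x + c)) (cos (al * x + c)).
  by apply: is_derive_eq; rewrite /GRing.scale /=; field.
have D' (x : R) : is_derive x 1 (fun x => cos (al * x + c)) (- (al * sin (al * x + c))).
  by apply: is_derive_eq; rewrite /GRing.scale /=; ring.
rewrite /Rintegral (@continuous_FTC2 _ _ (fun x => al^-1 * sin (al * x + c))) //.
- rewrite -EFinB /=.
  have -> : al * (T / 2) + c = (al * - (T / 2) + c) + (2 * pi * m%:~R).
    by rewrite /al; field; rewrite gt_eqF.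
  have per (y : R) : sin (y + 2 * pi * m%:~R) = sin y.
    have H (n : nat) (z : R) : sin (z + 2 * pi * n%:R) = sin z.
      elim: n => [|n IH]; first by rewrite mulr0 addr0.
      by rewrite -IH -[RHS]sinD2pi; congr sin; rewrite -natr1; ring.
    case: m {m0 al al0 D D'} => n; first exact: H.
    by rewrite NegzE mulrNz mulrN -[LHS](H n.+1); congr sin; ring.
  by rewrite per subrr.
- apply: continuous_subspaceT; exact: is_derive_continuous D'.
- split.
  + by move=> x _; case: (D x).
  + by apply: cvg_at_right_filter; exact: (is_derive_continuous D).
  + by apply: cvg_at_left_filter; exact: (is_derive_continuous D).
- by move=> x _; rewrite derive1E; have := D x => Dx; rewrite derive_val.
Qed.

End Integrals.

Section LocalLimit.
Variables (R : realType) (p : 'I_3 -> R).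
Hypotheses (p_ge0 : forall i, 0 <= p i) (p_sum1 : \sum_(i < 3) p i = 1).
Hypothesis p10 : p (inord 1) = 0.
Implicit Types (u v s t : R) (n : nat).

(** For c = 1 this is P(-1), and for c_j = j it is -P'(-1). *)
Definition altsum n (c : nat -> int) (x : {ffun 'I_n.+1 -> 'I_3}) : int :=
  \sum_(j < n.+1) (-1) ^+ j * c j * val3 (x j).

Definition rootN n : R := Num.sqrt n.+1%:R.

Definition phase n s t (j : nat) : R := pi * (s + (j%:R - n%:R / 2) * t).

(* The integrand after centring the phase at n / 2 and rescaling by sqrt (n + 1) and
   (n + 1)^(3/2), which makes the limiting covariance diagonal. *)
Definition Fint n u v : R :=
  complex.Re (\prod_(j < n.+1) charfun p ((-1) ^+
    j * phase n (u / rootN n) (v / (n.+1%:R * rootN n)) j)).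

Lemma rootN_gt0 n : 0 < rootN n. Proof. by rewrite sqrtr_gt0. Qed.

Lemma sqr_rootN n : rootN n ^+ 2 = n.+1%:R. Proof. by rewrite sqr_sqrtr. Qed.

Lemma Re_sum (I : finType) (F : I -> R[i]) : complex.Re (\sum_i F i) = \sum_i complex.Re (F i).
Proof. by apply: (big_morph (@complex.Re R)) => // -[a b] [c d]. Qed.

Lemma FintE n u v : Fint n u v = \sum_(x : {ffun 'I_n.+1 -> 'I_3}) weight p x *
  cos (pi * (u / rootN n) * (altsum (fun=> 1) x)%:~R
       + pi * (v / (n.+1%:R * rootN n)) * ((altsum (fun j =>
         j%:Z) x)%:~R - n%:R / 2 * (altsum (fun=> 1) x)%:~R)).
Proof.
rewrite /Fint -expectation_cis Re_sum; apply: eq_bigr => x _.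
rewrite -[LHS]/(complex.Re ((weight p x)%:C%C * cis _)) /= mul0r subr0; congr (_ * cos _).
rewrite /altsum !rmorph_sum !mulr_sumr -sumrB mulr_sumr -big_split /=.
apply: eq_bigr => j _; rewrite /phase !rmorphM !rmorphXn rmorphN1 /= mulr1 -[(j%:Z)%:~R]/(j%:R);
  ring.
Qed.

Definition sinsum n s t : R := \sum_(j < n.+1) sin (phase n s t j) ^+ 2.

Lemma sin_sign_sqr (j : nat) t : sin ((-1) ^+ j * t) ^+ 2 = sin t ^+ 2.
Proof.
by rewrite -signr_odd; case: (odd j); rewrite ?expr0 ?mul1r // expr1 mulN1r sinN sqrrN.
Qed.

Lemma Fint_le n u v :
  `|Fint n u v| <= expR (- (spread p / 2) * sinsum n (u / rootN n) (v / (n.+1%:R * rootN n))).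
Proof.
apply: norm_Re_le; apply: le_trans (prod_charfun_le p_ge0 p_sum1 _ _) _.
rewrite lecR ler_expR; under eq_bigr do rewrite sin_sign_sqr.
by [].
Qed.

(** The estimate sees only the increment pi t of the phases, hence is uniform in [s]. *)
Lemma sinsum_ge_v n s t : (0 < n)%N -> `|t| <= 1 / 2 ->
  n.+1%:R / 1000 * Num.min 1 ((n.+1%:R * (pi * t)) ^+ 2) <= sinsum n s t.
Proof.
move=> n0 t2; have pi0 := pi_gt0 R.
have H s' t' : 0 <= t' <= 1 / 2 -> n.+1%:R / 1000 * Num.min 1 ((n.+1%:R * (pi * t')) ^+ 2) <=
  sinsum n s' t'.
  move=> /andP[t0 t1].
  have y2 : 0 <= pi * t' <= pi / 2.
    apply/andP; split; first by rewrite mulr_ge0 // ltW.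
    by have := ler_wpM2l (ltW pi0) t1; lra.
  apply: le_trans (@sum_sqr_sin_ge R (pi * (s' - n%:R / 2 * t')) (pi * t') n.+1 n0 y2) _.
  rewrite le_eqVlt; apply/orP; left; apply/eqP; apply: eq_bigr => j _.
  by congr (sin _ ^+ 2); rewrite /phase; ring.
have [t0|t0] := lerP 0 t; first by apply: H; rewrite t0; move: t2; rewrite ger0_norm.
have := H (- s) (- t); rewrite oppr_ge0 (ltW t0) -ltr0_norm // t2 => /(_ isT).
rewrite ltr0_norm // !mulrN sqrrN => h; apply: le_trans h _.
rewrite le_eqVlt; apply/orP; left; apply/eqP; apply: eq_bigr => j _.
by rewrite -[RHS]sqrrN -sinN; congr (sin _ ^+ 2); rewrite /phase; ring.
Qed.

(** Reflecting j to n - j changes t into -t, so each term may be averaged with its mirror image: the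
    mean of sin^2(a + b) and sin^2(a - b) is at least sin^2 a cos^2 b. The condition on t keeps |b|
    <= 1/2, so the second factor is bounded below. *)
Lemma sinsum_ge_u n s t : `|s| <= 1 / 2 -> n.+1%:R * `|t| <= 1 / 4 ->
  2 / 9 * (n.+1%:R * s ^+ 2) <= sinsum n s t.
Proof.
move=> s2 nt.
have pi2 := pihalf_lt2 R; have pi1 := pihalf_ge1 R.
have sym : sinsum n s t = \sum_(j < n.+1) sin (phase n s (- t) j) ^+ 2.
  rewrite /sinsum (reindex_inj rev_ord_inj) /=; apply: eq_bigr => j _.
  congr (sin _ ^+ 2); rewrite /phase subSS natrB; last by rewrite -ltnS.
  by field.
have -> : sinsum n s t = \sum_(j < n.+1) (sin (phase n s t j) ^+ 2 + sin (phase n s (- t) j) ^+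
  2) / 2.
  by rewrite -mulr_suml big_split /= -sym -/(sinsum n s t); field.
apply: (@le_trans _ _ (\sum_(j < n.+1) 2 / 9 * s ^+ 2)).
  by rewrite sumr_const card_ord -[leRHS]mulr_natl mulrCA.
apply: ler_sum => j _.
set a := pi * s; set b := pi * ((j%:R - n%:R / 2) * t).
have -> : phase n s t j = a + b by rewrite /phase /a /b; ring.
have -> : phase n s (- t) j = a - b by rewrite /phase /a /b; ring.
have jn : `|j%:R - n%:R / 2| <= n.+1%:R / 2 :> R.
  have jn : j%:R <= n%:R :> R by rewrite ler_nat -ltnS.
  have j0 : 0 <= j%:R :> R by [].
  by rewrite ler_norml -natr1; apply/andP; split; lra.
have b12 : `|b| <= 1 / 2.
  rewrite /b !normrM (ger0_norm (pi_ge0 R)).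
  have h : `|j%:R - n%:R / 2| * `|t| <= 1 / 8.
    by apply: le_trans (ler_wpM2r (normr_ge0 t) jn) _; lra.
  have := ler_wpM2l (pi_ge0 R) h; lra.
have cb : 7 / 8 <= cos b.
  rewrite -cos_norm; apply: le_trans (cos_ge_taylor (normr_ge0 b)).
  have := ler_pM (normr_ge0 b) (normr_ge0 b) b12 b12; rewrite -expr2; lra.
have sa : (2 / 3 * s) ^+ 2 <= sin a ^+ 2.
  have H s' : 0 <= s' <= 1 / 2 -> (2 / 3 * s') ^+ 2 <= sin (pi * s') ^+ 2.
    move=> /andP[s0 s1]; have h1 := ler_wpM2l (pi_ge0 R) s1.
    have h2 : 2 * s' <= pi * s' by rewrite ler_wpM2r // pi_ge2.
    have h3 : 2 / 3 * s' <= sin (pi * s').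
      by apply: le_trans (sin_ge_third _); [lra|apply/andP; split; lra].
    by rewrite lerXn2r // nnegrE; lra.
  rewrite /a; have [s0|s0] := lerP 0 s; first by apply: H; rewrite s0; move: s2; rewrite ger0_norm.
  have := H (- s); rewrite oppr_ge0 (ltW s0) -ltr0_norm // s2 => /(_ isT).
  by rewrite ltr0_norm // !mulrN sinN !sqrrN.
rewrite sinD sinB.
have : (sin a * cos b) ^+ 2 <= ((sin a * cos b + cos a * sin b) ^+ 2 +
  (sin a * cos b - cos a * sin b) ^+ 2) / 2.
  have := sqr_ge0 (cos a * sin b); lra.
apply: le_trans; rewrite exprMn.
have c2 : 1 / 2 <= cos b ^+ 2 by nra.
have := ler_pM (sqr_ge0 _) (_ : 0 <= 1 / 2) sa c2; rewrite exprMn => /(_ _) h.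
by apply: le_trans (h _); lra.
Qed.

End LocalLimit.

Section LocalLimit.
Variables (R : realType) (p : 'I_3 -> R).
Hypotheses (p_ge0 : forall i, 0 <= p i) (p_sum1 : \sum_(i < 3) p i = 1).
Hypothesis p10 : p (inord 1) = 0.
Implicit Types (u v s t : R) (n : nat).
Let drift := p (inord 2) - p (inord 0).

Lemma sum_alt (n : nat) : \sum_(j < n.*2) (-1) ^+ j = 0 :> R.
Proof.
elim: n => [|n IH]; first by rewrite big_ord0.
by rewrite doubleS !big_ord_recr /= IH exprS mulN1r add0r subrr.
Qed.

Lemma sum_alt_id (n : nat) : \sum_(j < n.*2) (-1) ^+ j * j%:R = - n%:R :> R.
Proof.
elim: n => [|n IH]; first by rewrite big_ord0 oppr0.
rewrite doubleS !big_ord_recr /= IH exprS -signr_odd odd_double expr0 -!natr1; ring.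
Qed.

Lemma sum_centered (n : nat) : \sum_(j < n.+1) (j%:R - n%:R / 2) = 0 :> R.
Proof.
have H (c : R) m : \sum_(j < m) (j%:R - c) = m%:R * (m%:R - 1) / 2 - m%:R * c.
  elim: m => [|m IH]; first by rewrite big_ord0; ring.
  by rewrite big_ord_recr /= IH -natr1; field.
by rewrite H -natr1; field.
Qed.

Lemma sum_centered_sqr (n : nat) :
  \sum_(j < n.+1) (j%:R - n%:R / 2) ^+ 2 = n.+1%:R * (n.+1%:R ^+ 2 - 1) / 12 :> R.
Proof.
have H (c : R) m : \sum_(j < m) (j%:R - c) ^+ 2 =
    m%:R * (m%:R - 1) * (2 * m%:R - 1) / 6 - c * m%:R * (m%:R - 1) + m%:R * c ^+ 2.
  elim: m => [|m IH]; first by rewrite big_ord0; ring.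
  by rewrite big_ord_recr /= IH -natr1; field.
by rewrite H -natr1; field.
Qed.

Lemma spreadE : spread p = 1 - drift ^+ 2.
Proof.
have := p_sum1; rewrite sum3E p10 addr0 => e.
rewrite /spread /drift p10 mul0r add0r; have -> : p (inord 2) = 1 - p (inord 0) by lra.
ring.
Qed.

Lemma drift_le1 : `|drift| <= 1.
Proof.
have := p_sum1; rewrite sum3E p10 addr0 => e.
have := p_ge0 (inord 0); have := p_ge0 (inord 2).
by rewrite /drift ler_norml => h1 h2; apply/andP; split; lra.
Qed.

Lemma charfun_pm1 t : charfun p t = (cos t +i* (drift * sin t))%C.
Proof.
have := p_sum1; rewrite sum3E p10 addr0 => e.
by rewrite charfunE p10 add0r e mul1r.
Qed.

(** The real part of the product of Gaussian approximations at r = 1 / [rootN]. The cosine carries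
    the drift, through sum_j (-1)^j j = -(n+1)/2; the term r^4 comes from sum_j (j - n/2)^2 = N (N^2
    - 1) / 12 with N = n + 1. The Gaussian limit is the value at r = 0. *)
Definition limit_profile (r u v : R) : R :=
  cos (drift * (- (pi * v * r / 2))) *
  expR (- (spread p / 2 * (pi ^+ 2 * (u ^+ 2 + v ^+ 2 * (1 - r ^+ 4) / 12)))).

(** Each of the n + 1 angles is at most pi (|u| + |v|) / [rootN], and each factor costs twice the
    cube of its angle. *)
Lemma Fint_approx n u v : ~~ odd n.+1 -> pi * (`|u| + `|v|) <= rootN R n ->
  `|Fint p n u v - limit_profile (rootN R n)^-1 u v|
     <= 2 * (pi * (`|u| + `|v|)) ^+ 3 / rootN R n.
Proof.
move=> nev small; set rN := rootN R n in small *.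
have r0 : 0 < rN := rootN_gt0 R n.
have rN2 : rN ^+ 2 = n.+1%:R := sqr_rootN R n.
have r1 : rN != 0 by rewrite gt_eqF.
set s := u / rN; set t := v / (n.+1%:R * rN).
pose th (j : nat) : R := (-1) ^+ j * phase n s t j.
have N0 : 0 < n.+1%:R :> R by [].
have thle (j : 'I_n.+1) : `|th j| <= pi * (`|u| + `|v|) / rN.
  rewrite /th /phase !normrM normrX normrN1 expr1n mul1r (ger0_norm (pi_ge0 R)) -mulrA.
  apply: ler_wpM2l; first exact: pi_ge0.
  rewrite ler_pdivlMr //; apply: le_trans (ler_wpM2r (ltW r0) (ler_normD _ _)) _.
  rewrite mulrDl; apply: lerD.
    by rewrite /s normrM normfV (gtr0_norm r0) mulfVK.
  have jn : `|j%:R - n%:R / 2| <= n.+1%:R :> R.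
    have jn : j%:R <= n%:R :> R by rewrite ler_nat -ltnS.
    have j0 : 0 <= j%:R :> R by [].
    by rewrite ler_norml -natr1; apply/andP; split; lra.
  rewrite /t normrM normrM normfV normrM (gtr0_norm r0) (gtr0_norm N0) invfM.
  rewrite -!mulrA mulVf // mulr1 mulrCA -[leRHS]mulr1; apply: ler_wpM2l => //.
  by rewrite ler_pdivrMr // mul1r.
have thle1 (j : 'I_n.+1) : `|th j| <= 1 by apply: le_trans (thle j) _; rewrite ler_pdivrMr // mul1r.
pose b (j : 'I_n.+1) : R[i] := cis (drift * th j) * (expR (- (spread p * th j ^+ 2 / 2)))%:C%C.
have prodb : complex.Re (\prod_j b j) = limit_profile rN^-1 u v.
  have ReM (y z : R) : complex.Re (cis y * z%:C%C) = cos y * z by rewrite /= mulr0 subr0.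
  rewrite /b big_split /= -cis_sum -rmorph_prod -expR_sum ReM /limit_profile.
  rewrite -mulr_sumr.
  have -> : \sum_(i < n.+1) th i = - (pi * v * rN^-1 / 2).
    rewrite /th /phase (eq_bigr (fun j : 'I_n.+1 => (pi * (s - n%:R / 2 * t)) * (-1) ^+ j +
      pi * t * ((-1) ^+ j * j%:R))) => [|j _]; last by ring.
    rewrite big_split /= -!mulr_sumr.
    have -> : n.+1 = (n.+1)./2.*2 by rewrite -[LHS]odd_double_half (negPf nev).
    rewrite sum_alt sum_alt_id mulr0 add0r /t.
    have -> : n.+1%:R = 2 * (n.+1)./2%:R :> R.
      by rewrite -{1}[n.+1]odd_double_half (negPf nev) add0n -mul2n natrM.
    have h0 : (n.+1)./2%:R != 0 :> R by rewrite pnatr_eq0; move: nev; case: (n) => [|[|k]].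
    by field; rewrite ?r1 ?h0.
  congr (_ * expR _); rewrite sumrN -mulr_suml -mulr_sumr; congr (- _).
  have -> : \sum_(i < n.+1) th i ^+ 2 = pi ^+ 2 * (u ^+ 2 + v ^+ 2 * (1 - rN^-1 ^+ 4) / 12).
    rewrite (eq_bigr (fun j : 'I_n.+1 => (pi * s) ^+ 2 + (2 * pi ^+ 2 * s * t) * (j%:R - n%:R / 2)
       + (pi * t) ^+ 2 * (j%:R - n%:R / 2) ^+ 2)) => [|j _]; last first.
      by rewrite /th exprMn -exprM mulnC exprM sqrrN expr1n expr1n mul1r /phase; ring.
    rewrite !big_split /= sumr_const card_ord -!mulr_sumr sum_centered sum_centered_sqr mulr0 addr0.
    by rewrite -[_ *+ n.+1]mulr_natl /s /t -rN2; field.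
  ring.
rewrite -prodb /Fint -/rN -/s -/t.
have Re_sub (z w : R[i]) : complex.Re z - complex.Re w = complex.Re (z - w) by case: z; case: w.
rewrite Re_sub; apply: norm_Re_le.
have c1 : (1 : R[i]) = (1 : R)%:C%C by [].
apply: le_trans (@prod_diff_le _ _ _ _ (fun=> 2 * (pi * (`|u| + `|v|) / rN) ^+ 3) _ _ _) _.
- move=> j; apply: le_trans (charfun_norm_le p_ge0 p_sum1 _) _.
  rewrite c1 lecR expR_le1 mulNr oppr_le0 mulr_ge0 ?sqr_ge0 //.
  by rewrite divr_ge0 ?spread_ge0.
- move=> j; rewrite normrM norm_cis mul1r normc_def /= expr0n addr0 sqrtr_sqr.
  rewrite c1 lecR ger0_norm ?expR_ge0 // expR_le1 oppr_le0.
  by rewrite divr_ge0 // mulr_ge0 ?sqr_ge0 ?spread_ge0.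
- move=> j; rewrite charfun_pm1 /b spreadE; apply: le_trans (charfun_approx drift_le1 (thle1 j)) _.
  rewrite lecR ler_wpM2l // lerXn2r // nnegrE.
  by rewrite divr_ge0 ?(ltW r0) // mulr_ge0 ?pi_ge0 // addr_ge0.
rewrite lecR sumr_const card_ord -[leLHS]mulr_natl -rN2 le_eqVlt; apply/orP; left; apply/eqP.
by field.
Qed.

Lemma cvg_inv_rootN : (rootN R (4 * k + 3))^-1 @[k --> \oo] --> 0.
Proof.
have -> : (fun k => (rootN R (4 * k + 3))^-1) = (fun k => Num.sqrt (harmonic k / 4)).
  apply/funext => k; rewrite /rootN -sqrtrV //; congr Num.sqrt; rewrite /= -invfM.
  by congr (_^-1); rewrite -natrM; congr (_%:R); lia.
rewrite -[X in _ --> X](sqrtr0 R).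
apply: continuous_cvg; first exact: sqrt_continuous.
by rewrite -[X in _ --> X](mul0r 4^-1); apply: cvgMl; exact: cvg_harmonic.
Qed.

Lemma Fint_cvg u v : Fint p (4 * k + 3) u v @[k --> \oo] -->
  gaussian (spread p / 2 * pi ^+ 2) u * gaussian (spread p / 24 * pi ^+ 2) v.
Proof.
have lp : limit_profile (rootN R (4 * k + 3))^-1 u v @[k --> \oo] --> limit_profile 0 u v.
  have c (g : R -> R) : continuous g -> g (rootN R (4 * k + 3))^-1 @[k --> \oo] --> g 0.
    by move=> cg; exact: (cvg_comp _ _ cvg_inv_rootN (cg 0)).
  apply: (c (fun r => limit_profile r u v)) => r; apply: cvgM.
    apply: continuous_comp; last exact: continuous_cos.
    apply: cvgMr; apply: cvgN; apply: cvgMl; apply: cvgMr; exact: cvg_id.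
  apply: continuous_comp; last exact: continuous_expR.
  apply: cvgN; apply: cvgMr; apply: cvgMr; apply: cvgD; first exact: cvg_cst.
  apply: cvgMl; apply: cvgMr; apply: cvgB; first exact: cvg_cst.
  exact: exprn_continuous.
have -> : gaussian (spread p / 2 * pi ^+ 2) u * gaussian (spread p / 24 * pi ^+ 2) v =
  limit_profile 0 u v.
  rewrite /limit_profile /gaussian mulr0 mul0r oppr0 mulr0 cos0 mul1r -expRD; congr expR.
  by rewrite expr0n /= subr0; field.
have er : 2 * (pi * (`|u| + `|v|)) ^+ 3 * (rootN R (4 * k + 3))^-1 @[k --> \oo] --> 0.
  by rewrite -[X in _ --> X](mulr0 (2 * (pi * (`|u| + `|v|)) ^+ 3)); apply: cvgMr;
    exact: cvg_inv_rootN.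
rewrite -[X in _ --> X]add0r.
have -> : (fun k => Fint p (4 * k + 3) u v) = (fun k => (Fint p (4 * k + 3) u v -
   limit_profile (rootN R (4 * k + 3))^-1 u v) + limit_profile (rootN R (4 * k + 3))^-1 u v).
  by apply/funext => k; rewrite subrK.
apply: cvgD => //.
have M0 : 0 < pi * (`|u| + `|v|) + 1 by rewrite ltr_wpDl // mulr_ge0 ?pi_ge0 ?addr_ge0.
apply/norm_cvg0P; apply: (squeeze_cvgr _ (cvg_cst 0) er).
near=> k; rewrite normr_ge0 /=; apply: Fint_approx; first by rewrite -addn1 oddD; lia.
have r0 := rootN_gt0 R (4 * k + 3).
apply: ltW; apply: (@lt_trans _ _ (pi * (`|u| + `|v|) + 1)); first by rewrite ltrDl.
rewrite -[ltRHS]invrK -[ltLHS]invrK ltf_pV2 ?posrE ?invr_gt0 //.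
near: k; apply: (cvgr_lt _ cvg_inv_rootN).
by rewrite invr_gt0 ltr_wpDl // mulr_ge0 ?pi_ge0 ?addr_ge0.
Unshelve. all: by end_near. Qed.

End LocalLimit.

Section LocalLimit.
Variables (R : realType) (p : 'I_3 -> R).
Hypotheses (p_ge0 : forall i, 0 <= p i) (p_sum1 : \sum_(i < 3) p i = 1).
Hypothesis p10 : p (inord 1) = 0.
Implicit Types (u v s t : R) (n : nat).
Let mu := @lebesgue_measure R.

(** On the support every coefficient is 2 [x_j = 2] - 1, so a weighted sum has the parity of its
    weights. This gives the divisibility obstruction, and it also halves the domain of the inversion
    integral. *)
Lemma altsum_half n (c : nat -> int) (x : {ffun 'I_n.+1 -> 'I_3}) : weight p x != 0 ->
  exists m : int, altsum c x = 2 * m - \sum_(j < n.+1) (-1) ^+ j * c j.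
Proof.
move=> w0; exists (\sum_(j < n.+1) (-1) ^+ j * c j * (x j == inord 2)%:R).
rewrite /altsum mulr_sumr -sumrB; apply: eq_bigr => j _.
have : x j != inord 1.
  apply: contraNneq w0 => xj; rewrite /weight (bigD1 j) //= xj p10 mul0r //.
have : (x j < 3)%N := ltn_ord (x j).
have e2 : x j = inord 2 -> val3 (x j) = 1 by move=> ->; rewrite /val3 inordK.
have e0 : x j = inord 0 -> val3 (x j) = -1 by move=> ->; rewrite /val3 inordK.
have [x2 _ _|x2 lt x1] := eqVneq (x j) (inord 2).
  by rewrite (e2 x2) /= !mulr1; ring.
rewrite e0; first by rewrite !mulr0 sub0r mulrN1.
apply/ord_inj; rewrite inordK //; move: x2 x1; rewrite -!(inj_eq val_inj) /= !inordK //.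
by case: (nat_of_ord (x j)) lt => [|[|[|]]].
Qed.

Lemma sum_alt_int (n : nat) : \sum_(j < n.*2) (-1) ^+ j * 1 = 0 :> int.
Proof.
elim: n => [|n IH]; first by rewrite big_ord0.
by rewrite doubleS !big_ord_recr /= IH exprS; ring.
Qed.

Lemma sum_alt_id_int (n : nat) : \sum_(j < n.*2) (-1) ^+ j * j%:Z = - n%:Z :> int.
Proof.
elim: n => [|n IH]; first by rewrite big_ord0 oppr0.
by rewrite doubleS !big_ord_recr /= IH exprS -signr_odd odd_double expr0; lia.
Qed.

Lemma altsum1_even n (x : {ffun 'I_n.+1 -> 'I_3}) : (4 %| n.+1)%N -> weight p x != 0 ->
  exists m : int, altsum (fun=> 1) x = 2 * m.
Proof.
move=> n4 /(altsum_half (fun=> 1))[m ->]; exists m.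
have -> : n.+1 = (n.+1)./2.*2 by lia.
by rewrite sum_alt_int subr0.
Qed.

Lemma altsum_id_even n (x : {ffun 'I_n.+1 -> 'I_3}) : (4 %| n.+1)%N -> weight p x != 0 ->
  exists m : int, altsum (fun j => j%:Z) x = 2 * m.
Proof.
move=> n4 /(altsum_half (fun j => j%:Z))[m ->].
exists (m + (n.+1 %/ 4)%N%:Z).
have -> : \sum_(j < n.+1) (-1) ^+ j * j%:Z = - ((n.+1)./2)%:Z.
  by rewrite -sum_alt_id_int; have -> : (n.+1)./2.*2 = n.+1 by lia.
lia.
Qed.

Definition prob0 n : R :=
  Pr p (fun x : {ffun 'I_n.+1 -> 'I_3} => altsum (fun=> 1) x = 0 /\ altsum (fun j => j%:Z) x = 0).

(* The inner integral of the Fourier inversion formula. *)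
Definition slice n v : R :=
  \sum_(x : {ffun 'I_n.+1 -> 'I_3}) weight p x * (altsum (fun=> 1) x == 0)%:R *
    (rootN R n * cos (pi * (v / (n.+1%:R * rootN R n)) * (altsum (fun j => j%:Z) x)%:~R)).

Lemma eq_continuous1 (f g : R -> R) : f =1 g -> continuous g -> continuous f.
Proof. by move=> /funext ->. Qed.

Lemma continuous_cos_affine (w a c : R) : continuous (fun x => w * cos (a * x + c)).
Proof.
have D (x : R) : is_derive x 1 (fun x => w * cos (a * x + c)) (- (w * a * sin (a * x + c))).
  by apply: is_derive_eq; rewrite /GRing.scale /=; ring.
exact: is_derive_continuous D.
Qed.

Lemma continuous_Fint_l n v : continuous (fun u => Fint p n u v).
Proof.
under eq_fun do rewrite FintE.
apply: continuous_sum => x.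
apply: eq_continuous1 (@continuous_cos_affine (weight p x) (pi / rootN R n * (altsum (fun=>
  1) x)%:~R)
  (pi * (v / (n.+1%:R * rootN R n)) * ((altsum (fun j => j%:Z) x)%:~R - n%:R / 2 * (altsum (fun=>
    1) x)%:~R))) => u.
congr (_ * cos (_ + _)); ring.
Qed.

(** As the alternating sum is an even number 2 m, the cosine runs through m full periods over an
    interval of length [rootN], although its phase involves pi and not 2 pi. *)
Lemma sliceE n v : (4 %| n.+1)%N ->
  \int[mu]_(u in `[- (rootN R n / 2), rootN R n / 2]) Fint p n u v = slice n v.
Proof.
move=> n4; have r0 := rootN_gt0 R n.
pose a (x : {ffun 'I_n.+1 -> 'I_3}) : R := pi / rootN R n * (altsum (fun=> 1) x)%:~R.
pose c (x : {ffun 'I_n.+1 -> 'I_3}) : R := pi * (v / (n.+1%:R * rootN R n)) * ((altsum (fun j =>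
  j%:Z) x)%:~R - n%:R / 2 * (altsum (fun=> 1) x)%:~R).
have -> : (fun u => Fint p n u v) = (fun u => \sum_x weight p x * cos (a x * u + c x)).
  apply/funext => u; rewrite FintE //; apply: eq_bigr => x _.
  by rewrite /a /c; congr (_ * cos (_ + _)); ring.
rewrite Rintegral_sum; last by move=> x; exact: continuous_cos_affine.
apply: eq_bigr => x _; have [w0|w0] := eqVneq (weight p x) 0.
  rewrite w0 !mul0r; under eq_Rintegral do rewrite mul0r.
  by rewrite Rintegral_cst // mul0r.
rewrite RintegralZl //; last first.
  apply: continuous_segment_integrable.
  by apply: eq_continuous1 (@continuous_cos_affine 1 (a x) (c x)) => u; rewrite mul1r.
rewrite -mulrA; congr (_ * _).
have [m mE] := altsum1_even n4 w0.
have aE : a x = 2 * pi * m%:~R / rootN R n by rewrite /a mE rmorphM /=; ring.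
rewrite aE integral_cos // mE mulf_eq0 /=; case: eqVneq => [m0|_]; last by rewrite mul0r.
by rewrite mul1r /c mE m0 !mulr0 subr0.
Qed.

Lemma continuous_slice n : continuous (slice n).
Proof.
apply: continuous_sum => x.
apply: eq_continuous1 (@continuous_cos_affine (weight p x * (altsum (fun=> 1) x ==
  0)%:R * rootN R n)
   (pi / (n.+1%:R * rootN R n) * (altsum (fun j => j%:Z) x)%:~R) 0) => v.
rewrite -[RHS]mulrA; congr (_ * (_ * cos _)); ring.
Qed.

Lemma integral_slice n : (4 %| n.+1)%N ->
  \int[mu]_(v in `[- (n.+1%:R * rootN R n / 2), n.+1%:R * rootN R n / 2]) slice n v
    = n.+1%:R ^+ 2 * prob0 n.
Proof.
move=> n4; have r0 := rootN_gt0 R n.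
have T0 : 0 < n.+1%:R * rootN R n by rewrite mulr_gt0.
pose b (x : {ffun 'I_n.+1 -> 'I_3}) : R := pi / (n.+1%:R * rootN R n) * (altsum (fun j =>
  j%:Z) x)%:~R.
pose w (x : {ffun 'I_n.+1 -> 'I_3}) : R := weight p x * (altsum (fun=> 1) x == 0)%:R * rootN R n.
have -> : slice n = (fun v => \sum_x w x * cos (b x * v + 0)).
  apply/funext => v; apply: eq_bigr => x _.
  by rewrite /b /w -[RHS]mulrA; congr (_ * (_ * cos _)); ring.
rewrite Rintegral_sum; last by move=> x; exact: continuous_cos_affine.
rewrite /prob0 /Pr mulr_sumr; apply: eq_bigr => x _.
rewrite RintegralZl //; last first.
  apply: continuous_segment_integrable.
  by apply: eq_continuous1 (@continuous_cos_affine 1 (b x) 0) => u; rewrite mul1r.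
rewrite /w; have [->|w0] := eqVneq (weight p x) 0; first by rewrite !mul0r mulr0.
have [m mE] := altsum_id_even n4 w0.
have bE : b x = 2 * pi * m%:~R / (n.+1%:R * rootN R n) by rewrite /b mE rmorphM /=; ring.
rewrite bE integral_cos // cos0 mulr1 asbool_and mE.
have -> : `[< (2 * m = 0 :> int) >] = (m == 0).
  by apply/asboolP/eqP => [|->]; [lia|rewrite mulr0].
have -> : `[< altsum (fun=> 1) x = 0 >] = (altsum (fun=> 1) x == 0).
  by apply/asboolP/eqP.
case: (altsum _ x == 0) => /=; last by rewrite !(mulr0, mul0r).
case: (m == 0); last by rewrite !mulr0.
by rewrite !mulr1 -(sqr_rootN R n); ring.
Qed.

End LocalLimit.

(** * Domination and passage to the limit in the inversion integral *)

Section LocalLimit.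
Variables (R : realType) (p : 'I_3 -> R).
Hypotheses (p_ge0 : forall i, 0 <= p i) (p_sum1 : \sum_(i < 3) p i = 1).
Hypothesis p10 : p (inord 1) = 0.
Hypothesis spread_gt0 : 0 < spread p.
Implicit Types (u v s t : R) (n k : nat).
Let mu := @lebesgue_measure R.
Let c := spread p / 4000.

(** The bound on v means (n+1) |t| <= 1/4, so the lower bounds in u and in v both hold; their
    average gives [sinsum] >= (u^2 + v^2) / 2000, and the factor spread / 2 turns 2000 into the 4000
    of [c]. *)
Lemma Fint_le_center n u v : (0 < n)%N -> `|u| <= rootN R n / 2 -> `|v| <= rootN R n / 4 ->
  `|Fint p n u v| <= gaussian c u * gaussian c v.
Proof.
move=> n0 ur vr; have r0 := rootN_gt0 R n; have r2 := sqr_rootN R n.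
apply: le_trans (Fint_le p_ge0 p_sum1 n u v) _; rewrite -expRD ler_expR.
set s := u / _; set t := v / _; pose N : R := n.+1%:R.
have N0 : 0 < N by [].
have N2 : 2 <= N by rewrite ler_nat.
have s2 : `|s| <= 1 / 2.
  by rewrite /s normrM normfV (gtr0_norm r0) ler_pdivrMr //; apply: le_trans ur _; lra.
have nt : N * `|t| <= 1 / 4.
  have -> : N * `|t| = `|v| / rootN R n.
    rewrite /t normrM normfV (gtr0_norm (mulr_gt0 N0 r0)) -/N.
    by field; rewrite !gt_eqF.
  by rewrite ler_pdivrMr //; apply: le_trans vr _; lra.
have t2 : `|t| <= 1 / 2.
  have h0 := normr_ge0 t; have := ler_wpM2r h0 N2; lra.
have h1 := sinsum_ge_v s n0 t2; have h2 := sinsum_ge_u s2 nt.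
have e1 : v ^+ 2 / 1000 <= n.+1%:R / 1000 * Num.min 1 ((n.+1%:R * (pi * t)) ^+ 2).
  have -> : v ^+ 2 / 1000 = (v ^+ 2 / N) * (N / 1000) by field; rewrite gt_eqF.
  rewrite [leRHS]mulrC; apply: ler_wpM2r; first by apply: divr_ge0; exact: ler0n.
  rewrite le_min; apply/andP; split.
    rewrite ler_pdivrMr // mul1r /N -r2 -(real_normK (num_real v)).
    have := ler_pM (normr_ge0 v) (normr_ge0 v) vr vr; rewrite -!expr2.
    have := sqr_ge0 (rootN R n); lra.
  have -> : (n.+1%:R * (pi * t)) ^+ 2 = pi ^+ 2 * (v ^+ 2 / N).
    by rewrite /t /N -r2; field; rewrite gt_eqF.
  rewrite ler_peMl ?divr_ge0 ?sqr_ge0 //; apply: exprn_ege1.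
  by apply: le_trans (pi_ge2 R); rewrite ler1n.
have e2 : 2 / 9 * (n.+1%:R * s ^+ 2) = 2 / 9 * u ^+ 2.
  by rewrite /s -r2; field; rewrite gt_eqF.
rewrite /c mulNr -opprD lerN2.
have h3 : (u ^+ 2 + v ^+ 2) / 2000 <= sinsum n s t.
  have := sqr_ge0 u; have := sqr_ge0 v.
  have := le_trans e1 h1; rewrite e2 in h2; lra.
have := ler_wpM2l (ltW (divr_gt0 spread_gt0 (ltr0n R 2))) h3.
apply: le_trans; rewrite le_eqVlt; apply/orP; left; apply/eqP; by field.
Qed.

(** Away from the centre the mirror argument in u fails, but the v-estimate alone has its minimum at
    least 1/4, which makes the decay exponential in n. *)
Lemma Fint_le_far n u v : (0 < n)%N -> rootN R n / 4 <= `|v| <= n.+1%:R * rootN R n / 2 ->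
  `|Fint p n u v| <= expR (- (spread p / 8000 * n.+1%:R)).
Proof.
move=> n0 /andP[vl vu]; have r0 := rootN_gt0 R n; have r2 := sqr_rootN R n.
apply: le_trans (Fint_le p_ge0 p_sum1 n u v) _; rewrite ler_expR mulNr lerN2.
set s := u / _; set t := v / _; pose N : R := n.+1%:R.
have N0 : 0 < N by [].
have t2 : `|t| <= 1 / 2.
  rewrite /t normrM normfV (gtr0_norm (mulr_gt0 N0 r0)) ler_pdivrMr ?mulr_gt0 //.
  by apply: le_trans vu _; rewrite mulrC mul1r.
have h1 := sinsum_ge_v s n0 t2.
have e1 : N / 4000 <= n.+1%:R / 1000 * Num.min 1 ((n.+1%:R * (pi * t)) ^+ 2).
  have -> : N / 4000 = N / 1000 * (1 / 4) by field.
  apply: ler_wpM2l; first by apply: divr_ge0; exact: ler0n.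
  rewrite le_min; apply/andP; split; first by lra.
  have -> : (n.+1%:R * (pi * t)) ^+ 2 = pi ^+ 2 * (v ^+ 2 / N).
    by rewrite /t /N -r2; field; rewrite gt_eqF.
  have p4 : 4 <= pi ^+ 2 :> R.
    have -> : 4 = 2 ^+ 2 :> R by rewrite -natrX.
    by rewrite lerXn2r ?nnegrE ?pi_ge0 ?pi_ge2.
  have v4 : 1 / 16 <= v ^+ 2 / N.
    rewrite ler_pdivlMr // /N -r2 -(real_normK (num_real v)).
    have h : 0 <= rootN R n / 4 by rewrite divr_ge0 // ltW.
    have := ler_pM h h vl vl; rewrite -!expr2; lra.
  have -> : 1 / 4 = 4 * (1 / 16) :> R by field.
  apply: ler_pM p4 v4; lra.
have h3 := le_trans e1 h1.
have := ler_wpM2l (ltW (divr_gt0 spread_gt0 (ltr0n R 2))) h3.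
apply: le_trans; rewrite le_eqVlt; apply/orP; left; apply/eqP; by field.
Qed.

Lemma c_gt0 : 0 < c. Proof. by apply: divr_gt0; [exact: spread_gt0|rewrite ltr0n]. Qed.

Let gk := gaussian (spread p / 24 * pi ^+ 2).
Let mass := Num.sqrt (pi / (spread p / 2 * pi ^+ 2)).

(** The inner integral restricted to the values of v with an integrable Gaussian majorant, extended
    by 0. *)
Definition slice_center k : R -> R :=
  slice p (4 * k + 3) \_ `[- (rootN R (4 * k + 3) / 4), rootN R (4 * k + 3) / 4].

Lemma div4 k : (4 %| (4 * k + 3).+1)%N. Proof. by rewrite -addnS addnC -mulnS dvdn_mulr. Qed.

Lemma in_seg (a x : R) : (x \in `[- a, a]%classic) = (`|x| <= a).
Proof. by rewrite ler_norml mem_setE in_itv. Qed.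

Lemma measurable_gaussian a : measurable_fun setT (@gaussian R a).
Proof.
apply: measurableT_comp => //; apply: measurableT_comp => //.
by apply: measurable_funM => //; exact: measurable_funX.
Qed.

Lemma slice_center_cvg v : slice_center k v @[k --> \oo] --> mass * gk v.
Proof.
pose f k u := if `|v| <= rootN R (4 * k + 3) / 4
  then ((fun u => Fint p (4 * k + 3) u v) \_ `[- (rootN R (4 * k + 3) / 2), rootN R (4 * k +
    3) / 2]) u else 0.
have -> : (fun k => slice_center k v) = (fun k => \int[mu]_u f k u).
  apply/funext => k; rewrite /slice_center /f patchE in_seg; case: ifP => _.
    by rewrite -Rintegral_mkcond sliceE // div4.
  by rewrite Rintegral_cst // mul0r.
pose kap := spread p / 2 * pi ^+ 2.
have kap0 : 0 < kap by rewrite mulr_gt0 ?divr_gt0 ?exprn_gt0 ?pi_gt0.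
have -> : mass * gk v = \int[mu]_u (gaussian kap u * gk v).
  by rewrite RintegralZr ?integral_gaussian //; exact: integrable_gaussian.
have rbig M : \forall k \near \oo, M <= rootN R (4 * k + 3).
  near=> k; have r0 := rootN_gt0 R (4 * k + 3).
  have : (rootN R (4 * k + 3))^-1 < (`|M| + 1)^-1.
    by near: k; apply: (cvgr_lt _ (@cvg_inv_rootN R)); rewrite invr_gt0 ltr_wpDl.
  rewrite ltf_pV2 ?posrE ?ltr_wpDl // => h; have := ler_norm M; lra.
apply: (@dominated_cvg_Rintegral _ _ _ (fun u => gaussian c u * gaussian c v)).
- move=> k; have [vk|vk] := boolP (`|v| <= rootN R (4 * k + 3) / 4); last first.
    have -> : f k = cst 0 by apply/funext => u; rewrite /f (negPf vk).
    exact: measurable_cst.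
  have -> : f k = (fun u => Fint p (4 * k + 3) u v) \_ `[- (rootN R (4 * k + 3) / 2),
    rootN R (4 * k + 3) / 2].
    by apply/funext => u; rewrite /f vk.
  have [+ _] := @measurable_restrictT _ _ R R `[- (rootN R (4 * k + 3) / 2), rootN R (4 * k +
    3) / 2] (fun u => Fint p (4 * k + 3) u v) (measurable_itv _).
  apply; apply: measurable_funTS.
  apply: continuous_measurable_fun. exact: continuous_Fint_l.
- by apply: measurable_funM => //; exact: measurable_gaussian.
- move=> u; have := @Fint_cvg R p p_ge0 p_sum1 p10 u v; rewrite -/kap -/gk.
  apply: cvg_trans; apply: near_eq_cvg; near=> k.
  rewrite /f patchE in_seg.
  have -> : `|v| <= rootN R (4 * k + 3) / 4.
    by rewrite ler_pdivlMr //; near: k; exact: rbig.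
  have -> // : `|u| <= rootN R (4 * k + 3) / 2.
  by rewrite ler_pdivlMr //; near: k; exact: rbig.
- have := @integrableZr _ _ R mu setT measurableT (gaussian c v) _ (integrable_gaussian c_gt0).
  by congr (integrable _ _ _).
- move=> k u; rewrite /f; case: ifPn => vk; last first.
    by rewrite normr0 mulr_ge0 ?expR_ge0.
  rewrite patchE in_seg; case: ifPn => uk; last by rewrite normr0 mulr_ge0 ?expR_ge0.
  by apply: Fint_le_center => //; lia.
Unshelve. all: by end_near. Qed.

Lemma integrable_patch (G : R -> R) (D : set R) : measurable D ->
  mu.-integrable setT (EFin \o G) -> mu.-integrable setT (EFin \o (G \_ D)).
Proof.
move=> mD iG; rewrite -restrict_EFin; have [+ _] := @integrable_mkcond _ _ R mu D (EFin \o G) mD.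
by apply; exact: integrableS iG.
Qed.

Lemma Rintegral_le_setT (G : R -> R) (D : set R) : measurable D -> (forall x, 0 <= G x) ->
  mu.-integrable setT (EFin \o G) -> \int[mu]_(x in D) G x <= \int[mu]_x G x.
Proof.
move=> mD G0 iG; rewrite Rintegral_mkcond; apply: le_Rintegral => //.
  exact: integrable_patch.
by move=> x _; rewrite patchE; case: ifP.
Qed.

Lemma integral_cst_segment (T C : R) : 0 < T ->
  \int[mu]_(x in `[- (T / 2), T / 2]) C = C * T.
Proof.
move=> T0; rewrite Rintegral_cst //; congr (_ * _).
have := @integral_cos R T 0 0 T0; rewrite eqxx cos0 mulr1; apply: etrans.
under eq_Rintegral do rewrite mulr0 !mul0r addr0 cos0.
by rewrite Rintegral_cst // mul1r.
Qed.

Lemma slice_center_le k v :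
  `|slice_center k v| <= Num.sqrt (pi / c) * gaussian c v.
Proof.
rewrite /slice_center patchE in_seg; case: ifPn => vk; last first.
  by rewrite normr0 mulr_ge0 ?sqrtr_ge0 ?expR_ge0.
rewrite -(sliceE p10 _ (div4 k)).
have ig := @continuous_segment_integrable R _ (- (rootN R (4 * k + 3) / 2)) (rootN R (4 * k +
  3) / 2) (@continuous_Fint_l R p (4 * k + 3) v).
apply: le_trans (le_normr_Rintegral _ ig) _ => //.
have iG : mu.-integrable setT (EFin \o (fun u => gaussian c u * gaussian c v)).
  have := @integrableZr _ _ R mu setT measurableT (gaussian c v) _ (integrable_gaussian c_gt0).
  by congr (integrable _ _ _).
rewrite -integral_gaussian ?c_gt0 // -RintegralZr //; last exact: integrable_gaussian c_gt0.
have G0 u : 0 <= gaussian c u * gaussian c v by rewrite mulr_ge0 ?expR_ge0.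
apply: le_trans (Rintegral_le_setT (measurable_itv `[- (rootN R (4 * k + 3) / 2),
  rootN R (4 * k + 3) / 2]) G0 iG).
apply: le_Rintegral => //.
- by apply: continuous_segment_integrable; move=> x; apply: cvg_norm; exact: continuous_Fint_l.
- exact: integrableS iG.
- move=> u /=; rewrite in_itv /= -ler_norml => ur.
  by apply: Fint_le_center => //; lia.
Qed.

(** The inversion formula is an iterated integral, so dominated convergence is used twice: in u for
    fixed v in [slice_center_cvg], then in v here. *)
Lemma prob0_cvg : ((4 * k + 3).+1%:R ^+ 2 * prob0 p (4 * k + 3)) @[k --> \oo] -->
  4 * Num.sqrt 3 / (pi * spread p).
Proof.
have r0 k := rootN_gt0 R (4 * k + 3).
have I1 : \int[mu]_v slice_center k v @[k --> \oo] --> 4 * Num.sqrt 3 / (pi * spread p).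
  have -> : 4 * Num.sqrt 3 / (pi * spread p) = \int[mu]_v (mass * gk v).
    have kap0 : 0 < spread p / 24 * pi ^+ 2 by rewrite mulr_gt0 ?divr_gt0 ?exprn_gt0 ?pi_gt0 ?ltr0n.
    rewrite RintegralZl //; last exact: integrable_gaussian kap0.
    have q0 : 0 <= pi / (spread p / 2 * pi ^+ 2).
      apply: divr_ge0; first exact: pi_ge0.
      by apply: mulr_ge0; [apply: divr_ge0; [exact: ltW|exact: ler0n]|exact: sqr_ge0].
    rewrite integral_gaussian // /mass -sqrtrM //.
    (* The product of the two Gaussian masses is sqrt (2 * 24) / (pi spread) = 4 sqrt 3 / (pi
       spread); 24 is twice the 12 of the centred sum of squares. *)
    have -> : pi / (spread p / 2 * pi ^+ 2) * (pi / (spread p / 24 * pi ^+ 2)) =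
        (4 / (pi * spread p)) ^+ 2 * 3.
      have pn : pi != 0 :> R by rewrite gt_eqF ?pi_gt0.
      have sn : spread p != 0 by rewrite gt_eqF.
      move: (pi) (spread p) pn sn => a b an bn; by field; rewrite ?an ?bn.
    rewrite sqrtrM ?sqr_ge0 // sqrtr_sqr ger0_norm; last first.
      by apply: divr_ge0; [exact: ler0n|apply: mulr_ge0; [exact: pi_ge0|exact: ltW]].
    by ring.
  apply: (@dominated_cvg_Rintegral _ _ _ (fun v => Num.sqrt (pi / c) * gaussian c v)).
  - move=> k; have [+ _] := @measurable_restrictT _ _ R R `[- (rootN R (4 * k + 3) / 4),
    rootN R (4 * k + 3) / 4] (slice p (4 * k + 3)) (measurable_itv _).
    apply; apply: measurable_funTS; apply: continuous_measurable_fun; exact: continuous_slice.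
  - by apply: measurable_funM => //; exact: measurable_gaussian.
  - move=> v; exact: slice_center_cvg.
  - have := @integrableZl _ _ R mu setT measurableT (Num.sqrt (pi / c)) _ (integrable_gaussian c_gt0).
    by congr (integrable _ _ _).
  - by move=> k v; exact: slice_center_le.
(* The part |v| > [rootN] / 4: the whole box has area (n+1)^2, and [Fint_le_far] bounds the
   integrand. *)
pose err k : R := (4 * k + 3).+1%:R ^+ 2 * expR (- (spread p / 8000 * (4 * k + 3).+1%:R)).
have err0 : err k @[k --> \oo] --> 0.
  pose a := spread p / 8000.
  have a0 : 0 < a by apply: divr_gt0; [exact: spread_gt0|rewrite ltr0n].
  have h : (fun k => 6 / a ^+ 3 * ((rootN R (4 * k + 3))^-1 * (rootN R (4 * k +
    3))^-1)) @ \oo --> 0.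
    rewrite -[X in _ --> X](mulr0 (6 / a ^+ 3)); apply: cvgMr.
    by rewrite -[X in _ --> X](mulr0 0); apply: cvgM; exact: cvg_inv_rootN.
  apply: (squeeze_cvgr _ (cvg_cst 0) h); apply: nearW => k.
  rewrite /err -/a; set N := (4 * k + 3).+1%:R; have N0 : 0 < N by rewrite ltr0n.
  apply/andP; split; first by rewrite mulr_ge0 ?sqr_ge0 ?expR_ge0.
  rewrite -invfM -expr2 sqr_rootN -/N expRN ler_pdivrMr ?expR_gt0 //.
  have aN : 0 <= a * N by rewrite mulr_ge0 ?ltW.
  have := @expR_ge1Dxn R _ 2 aN => e3.
  have {e3} : (a * N) ^+ 3 / 6 <= expR (a * N) by apply: le_trans e3; rewrite lerDr.
  have k0 : 0 <= 6 / a ^+ 3 / N by rewrite !divr_ge0 ?exprn_ge0 ?ltW.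
  move/(ler_wpM2l k0); apply: le_trans.
  by rewrite le_eqVlt; apply/orP; left; apply/eqP; field; rewrite !gt_eqF.
have diff k : `|(4 * k + 3).+1%:R ^+ 2 * prob0 p (4 * k + 3) - \int[mu]_v slice_center k v| <=
  err k.
  set n := (4 * k + 3)%N; pose r := rootN R n; pose T := n.+1%:R * r.
  have rk : 0 < r := r0 k.
  have T0 : 0 < T by rewrite mulr_gt0.
  have rT : r / 4 <= T / 2.
    have : 1 * r <= T by rewrite ler_pM2r // ler1n.
    lra.
  have isl := @continuous_segment_integrable R _ (- (T / 2)) (T / 2) (@continuous_slice R p n).
  have isc : mu.-integrable setT (EFin \o slice_center k).
    rewrite /slice_center -restrict_EFin.
    have [+ _] := @integrable_mkcond _ _ R mu `[- (rootN R n / 4),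
      rootN R n / 4] (EFin \o slice p n) (measurable_itv _).
    by apply; apply: continuous_segment_integrable; exact: continuous_slice.
  have -> : \int[mu]_v slice_center k v = \int[mu]_(v in `[- (T / 2), T / 2]) slice_center k v.
    rewrite [RHS]Rintegral_mkcond; apply: eq_Rintegral => v _; rewrite [RHS]patchE in_seg.
    case: ifPn => // vT; rewrite /slice_center patchE in_seg ifF //.
    by apply: contraNF vT => vr; apply: le_trans vr _.
  rewrite -(integral_slice p10 (div4 k)) -/n -/r -/T -RintegralB //; last first.
    exact: integrableS isc.
  have iB : mu.-integrable `[- (T / 2), T / 2] (EFin \o (fun v => slice p n v - slice_center k v)).
    have iscs : mu.-integrable `[- (T / 2),
      T / 2] (EFin \o slice_center k) by exact: integrableS isc.
    by have := @integrableB _ _ R mu _ (measurable_itv `[- (T / 2), T / 2]) _ _ isl iscs;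
      congr (integrable _ _ _).
  apply: le_trans (le_normr_Rintegral _ iB) _ => //.
  have -> : err k = (expR (- (spread p / 8000 * n.+1%:R)) * r) * T.
    by rewrite /err -/n /T -(sqr_rootN R n) -/r; ring.
  rewrite -(integral_cst_segment _ T0); apply: le_Rintegral => //.
  - by have := integrable_abse iB; congr (integrable _ _ _).
  - by apply: continuous_segment_integrable => x; exact: cvg_cst.
  - move=> v /=; rewrite in_itv /= -ler_norml => vT.
    rewrite /slice_center patchE in_seg; case: ifPn => vr.
      by rewrite subrr normr0 mulr_ge0 ?expR_ge0 // ltW.
    rewrite subr0 -(sliceE p10 _ (div4 k)) -/n -/r.
    have ig := @continuous_segment_integrable R _ (- (r / 2)) (r / 2) (@continuous_Fint_l R p n v).
    apply: le_trans (le_normr_Rintegral _ ig) _ => //.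
    rewrite -(integral_cst_segment _ rk); apply: le_Rintegral => //.
    + by apply: continuous_segment_integrable; move=> x; apply: cvg_norm; exact: continuous_Fint_l.
    + by apply: continuous_segment_integrable => x; exact: cvg_cst.
    + move=> u _; apply: (@Fint_le_far n u v); first by rewrite /n; lia.
      by rewrite vT andbT ltW // ltNge.
rewrite -[X in _ --> X]add0r.
have -> : (fun k => (4 * k + 3).+1%:R ^+ 2 * prob0 p (4 * k + 3)) = (fun k => ((4 * k +
  3).+1%:R ^+ 2 * prob0 p (4 * k + 3)
    - \int[mu]_v slice_center k v) + \int[mu]_v slice_center k v).
  by apply/funext => k; rewrite subrK.
apply: cvgD => //; apply/norm_cvg0P; apply: (squeeze_cvgr _ (cvg_cst 0) err0).
by apply: nearW => k; rewrite normr_ge0 diff.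
Qed.

End LocalLimit.

(** * Exceptional double roots *)

Lemma expr_ge1Dn (A : numDomainType) (e : A) m : 0 <= e -> 1 + m%:R * e <= (1 + e) ^+ m.
Proof.
move=> e0; elim: m => [|m IH]; first by rewrite mul0r addr0 expr0.
have h : 1 <= 1 + e by rewrite lerDl.
rewrite exprS; apply: le_trans (ler_wpM2l (le_trans ler01 h) IH).
rewrite -natr1 -subr_ge0.
have -> : (1 + e) * (1 + m%:R * e) - (1 + (m%:R + 1) * e) = m%:R * (e * e) by ring.
by rewrite mulr_ge0 ?mulr_ge0.
Qed.

Section Exceptional.
Variables (n : nat) (R : realType) (p : 'I_3 -> R).
Hypotheses (p_ge0 : forall i, 0 <= p i) (p_sum1 : \sum_(i < 3) p i = 1).
Implicit Types x y : {ffun 'I_n.+1 -> 'I_3}.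

(** The relation z P'(z) = 0 restricted to the multiples of m prescribes one weighted sum. This
    crude bound serves for the roots 1 and -1 when only convergence to 0 is wanted. *)
Lemma Pr_double_root_unity (A : numClosedFieldType) (z : A) m N s : (0 < m)%N ->
    (m * N <= n.+1)%N -> z ^+ m = 1 -> concentration n p N s ->
  Pr p (fun x => iroot2 z (ipoly x)) <= s.
Proof.
move=> m0 mN zm conc.
have gK (i : nat) : (i < N)%N -> (inord (m * i)%N : 'I_n.+1) = (m * i)%N :> nat.
  by move=> iN; rewrite inordK //; apply: leq_trans mN; nia.
pose g (i : 'I_N) : 'I_n.+1 := inord (m * i)%N.
have ginj : injective g.
  move=> i j /(congr1 (@nat_of_ord _)); rewrite !gK // => /eqP.
  by rewrite eqn_pmul2l // => /eqP /ord_inj.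
pose S : {set 'I_n.+1} := g @: 'I_N.
have gS i : g i \in S by apply: imset_f.
apply: (@Pr_le_resample _ _ _ _ p_ge0 p_sum1 S) => y.
have [[w Ew]|nE] := pselect (exists w, iroot2 z (ipoly (merge S w y))); last first.
  rewrite Pr_false => [|x Ex]; last by apply: nE; exists x.
  by apply: le_trans (conc g ginj 0); apply: Pr_ge0.
apply: (@le_trans _ _ (Pr p (fun x => wsum g x = wsum g w))); last exact: conc.
apply: Pr_le => // x Ex.
have [_ x1] := iroot2P Ex; have [_ w1] := iroot2P Ew.
pose d j : A := (val3 (x j) - val3 (w j))%:~R.
have : \sum_(j in S) d j * j%:R * z ^+ j = 0.
  have := congr2 (fun u v => u - v) x1 w1; rewrite /= subrr -sumrB => E.
  apply: (etrans _ E); rewrite big_mkcond /=; apply: eq_bigr => j _.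
  rewrite !ffunE /d; case: ifP => _; last by rewrite subrr.
  by rewrite rmorphB -!mulrBl.
rewrite big_imset /=; last by move=> ? ? _ _; apply: ginj.
move=> E; apply/eqP; rewrite -subr_eq0 -(intr_eq0 A) /wsum -sumrB.
have mA : m%:R != 0 :> A by rewrite pnatr_eq0 -lt0n.
apply/eqP/(mulfI mA); rewrite mulr0; apply: (etrans _ E).
rewrite rmorph_sum mulr_sumr; apply: eq_bigr => i _ /=.
rewrite gK // exprM zm expr1n -mulrBr rmorphM /= -/(d _) natrM; ring.
Qed.

Lemma iroot2_sqr (A : numClosedFieldType) (f g : {poly int}) (z : A) :
  iroot f z -> iroot2 z (f ^+ 2 * g).
Proof.
move=> fz; rewrite /iroot2 expr2 -mulrA derivM /iroot rmorphD /= !rmorphM /=.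
by rewrite /root !hornerD !hornerM (eqP fz) !mul0r !mulr0 addr0.
Qed.

(** A primitive root z and its inverse z^(k-1) are two roots of ['Phi_k], distinct as soon as k >
    2. *)
Lemma Pr_sqr_Cyclotomic k N s : (2 < k)%N -> (k * N <= n.+1)%N -> @concentration n R p N s ->
  Pr p (fun x => exists g, ipoly x = 'Phi_k ^+ 2 * g) <= s ^+ 2.
Proof.
move=> k2 kN conc; have k0 : (0 < k)%N by lia.
have [z zprim] := C_prim_root_exists k0.
have zk := prim_expr_order zprim.
have z'prim : k.-primitive_root (z ^+ k.-1).
  by rewrite prim_root_exp_coprime //; case: k k0 {k2 kN zprim zk} => // k _ /=; exact: coprimenS.
have PhiE : map_poly intr 'Phi_k = cyclotomic z k := Cintr_Cyclotomic zprim.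
have zz' : z != z ^+ k.-1.
  by rewrite -[X in X != _]expr1 (eq_prim_root_expr zprim) !modn_small //; lia.
have k1 : (1 < k)%N by lia.
apply: le_trans (@Pr_two_double_roots n R p p_ge0 p_sum1 _ _ _ k N s k1 kN zk (prim_expr_order z'prim) zz' conc).
apply: Pr_le => // x [g ->].
by split; apply: iroot2_sqr; rewrite /iroot PhiE root_cyclotomic.
Qed.

Variable q : R.
Hypothesis (p_le : forall i, p i <= q).
Hypothesis (q_lt : q * Num.sqrt 3 < 1).

Let q_ge0 : 0 <= q. Proof. by apply: le_trans (p_le ord0). Qed.

Lemma atom_sqr_le : 3 * q ^+ 2 <= 1 /\ q <= q * Num.sqrt 3.
Proof.
have s0 : 0 <= Num.sqrt 3 :> R by exact: sqrtr_ge0.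
have ss : Num.sqrt 3 ^+ 2 = 3 :> R by rewrite sqr_sqrtr.
split.
  have h : 0 <= q * Num.sqrt 3 by rewrite mulr_ge0.
  have := exprn_ile1 2 h (ltW q_lt); rewrite exprMn ss; lra.
have s1 : 1 <= Num.sqrt 3 :> R by rewrite -(ler_pXn2r (ltn0Sn 1)) ?nnegrE // expr1n ss ler1n.
by rewrite ler_peMr.
Qed.

(** Simultaneous double roots at 1 and -1 are included so that the two events may be treated as
    disjoint up to an exceptional one. *)
Definition exceptional x := (exists2 z : R[i], ('X - z%:P) ^+ 2 %| map_poly intr (ipoly x) &
   [/\ z != 0, z != 1 & z != -1]) \/ (iroot2 (1 : R[i]) (ipoly x) /\ iroot2 (-1 : R[i]) (ipoly x)).

Lemma Pr_small_factor d0 : (0 < d0)%N ->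
   (32 * d0 ^ 2 * (2 * d0 ^ 2 + 3 * d0) <= n)%N ->
  Pr p (fun x => exists f : {poly int}, [/\ (size f <= d0)%N, forall i, `|f`_i| <= 3 ^+ d0,
         exists g, ipoly x = f * g &
         exists2 a : R[i], iroot f a & 1 + (16 * d0 ^ 2)%:R^-1 < `|a| ]) <= q ^+ d0.
Proof.
move=> d00 dn; pose B := (3 ^ d0)%N.
(* Coefficients in [-B, B] are stored shifted by B, so that the candidate factors range over a
   finite type. *)
pose pol (c : {ffun 'I_d0 -> 'I_(2 * B).+1}) : {poly int} :=
  \poly_(i < d0) (oapp (fun j : 'I_d0 => (c j)%:Z - B%:Z) 0 (insub i)).
(* There are at most (2 B + 1)^d0 <= 3^(d0^2 + d0) candidates. As 3 q^2 <= 1, the first part of the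
   exponent absorbs them and leaves q^d0. *)
pose r := (2 * (d0 ^ 2 + d0) + d0)%N.
apply: (@le_trans _ _ (Pr p (fun x => exists c, (exists g, ipoly x = pol c * g) /\
         exists2 a : R[i], iroot (pol c) a & 1 + (16 * d0 ^ 2)%:R^-1 < `|a|))).
  apply: Pr_le => // x [f [fd f3 fg fa]].
  have c_lt (j : 'I_d0) : (absz (f`_j + B%:Z)%R < (2 * B).+1)%N.
    have := f3 j; have -> : (3 : int) ^+ d0 = B%:Z by rewrite -[RHS]natz natrX.
    lia.
  exists [ffun j => Ordinal (c_lt j)].
  suff -> : pol [ffun j => Ordinal (c_lt j)] = f by [].
  apply/polyP => i; rewrite coef_poly; case: ltnP => id0;
    last by rewrite nth_default // (leq_trans fd).
  rewrite insubT /= ffunE /=; have := f3 i; have -> : (3 : int) ^+ d0 =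
    B%:Z by rewrite -[RHS]natz natrX.
  move: (f`_i : int) => y yB; have yB0 : 0 <= y + B%:Z by lia.
  by rewrite gez0_abs // addrK.
apply: le_trans (Pr_exists p_ge0 _) _.
apply: (@le_trans _ _ (\sum_(c : {ffun 'I_d0 -> 'I_(2 * B).+1}) q ^+ r)).
  apply: ler_sum => c _.
  have [[a fa a1]|nE] := pselect (exists2 a : R[i], iroot (pol c) a & 1 +
    (16 * d0 ^ 2)%:R^-1 < `|a|); last first.
    by rewrite Pr_false ?exprn_ge0 // => x [].
  apply: (@le_trans _ _ (Pr p (fun x => (map_poly intr (ipoly x)).[a] = 0))).
    by apply: Pr_le => // x [[g ->] _]; apply/eqP; rewrite -[_ == _]/(iroot _ a) irootM fa.
  apply: (@Pr_root_outside n R p q p_ge0 p_sum1 p_le _ a (32 * d0 ^ 2) r).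
  - by rewrite muln_gt0 expn_gt0 d00.
  - by apply: leq_trans dn; rewrite leq_mul2l /r; apply/orP; right; lia.
  (* Bernoulli's inequality: (1 + 1/(16 d0^2))^(32 d0^2) >= 1 + 2 = 3, which dictates the step of
     the progression. *)
  - have e0 : 0 <= (16 * d0 ^ 2)%:R^-1 :> R[i] by rewrite invr_ge0 ler0n.
    apply: (@le_trans _ _ ((1 + (16 * d0 ^ 2)%:R^-1) ^+ (32 * d0 ^ 2))); last first.
      by apply: lerXn2r (ltW a1); rewrite nnegrE ?normr_ge0 // addr_ge0.
    apply: le_trans (expr_ge1Dn _ e0).
    have -> : (32 * d0 ^ 2)%N = (2 * (16 * d0 ^ 2))%N by lia.
    rewrite natrM -mulrA mulfV ?mulr1 ?pnatr_eq0 -?lt0n ?muln_gt0 ?expn_gt0 ?d00 //.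
rewrite sumr_const card_ffun !card_ord -[leLHS]mulr_natl /r exprD mulrA.
apply: ler_piMl; first by rewrite exprn_ge0.
have [q3 _] := atom_sqr_le.
have h : ((2 * B).+1 ^ d0 <= 3 ^ (d0 ^ 2 + d0))%N.
  have -> : (d0 ^ 2 + d0 = (d0 + 1) * d0)%N by lia.
  rewrite expnM leq_exp2r // expnD expn1 -/B.
  have : (0 < B)%N by rewrite expn_gt0.
  lia.
apply: (@le_trans _ _ (3 ^+ (d0 ^ 2 + d0) * q ^+ (2 * (d0 ^ 2 + d0)))).
  by apply: ler_wpM2r; rewrite ?exprn_ge0 // -natrX ler_nat.
rewrite exprM -exprMn; apply: exprn_ile1 => //.
by rewrite mulr_ge0 ?exprn_ge0.
Qed.

(** The size conditions in turn: 4^d0 exceeds 3^d0 even after the Landau loss n + 1; the progression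
    for a root outside the circle fits below n; progressions of N terms and step up to 2 d0^2 fit as
    well. *)
Lemma Pr_exceptional d0 N s : (0 < d0)%N -> (n.+1 * 3 ^ d0 <= 4 ^ d0)%N ->
    (32 * d0 ^ 2 * (2 * d0 ^ 2 + 3 * d0) <= n)%N -> (2 * d0 ^ 2 * N <= n.+1)%N ->
    @concentration n R p N s ->
  Pr p exceptional <= (2 + 4 / (1 - q * Num.sqrt 3)) * (q * Num.sqrt 3) ^+ d0
     + (2 * d0 ^ 2).+1%:R * s ^+ 2.
Proof.
move=> d00 d34 dn dN conc; set rho := q * _.
have q0 := q_ge0; have [q3 qr] := atom_sqr_le.
have rho0 : 0 <= rho by rewrite mulr_ge0 ?sqrtr_ge0.
have qrd : q ^+ d0 <= rho ^+ d0 by rewrite lerXn2r ?nnegrE.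
pose EH x := exists k : nat, ((k ^ 2)%N%:Z %| (ipoly x).[3])%Z /\ (3 ^ d0 <= k ^ 2)%N.
pose EL x := exists f : {poly int}, [/\ (size f <= d0)%N, forall i, `|f`_i| <= 3 ^+ d0,
         exists g, ipoly x = f * g &
         exists2 a : R[i], iroot f a & 1 + (16 * d0 ^ 2)%:R^-1 < `|a| ].
pose EC x := exists k : 'I_(2 * d0 ^ 2), (2 < k)%N /\ exists g, ipoly x = 'Phi_k ^+ 2 * g.
pose E1 x := iroot2 (1 : R[i]) (ipoly x) /\ iroot2 (-1 : R[i]) (ipoly x).
apply: (@le_trans _ _ (Pr p (fun x => (EH x \/ EL x) \/ (EC x \/ E1 x)))).
  apply: Pr_le => // x [[z dz [z0 z1 zN1]]|?]; last by right; right.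
  have [P0|P0] := eqVneq (ipoly x) 0.
    (* The zero polynomial has P(3) = 0, so any large k is a witness. *)
    left; left; exists (3 ^ d0)%N; rewrite P0 horner0 dvdz0; split=> //.
    by rewrite -[leqLHS]muln1 -mulnn leq_mul2l expn_gt0 orbT.
  have := double_root_cases (coef_ipoly_le1 x) (size_ipoly x) P0 dz z0 z1 zN1 d00.
  case=> [[k [kd k4]]|fH|[k [k2 kd g]]].
  - left; left; exists k; split=> //.
    by have := leq_trans d34 k4; rewrite [leqRHS]mulnC leq_pmul2l.
  - by left; right.
  - right; left; have kb : (k < 2 * d0 ^ 2)%N.
      apply: leq_ltn_trans (le_totient_sq k) _.
      by rewrite ltn_mul2l /= ltn_exp2r.
    by exists (Ordinal kb).
apply: le_trans (Pr_or p_ge0 _ _) _; apply: lerD.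
  apply: le_trans (Pr_or p_ge0 _ _) _.
  have h1 := @Pr_square_dvd_horner3 n R p q p_ge0 p_sum1 p_le d0 q_lt.
  have h2 := Pr_small_factor d00 dn; rewrite -/rho in h1.
  have h3 : q ^+ n.+1 <= q ^+ d0.
    have q1 : q <= 1 by apply: le_trans qr (ltW q_lt).
    apply: ler_wiXn2l => //; nia.
  rewrite mulrDl; apply: le_trans (lerD h1 h2) _.
  set t := 4 / _ * _; set u := rho ^+ d0 in qrd *; set w := q ^+ d0 in h3 qrd *.
  rewrite addrAC lerD2r; apply: le_trans (lerD h3 (lexx _)) _; lra.
apply: le_trans (Pr_or p_ge0 _ _) _; rewrite -natr1 mulrDl mul1r; apply: lerD.
  apply: le_trans (Pr_exists p_ge0 _) _.
  rewrite mulr_natl -[X in _ *+ X]card_ord -sumr_const; apply: ler_sum => k _.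
  have [k2|k2] := ltnP 2 k; last first.
    by rewrite Pr_false ?sqr_ge0 // => x [].
  apply: (@le_trans _ _ (Pr p (fun x => exists g, ipoly x = 'Phi_k ^+ 2 * g))).
    by apply: Pr_le => // x [].
  apply: (@Pr_sqr_Cyclotomic _ N) => //.
  by apply: leq_trans dN; rewrite leq_mul2r ltnW ?orbT.
have two : (2 * N <= n.+1)%N.
  apply: leq_trans dN; rewrite leq_mul2r -[X in (X <= _)%N]muln1 leq_mul2l expn_gt0 d00 ?orbT //.
apply: (@Pr_two_double_roots n R p p_ge0 p_sum1 _ _ _ 2 N s) => //.
- by rewrite expr1n.
- by rewrite sqrrN expr1n.
- by rewrite -subr_eq0 opprK -(natrD _ 1 1) pnatr_eq0.
Qed.

End Exceptional.

Lemma sqr_le_exp2 D M : (64 * D <= M)%N -> (D * M.+1 ^ 2 <= 2 ^ M)%N.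
Proof.
move=> DM; pose j := (M %/ 4)%N.
have Mj : (M.+1 <= 4 * j.+1)%N by rewrite /j; lia.
have j2 : (j.+1 <= 2 ^ j)%N by rewrite ltn_expl.
have D4 : (16 * D <= 2 ^ (2 * j))%N.
  by apply: ltnW; apply: leq_ltn_trans (ltn_expl _ (isT : (1 < 2)%N)); rewrite /j; lia.
apply: (@leq_trans (2 ^ (4 * j))); last by rewrite leq_exp2l // /j; lia.
have -> : (4 * j = 2 * j + (j + j))%N by lia.
rewrite 2!expnD -mulnn; apply: leq_trans (leq_mul D4 (leq_mul j2 j2)); nia.
Qed.

(** * Choice of parameters and rates on blocks of n *)

Section ConcentrationRate.
Variables (R : realType) (a : R).
Hypothesis a0 : 0 < a.

Definition concentration_bound M : R := (4 ^ M)%N%:R ^- 5 + expR (- a * (4 ^ M)%N%:R ^+ 2).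
Definition concentration_const : R := 512 * (1 + 6 / a ^+ 3).

Lemma concentration_const_ge0 : 0 <= concentration_const.
Proof.
apply: mulr_ge0; [exact: ler0n|apply: addr_ge0; first exact: ler01].
by apply: divr_ge0; [exact: ler0n|apply: exprn_ge0; exact: ltW].
Qed.

Lemma concentration_bound_ge0 M : 0 <= concentration_bound M.
Proof. by rewrite addr_ge0 ?invr_ge0 ?exprn_ge0 ?ler0n ?expR_ge0. Qed.

(** With t = 2^M we have n <= 512 t^9 and K = 4^M = t^2, so n K^(-5) = O(1/t). For the exponential,
    exp(-y) <= 6 / y^3 with y = a K^2 gives O(K^(-6)). *)
Lemma concentration_rate n M : (n < 512 ^ M.+1)%N -> n%:R * concentration_bound M <=
  concentration_const / 2 ^+ M.
Proof.
move=> nM.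
set K : R := (4 ^ M)%N%:R; have K0 : 0 < K by rewrite ltr0n expn_gt0.
have KE : K = (2 ^+ M) ^+ 2 by rewrite /K natrX -exprM mulnC exprM -(natrX _ 2 2).
set t : R := 2 ^+ M in KE *; have t0 : 0 < t by rewrite exprn_gt0.
have t1 : 1 <= t by rewrite exprn_ege1 // ler1n.
have nb : n%:R <= 512 * t ^+ 9.
  have -> : 512 * t ^+ 9 = (512 ^ M.+1)%N%:R :> R.
    by rewrite /t exprAC -(natrX _ 2 9) -natrX -natrM -expnS.
  by rewrite ler_nat ltnW.
have e6 : expR (- a * K ^+ 2) <= 6 / (a ^+ 3 * K ^+ 6).
  have y0 : 0 <= a * K ^+ 2 by rewrite mulr_ge0 ?exprn_ge0 ?ltW.
  have := @expR_ge1Dxn R _ 2 y0 => e3.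
  have {e3} e3 : (a * K ^+ 2) ^+ 3 / 6 <= expR (a * K ^+ 2).
    by apply: le_trans e3; rewrite lerDr.
  rewrite mulNr expRN -[leRHS]invrK lef_pV2 ?posrE ?expR_gt0 ?invr_gt0 ?divr_gt0 ?mulr_gt0 ?exprn_gt0 //.
  apply: le_trans e3; rewrite le_eqVlt; apply/orP; left; apply/eqP; field.
  by rewrite !gt_eqF.
apply: (@le_trans _ _ (512 * t ^+ 9 * (K ^- 5 + 6 / (a ^+ 3 * K ^+ 6)))).
  by apply: ler_pM; rewrite ?ler0n ?concentration_bound_ge0 // lerD2l.
have -> : 512 * t ^+ 9 * (K ^- 5 + 6 / (a ^+ 3 * K ^+ 6)) = 512 * (1 / t + 6 / a ^+ 3 * (1 / t ^+
  3)).
  by rewrite KE; field; rewrite !gt_eqF.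
have -> : concentration_const / t = 512 * (1 / t + 6 / a ^+
  3 * (1 / t)) by rewrite /concentration_const; ring.
apply: ler_wpM2l; first exact: ler0n.
rewrite lerD2l; apply: ler_wpM2l; first by rewrite divr_ge0 ?exprn_ge0 ?ltW.
rewrite !div1r lef_pV2 ?posrE ?exprn_gt0 //.
by apply: (ler_eXnr (n := 3)).
Qed.

End ConcentrationRate.

Lemma sqr_mul_pow_le (R : realFieldType) (r Q x : R) m M : 0 <= r -> r <= 1 ->
  r ^+ m <= Q ^- 3 -> 1 <= Q -> 0 <= x <= Q ^+ M.+1 -> x ^+ 2 * r ^+ (27 * m * M.+1) <= (Q ^+ M)^-1.
Proof.
move=> r0 r1 rm Q1 /andP[x0 xQ]; have Q0 : 0 < Q := lt_le_trans ltr01 Q1.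
have rm1 : r ^+ m <= 1 by rewrite exprn_ile1.
have rd : r ^+ (27 * m * M.+1) <= (Q ^- 3) ^+ M.+1.
  rewrite (mulnC 27) 2!exprM; have Q30 : 0 <= Q ^- 3 by rewrite invr_ge0 exprn_ge0 ?ltW.
  apply: lerXn2r; rewrite ?nnegrE ?exprn_ge0 //.
  apply: (le_trans _ rm); rewrite -[leRHS]expr1; apply: ler_wiXn2l; by rewrite ?exprn_ge0.
have xx : x ^+ 2 <= (Q ^+ M.+1) ^+ 2.
  by apply: lerXn2r; rewrite ?nnegrE ?exprn_ge0 ?(ltW Q0).
apply: (le_trans (ler_pM (sqr_ge0 _) _ xx rd)); first by rewrite exprn_ge0.
have -> : (Q ^- 3) ^+ M.+1 = (Q ^+ M.+1) ^- 3 by rewrite exprVn -!exprM mulnC.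
have QM : 1 <= Q ^+ M by rewrite exprn_ege1.
have -> : (Q ^+ M.+1) ^+ 2 * (Q ^+ M.+1) ^- 3 = (Q ^+ M.+1)^-1.
  by field; rewrite gt_eqF ?exprn_gt0.
by rewrite lef_pV2 ?posrE ?exprn_gt0 // exprS; apply: ler_peMl => //; rewrite exprn_ge0 ?(ltW Q0).
Qed.

Section Rates.
Variables (R : realType) (p : 'I_3 -> R) (q : R).
Hypotheses (p_ge0 : forall i, 0 <= p i) (p_sum1 : \sum_(i < 3) p i = 1).
Hypothesis (p_le : forall i, p i <= q).
Hypothesis (q_lt : q * Num.sqrt 3 < 1).
Hypothesis spread_gt0 : 0 < spread p.

Let rho := q * Num.sqrt 3.
Let rho_ge0 : 0 <= rho.
Proof. by rewrite mulr_ge0 ?sqrtr_ge0 // (le_trans _ (p_le ord0)). Qed.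
Let a := spread p / 4500.
Let a0 : 0 < a. Proof. by apply: divr_gt0; [exact: spread_gt0|rewrite ltr0n]. Qed.
Let s := concentration_bound a.
Let C2 := concentration_const a.

(** The base 512 = 2 * 256 splits n: the factor 2^M bounds the steps 2 d0^2, and 256^M = K^4 with K
    = 4^M is the length of the progressions. The concentration s is about K^(-5) = 1024^(-M), so n s
    = O(2^(-M)), and the 2 d0^2 + 1 terms cost O(2^M (n s)^2) = O(2^(-M)). *)
Lemma exceptional_rate : exists C3 M0, forall n M, (M0 <= M)%N -> (512 ^ M <= n < 512 ^ M.+1)%N ->
  [/\ n%:R ^+ 2 * Pr p (@exceptional n R) <= C3 / 2 ^+ M,
      Pr p (fun x : {ffun 'I_n.+1 -> 'I_3} => iroot2 (1 : R[i]) (ipoly x)) <= C3 / 2 ^+ M &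
      Pr p (fun x : {ffun 'I_n.+1 -> 'I_3} => iroot2 (-1 : R[i]) (ipoly x)) <= C3 / 2 ^+ M].
Proof.
have [m rm] : exists m, rho ^+ m.+1 <= 512 ^- 3.
  have h : 0 < 512 ^- 3 :> R by rewrite invr_gt0; apply: exprn_gt0; rewrite ltr0n.
  have := @cvg_expr R rho; rewrite ger0_norm // => /(_ q_lt).
  move/cvgr_lt => /(_ _ h) [m _ Hm]; exists m; apply: ltW.
  by apply: (Hm m.+1); rewrite /=.
(* The factor m + 1 makes rho^d0 beat n^2. The factor 27 = 3 * 9 comes from 2 * 3^3 <= 4^3: raised
   to the ninth power, 512 * 3^27 <= 4^27. [D] is chosen so that 2 d0^2 = D (M+1)^2, which 2^M
   dominates once M >= 64 D. *)
pose C := (27 * m.+1)%N; pose D := (2 * C ^ 2)%N.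
pose A := 2 + 4 / (1 - rho).
have r1 : 0 < 1 - rho by rewrite subr_gt0.
have A0 : 0 <= A by rewrite addr_ge0 // divr_ge0 // ltW.
exists (A + 2 * C2 ^+ 2 + C2), (64 * D).+1 => n M; rewrite -ltnS => M0 /andP[nl nu].
have M64 : (64 * D <= M)%N by lia.
have M1 : (1 <= M)%N by lia.
pose d0 := (C * M.+1)%N.
have d00 : (0 < d0)%N by rewrite !muln_gt0.
have d2 : (2 * d0 ^ 2 <= 2 ^ M)%N.
  by apply: leq_trans (sqr_le_exp2 M64); rewrite /D /d0 expnMn; lia.
have c34 : (n.+1 * 3 ^ d0 <= 4 ^ d0)%N.
  apply: (@leq_trans ((2 ^ 9 * 3 ^ C) ^ M.+1)).
    by rewrite expnMn -[X in (_ <= X)%N]/(512 ^ M.+1 * _)%N -expnM leq_mul2r nu orbT.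
  rewrite /d0 expnM leq_exp2r //; apply: (@leq_trans (((2 * 3 ^ 3) ^ 9) ^ m.+1)).
    rewrite /C 2!expnMn -!expnM mulnA leq_mul2r; apply/orP; right.
    by rewrite leq_exp2l //; lia.
  by rewrite /C (_ : 27 * m.+1 = 3 * 9 * m.+1)%N // !expnM !leq_exp2r.
have pw : (512 ^ M = 2 ^ M * 256 ^ M)%N by rewrite -expnMn.
have c1 : (32 * d0 ^ 2 * (2 * d0 ^ 2 + 3 * d0) <= n)%N.
  apply: leq_trans nl; rewrite pw.
  apply: (@leq_trans ((2 * d0 ^ 2) * (128 * d0 ^ 2)))%N.
    have : (d0 <= d0 ^ 2)%N by rewrite -mulnn leq_pmulr.
    move: (d0 ^ 2)%N => e ed; nia.
  apply: (leq_mul d2).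
  have h : (128 <= 128 ^ M)%N by rewrite -[X in (X <= _)%N]expn1 leq_exp2l.
  have -> : (256 ^ M = 128 ^ M * 2 ^ M)%N by rewrite -expnMn.
  apply: (leq_mul h); apply: leq_trans d2; lia.
have N4 : ((4 ^ M) ^ 4 = 256 ^ M)%N by rewrite expnAC.
have c2 : (2 * d0 ^ 2 * (4 ^ M) ^ 4 <= n.+1)%N.
  by rewrite N4; apply: leqW; apply: leq_trans nl; rewrite pw leq_mul2r d2 orbT.
have K1 : (1 < 4 ^ M)%N by rewrite -[X in (X < _)%N](exp1n M) ltn_exp2r.
have conc := @concentrationP R p p_ge0 p_sum1 n _ K1;
  rewrite -/a -/(concentration_bound a M) -/(s M) in conc.
have t0 : 0 < 2 ^+ M :> R by rewrite exprn_gt0.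
have n1 : 1 <= n%:R :> R.
  by rewrite ler1n; apply: leq_trans nl; rewrite expn_gt0.
have ns := concentration_rate a0 nu; rewrite -/(s M) -/C2 in ns.
have C20 : 0 <= C2 := concentration_const_ge0 a0.
have s0 : 0 <= s M := concentration_bound_ge0 a M.
have sC : s M <= (A + 2 * C2 ^+ 2 + C2) / 2 ^+ M.
  apply: (@le_trans _ _ (n%:R * s M)); first by rewrite ler_peMl ?s0.
  apply: le_trans ns _; rewrite ler_pM2r ?invr_gt0 // lerDr addr_ge0 // mulr_ge0 ?exprn_ge0 //.
have two : (2 * (4 ^ M) ^ 4 <= n.+1)%N.
  apply: leq_trans c2; rewrite leq_mul2r; apply/orP; right.
  by rewrite -[X in (X <= _)%N]muln1 leq_mul2l expn_gt0 d00.
have dbl (z : R[i]) : z ^+ 2 = 1 ->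
    Pr p (fun x : {ffun 'I_n.+1 -> 'I_3} => iroot2 z (ipoly x)) <= (A + 2 * C2 ^+ 2 + C2) / 2 ^+ M.
  move=> z2; apply: (le_trans _ sC).
  exact: (@Pr_double_root_unity n R p p_ge0 p_sum1 _ z 2 _ _ isT two z2 conc).
split; [|by apply: dbl; rewrite expr1n|by apply: dbl; rewrite sqrrN expr1n].
have := @Pr_exceptional n R p p_ge0 p_sum1 q p_le q_lt d0 _ _ d00 c34 c1 c2 conc.
rewrite -/rho -/A => ex.
apply: (@le_trans _ _ (A / 2 ^+ M + 2 * C2 ^+ 2 / 2 ^+ M)); last first.
  by rewrite -mulrDl ler_pM2r ?invr_gt0 // lerDl.
apply: le_trans (ler_wpM2l (sqr_ge0 _) ex) _; rewrite mulrDr; apply: lerD.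
  rewrite mulrCA; apply: ler_wpM2l => //.
  have nn : 0 <= (n%:R : R) <= 512 ^+ M.+1.
    by apply/andP; split; [exact: ler0n|rewrite -natrX ler_nat ltnW].
  have Q1 : 1 <= (512 : R) by rewrite ler1n.
  have h := sqr_mul_pow_le rho_ge0 (ltW q_lt) rm Q1 nn; apply: (le_trans h).
  rewrite lef_pV2 ?posrE ?exprn_gt0 ?(lt_le_trans ltr01 Q1) // -!natrX ler_nat.
  by rewrite leq_exp2r.
have -> : n%:R ^+ 2 * ((2 * d0 ^ 2).+1%:R * s M ^+ 2) = (2 * d0 ^ 2).+1%:R * (n%:R * s M) ^+
  2 by ring.
have h1 : (2 * d0 ^ 2).+1%:R <= 2 * 2 ^+ M :> R.
  by rewrite -natrX -natrM ler_nat; apply: leq_ltn_trans d2 _; rewrite ltn_Pmull // expn_gt0.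
have h2 : (n%:R * s M) ^+ 2 <= (C2 / 2 ^+ M) ^+ 2.
  apply: lerXn2r; last exact: ns; rewrite nnegrE.
    exact: mulr_ge0 (ler0n _ _) s0.
  exact: divr_ge0 C20 (ltW t0).
apply: le_trans (ler_pM (ler0n _ _) (sqr_ge0 _) h1 h2) _.
rewrite le_eqVlt; apply/orP; left; apply/eqP; field.
by rewrite gt_eqF.
Qed.

Lemma near_rate (C3 : R) : C3 / 2 ^+ trunc_log 512 n @[n --> \oo] --> 0.
Proof.
rewrite -[X in _ --> X](mulr0 C3); apply: cvgMr.
have h : (2^-1 : R) ^+ n @[n --> \oo] --> 0.
  by apply: cvg_expr; rewrite ger0_norm ?invr_ge0 // invf_lt1 ?ltr1n.
have -> : (fun n => (2 ^+ trunc_log 512 n)^-1 : R) = (fun M => 2^-1 ^+ M) \o trunc_log 512.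
  by apply/funext => n /=; rewrite exprVn.
apply: cvg_comp h; move=> A [M _ HM]; exists (512 ^ M)%N => // n /= Mn.
by apply: HM => /=; apply: trunc_log_max.
Qed.

Lemma rate_cvg (f : nat -> R) : (forall n, 0 <= f n) ->
  (exists C3 M0, forall n M, (M0 <= M)%N -> (512 ^ M <= n < 512 ^ M.+1)%N -> f n <= C3 / 2 ^+ M) ->
  f n @[n --> \oo] --> 0.
Proof.
move=> f0 [C3 [M0 H]]; apply: (squeeze_cvgr _ (cvg_cst 0) (near_rate C3)).
exists (512 ^ M0)%N => // n /= Mn; rewrite f0 /=.
have n0 : (0 < n)%N by apply: leq_trans Mn; rewrite expn_gt0.
by apply: H; [exact: trunc_log_max|exact: trunc_log_bounds].
Qed.

Lemma exceptional_cvg : n%:R ^+ 2 * Pr p (@exceptional n R) @[n --> \oo] --> 0.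
Proof.
apply: rate_cvg => [n|]; first by rewrite mulr_ge0 ?sqr_ge0 // Pr_ge0.
have [C3 [M0 H]] := exceptional_rate; exists C3, M0 => n M h1 h2.
by have [] := H n M h1 h2.
Qed.

Lemma double_root1_cvg :
  Pr p (fun x : {ffun 'I_n.+1 -> 'I_3} => iroot2 (1 : R[i]) (ipoly x)) @[n --> \oo] --> 0.
Proof.
apply: rate_cvg => [n|]; first by rewrite Pr_ge0.
have [C3 [M0 H]] := exceptional_rate; exists C3, M0 => n M h1 h2.
by have [] := H n M h1 h2.
Qed.

Lemma double_rootN1_cvg :
  Pr p (fun x : {ffun 'I_n.+1 -> 'I_3} => iroot2 (-1 : R[i]) (ipoly x)) @[n --> \oo] --> 0.
Proof.
apply: rate_cvg => [n|]; first by rewrite Pr_ge0.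
have [C3 [M0 H]] := exceptional_rate; exists C3, M0 => n M h1 h2.
by have [] := H n M h1 h2.
Qed.

End Rates.

(** * Double roots at 0, 1 and -1 *)

Section UnitRoots.
Variables (R : realType) (n : nat).
Implicit Types (x : {ffun 'I_n.+1 -> 'I_3}) (P : {poly int}) (z : R[i]) (c : int).

Lemma dvdp_sqr_iroot2 P z : ('X - z%:P) ^+ 2 %| map_poly intr P <-> iroot2 z P.
Proof.
have lz : ('X - z%:P).[z] = 0 by rewrite hornerXsubC subrr.
rewrite /iroot2 /iroot -deriv_map; set Q := map_poly _ _; split.
  move=> /dvdpP[r ->]; move: ('X - z%:P) lz => l lz.
  by rewrite expr2 !derivM /root !(hornerD, hornerM) lz !(mulr0, mul0r, addr0) eqxx.
case=> /factor_theorem[r ->]; rewrite derivM derivXsubC mulr1 /root.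
rewrite hornerD hornerM lz mulr0 add0r => rz.
by rewrite expr2 dvdp_mul2r ?polyXsubC_eq0 // dvdp_XsubCl.
Qed.

Lemma iroot_int P c : iroot P (c%:~R : R[i]) = (P.[c] == 0).
Proof. by rewrite /iroot /root horner_map intr_eq0. Qed.

Lemma horner_ipoly_int x c : (ipoly x).[c] = \sum_(j < n.+1) val3 (x j) * c ^+ j.
Proof.
have := @horner_ipoly n int x c; rewrite map_poly_id => [->|d _]; last by rewrite intz.
by apply: eq_bigr => j _; rewrite intz.
Qed.

Lemma iroot2_int x c : c != 0 -> iroot2 (c%:~R : R[i]) (ipoly x) <->
  \sum_(j < n.+1) val3 (x j) * c ^+ j = 0 /\ \sum_(j < n.+1) val3 (x j) * j%:Z * c ^+ j = 0.
Proof.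
move=> c0; rewrite /iroot2 !iroot_int horner_ipoly_int.
have -> : \sum_(j < n.+1) val3 (x j) * j%:Z * c ^+ j = c * (ipoly x)^`().[c].
  transitivity ('X * (ipoly x)^`()).[c]; last by rewrite hornerM hornerX.
  rewrite (@horner_coef_wide _ n.+1).
    apply: eq_bigr => -[j jn] _; rewrite coefXM coef_deriv /=.
    case: j jn => [|j] jn /=; first by rewrite mulr0.
    by rewrite (coef_ipoly x (Ordinal jn)) -mulr_natr natz.
  apply: leq_trans (size_polyMleq _ _) _; rewrite size_polyX add2n /= ltnS.
  apply/leq_sizeP => i ni; rewrite coef_deriv nth_default ?mul0rn //.
  by apply: leq_trans (size_ipoly x) _.
split=> -[/eqP h1 h2]; split; rewrite ?h1 //; first by rewrite (eqP h2) mulr0.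
by move/eqP: h2; rewrite mulf_eq0 (negPf c0).
Qed.

Lemma iroot2N1 x : iroot2 (-1 : R[i]) (ipoly x) <->
  altsum (fun=> 1) x = 0 /\ altsum (fun j => j%:Z) x = 0.
Proof.
have -> : -1 = (-1)%:~R :> R[i] by rewrite mulrN1z.
rewrite iroot2_int //.
have -> : altsum (fun=> 1) x = \sum_(j < n.+1) val3 (x j) * (-1) ^+ j.
  by apply: eq_bigr => j _; ring.
have -> // : altsum (fun j => j%:Z) x = \sum_(j < n.+1) val3 (x j) * j%:Z * (-1) ^+ j.
by apply: eq_bigr => j _; ring.
Qed.

Lemma iroot2_1 x : iroot2 (1 : R[i]) (ipoly x) <->
  \sum_(j < n.+1) val3 (x j) = 0 /\ \sum_(j < n.+1) val3 (x j) * j%:Z = 0.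
Proof.
rewrite -[1]/(1%:~R) iroot2_int //.
have -> : \sum_(j < n.+1) val3 (x j) * 1 ^+ j = \sum_(j < n.+1) val3 (x j) :> int.
  by apply: eq_bigr => j _; rewrite expr1n mulr1.
have -> // : \sum_(j < n.+1) val3 (x j) * j%:Z * 1 ^+ j = \sum_(j < n.+1) val3 (x j) * j%:Z :> int.
by apply: eq_bigr => j _; rewrite expr1n mulr1.
Qed.

Variable (p : 'I_3 -> R).
Hypotheses (p_ge0 : forall i, 0 <= p i) (p_sum1 : \sum_(i < 3) p i = 1).

Lemma Pr_iroot2_0 : (0 < n)%N -> Pr p (fun x => iroot2 (0 : R[i]) (ipoly x)) = p (inord 1) ^+ 2.
Proof.
move=> n0; pose o1 : 'I_n.+1 := inord 1.
have o1E : o1 = 1%N :> nat by rewrite inordK.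
have v31 (i : 'I_3) : (val3 i == 0) = (i == inord 1).
  by rewrite -(inj_eq val3_inj) /val3 inordK.
transitivity (Pr p (fun x => forall i, i \in [set ord0; o1]%SET -> x i = inord 1)).
  apply: eq_Pr => // x; rewrite /iroot2 -[0]/(0%:~R) !iroot_int !horner_coef0 coef_deriv mulr1n.
  have e0 : (ipoly x)`_0 = val3 (x ord0) := coef_ipoly x ord0.
  have e1 : (ipoly x)`_1 = val3 (x o1) by have := coef_ipoly x o1; rewrite {1}o1E.
  rewrite e0 e1 !v31 {e0 e1}; split.
    by case=> /eqP h0 /eqP h1 i; rewrite !inE => /orP[/eqP ->|/eqP ->].
  by move=> H; split; apply/eqP; apply: H; rewrite !inE eqxx ?orbT.
rewrite (Pr_cylinder p_sum1) big_setU1 ?big_set1 ?expr2 //= inE.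
by rewrite -(inj_eq val_inj) /= o1E.
Qed.

Definition double_root x := has_double_root (rand_poly R x).

Lemma prob_double_rootE : prob_double_root p n = Pr p double_root.
Proof. by []. Qed.

Lemma double_rootE x : double_root x <->
  [\/ iroot2 (0 : R[i]) (ipoly x), iroot2 (1 : R[i]) (ipoly x), iroot2 (-1 : R[i]) (ipoly x)
    | exists2 z : R[i], ('X - z%:P) ^+ 2 %| map_poly intr (ipoly x) & [/\ z != 0, z != 1 & z !=
      -1]].
Proof.
rewrite /double_root /has_double_root rand_polyE; split.
  move=> [z dz]; have [z0|z0] := eqVneq z 0; first by apply: Or41; rewrite -z0 -dvdp_sqr_iroot2.
  have [z1|z1] := eqVneq z 1; first by apply: Or42; rewrite -z1 -dvdp_sqr_iroot2.
  have [zN|zN] := eqVneq z (-1); first by apply: Or43; rewrite -zN -dvdp_sqr_iroot2.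
  by apply: Or44; exists z.
by case=> [/dvdp_sqr_iroot2 h|/dvdp_sqr_iroot2 h|/dvdp_sqr_iroot2 h|[z h _]]; eexists; exact: h.
Qed.

Let D1 := Pr p (fun x => iroot2 (1 : R[i]) (ipoly x)).
Let DN1 := Pr p (fun x => iroot2 (-1 : R[i]) (ipoly x)).
Let D0 := Pr p (fun x => iroot2 (0 : R[i]) (ipoly x)).

Lemma Pr_double_root_le : Pr p double_root <= D0 + (D1 + DN1) + Pr p (@exceptional n R).
Proof.
apply: (@le_trans _ _ (Pr p (fun x => (iroot2 (0 : R[i]) (ipoly x) \/
    (iroot2 (1 : R[i]) (ipoly x) \/ iroot2 (-1 : R[i]) (ipoly x))) \/ exceptional R x))).
  apply: Pr_le => // x /double_rootE[?|?|?|?]; try by left; tauto.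
  by right; left.
apply: le_trans (Pr_or p_ge0 _ _) _; rewrite lerD2r.
apply: le_trans (Pr_or p_ge0 _ _) _; rewrite lerD2l; exact: Pr_or.
Qed.

Lemma Pr_double_root_ge0 : D0 <= Pr p double_root.
Proof. by apply: Pr_le => // x h; apply/double_rootE; apply: Or41. Qed.

(** Inclusion-exclusion for the roots 1 and -1, whose joint event is exceptional. *)
Lemma Pr_double_root_ge : D1 + DN1 - Pr p (@exceptional n R) <= Pr p double_root.
Proof.
rewrite /D1 /DN1 -Pr_or_and lerBlDr; apply: lerD.
  by apply: Pr_le => // x [h|h]; apply/double_rootE; [apply: Or42|apply: Or43].
by apply: Pr_le => // x h; right.
Qed.

End UnitRoots.

(** * Roots 1 and -1 with nonzero coefficients: parity, symmetry, exponential tilting *)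

Section SignedRoots.
Variables (R : realType) (p : 'I_3 -> R).
Hypotheses (p_ge0 : forall i, 0 <= p i) (p_sum1 : \sum_(i < 3) p i = 1).
Hypothesis p10 : p (inord 1) = 0.

Definition prob_double1 n := Pr p (fun x : {ffun 'I_n.+1 -> 'I_3} => iroot2 (1 : R[i]) (ipoly x)).
Definition prob_doubleN1 n := Pr p (fun x : {ffun 'I_n.+1 -> 'I_3} => iroot2 (-1 : R[i]) (ipoly x)).

Lemma prob_doubleN1E n : prob_doubleN1 n = prob0 p n.
Proof. by apply: (eq_Pr p_ge0) => x; exact: iroot2N1. Qed.

Lemma sum_val3_half n (e : nat -> int) (x : {ffun 'I_n.+1 -> 'I_3}) : weight p x != 0 ->
  exists m : int, \sum_(j < n.+1) val3 (x j) * e j = 2 * m - \sum_(j < n.+1) e j.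
Proof.
move=> /(altsum_half p10 (fun j => (-1) ^+ j * e j))[m E]; exists m.
transitivity (altsum (fun j => (-1) ^+ j * e j) x).
  by apply: eq_bigr => j _; rewrite mulrA -expr2 sqrr_sign mul1r mulrC.
rewrite E; congr (_ - _); apply: eq_bigr => j _.
by rewrite mulrA -expr2 sqrr_sign mul1r.
Qed.

Lemma sum_id_int n : 2 * \sum_(j < n.+1) j%:Z = (n * n.+1)%N%:Z.
Proof.
elim: n => [|n IH]; first by rewrite big_ord_recr big_ord0.
by rewrite big_ord_recr mulrDr IH /=; lia.
Qed.

(** Both sums have the parity of their weights, so n + 1 and n (n+1) / 2 must be even; n is then odd
    and 4 divides n + 1. *)
Lemma prob_double1_eq0 n : ~~ (4 %| n.+1)%N -> prob_double1 n = 0.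
Proof.
move=> n4; transitivity (Pr p (fun x : {ffun 'I_n.+1 -> 'I_3} => False));
  last by apply: Pr_false => x [].
apply: eq_Pr_supp => // x wx; split=> // /iroot2_1[s0 s1].
have [m E] := sum_val3_half (fun=> 1) wx; have [m' E'] := sum_val3_half (fun j => j%:Z) wx.
rewrite s1 in E'; have s1' := sum_id_int n.
have E0 : \sum_(j < n.+1) val3 (x j) * 1 = 0.
  by rewrite -[RHS]s0; apply: eq_bigr => j _; rewrite mulr1.
rewrite E0 sumr_const card_ord natz in E.
move: (\sum_(j < n.+1) j%:Z) s1' E' => S s1' E'; clear -n4 E E' s1'.
have {s1' E'} h : 4 * m' = (n * n.+1)%N%:Z by lia.
have [k nk] : exists k, n.+1 = (2 * k)%N by exists (absz m); lia.
have hk : 2 * m' = (n * k)%N%:Z by nia.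
have ke : ~~ odd k by have : odd (n * k) = false; [lia|rewrite oddM; lia].
lia.
Qed.

(** For n even the weights (-1)^j sum to 1; for n odd the weights (-1)^j j sum to -(n+1)/2, which
    has to be even. *)
Lemma prob_doubleN1_eq0 n : ~~ (4 %| n.+1)%N -> prob_doubleN1 n = 0.
Proof.
move=> n4; rewrite prob_doubleN1E.
transitivity (Pr p (fun x : {ffun 'I_n.+1 -> 'I_3} => False)); last by apply: Pr_false => x [].
apply: eq_Pr_supp => // x wx; split=> // -[s0 s1].
have [m E] := altsum_half p10 (fun=> 1) wx; have [m' E'] := altsum_half p10 (fun j => j%:Z) wx.
rewrite s0 in E; rewrite s1 in E'.
have [nodd|neven] := boolP (odd n); last first.
  have hs := sum_alt_int n./2; have nE : (n./2).*2 = n by lia.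
  rewrite nE in hs; move: E.
  by rewrite big_ord_recr /= hs -signr_odd (negPf neven) expr0; lia.
have hs := sum_alt_id_int (n.+1)./2; have nE : (n.+1)./2.*2 = n.+1 by lia.
by rewrite nE in hs; move: E'; rewrite hs; lia.
Qed.

Lemma val3_rev_ord (i : 'I_3) : val3 (rev_ord i) = - val3 i.
Proof. by case: i => [[|[|[|]]]]. Qed.

(** Changing the signs of the odd coefficients, that is P(X) into P(-X), preserves a symmetric law
    and exchanges the roots 1 and -1. In the encoding, negation is [rev_ord]. *)
Lemma prob_double1_sym n : p (inord 0) = p (inord 2) -> prob_double1 n = prob_doubleN1 n.
Proof.
move=> p02; pose f (x : {ffun 'I_n.+1 -> 'I_3}) : {ffun 'I_n.+1 -> 'I_3} := [ffun j =>
  if odd (nat_of_ord j) then rev_ord (x j) else x j].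
have fK : involutive f.
  by move=> x; apply/ffunP => j; rewrite /f !ffunE; case: (odd j) => //; rewrite rev_ordK.
have prev i : p (rev_ord i) = p i.
  have e0 : rev_ord (inord 0) = inord 2 :> 'I_3 by apply/ord_inj; rewrite /= !inordK.
  have e1 : rev_ord (inord 1) = inord 1 :> 'I_3 by apply/ord_inj; rewrite /= !inordK.
  have : [\/ i = inord 0, i = inord 1 | i = inord 2].
    by case: i => [[|[|[|]]]] // h; [apply: Or31|apply: Or32|apply: Or33]; apply/ord_inj;
      rewrite inordK.
  by case=> ->; rewrite -?e0 ?rev_ordK ?e1 // e0 p02.
rewrite /prob_double1 /Pr (reindex f) /=; last by apply: onW_bij; exact: inv_bij.
apply: eq_bigr => x _; congr (_ * _).
  by apply: eq_bigr => j _; rewrite ffunE; case: ifP.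
congr (nat_of_bool _)%:R; apply: asbool_equiv_eq; rewrite iroot2_1 iroot2N1.
have vf j : val3 (f x j) = (-1) ^+ j * val3 (x j).
  by rewrite ffunE -signr_odd; case: odd; rewrite ?expr0 ?mul1r // val3_rev_ord expr1 mulN1r.
have -> : altsum (fun=> 1) x = \sum_(j < n.+1) val3 (f x j).
  by apply: eq_bigr => j _; rewrite vf mulr1.
have -> // : altsum (fun j => j%:Z) x = \sum_(j < n.+1) val3 (f x j) * j%:Z.
by apply: eq_bigr => j _; rewrite vf; ring.
Qed.

Hypothesis (p00 : 0 < p (inord 0)) (p20 : 0 < p (inord 2)).
Let b := 2 * (Num.sqrt (p (inord 0)) * Num.sqrt (p (inord 2))).

(** Chernoff bound: the indicator of S = 0 is at most lambda^S. The optimal lambda = sqrt (p_0 /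
    p_2) gives each factor the mean 2 sqrt (p_0 p_2), less than 1 when the two atoms differ. *)
Lemma Pr_sum0_le n : Pr p (fun x : {ffun 'I_n.+1 -> 'I_3} => \sum_(j < n.+1) val3 (x j) = 0) <=
  b ^+ n.+1.
Proof.
rewrite /b; set u := Num.sqrt (p (inord 0)); set v := Num.sqrt (p (inord 2)).
have u0 : 0 < u by rewrite sqrtr_gt0.
have v0 : 0 < v by rewrite sqrtr_gt0.
have lam0 : u / v != 0 by rewrite mulf_neq0 ?invr_eq0 // gt_eqF.
have -> : (2 * (u * v)) ^+ n.+1 = \prod_(j < n.+1) \sum_a p a * (u / v) ^ val3 a.
  rewrite prodr_const card_ord; congr (_ ^+ _); rewrite sum3E p10 mul0r addr0.
  have -> : val3 (inord 0) = -1 by rewrite /val3 inordK.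
  have -> : val3 (inord 2) = 1 by rewrite /val3 inordK.
  rewrite exprN1 expr1z -(sqr_sqrtr (ltW p00)) -(sqr_sqrtr (ltW p20)) -/u -/v.
  by field; rewrite !gt_eqF.
rewrite (bigA_distr_bigA (fun (_ : 'I_n.+1) a => p a * (u / v) ^ val3 a)).
apply: ler_sum => x _; rewrite [leRHS]big_split -/(weight p x).
have w0 := weight_ge0 p_ge0 x; apply: (ler_wpM2l w0).
have pr : \prod_(j < n.+1) (u / v) ^ val3 (x j) = (u / v) ^ (\sum_(j < n.+1) val3 (x j)).
  by elim/big_rec2: _ => [|j y z _ ->]; rewrite ?expr0z // -expfzDr.
rewrite pr; case: asboolP => [->|_]; first by rewrite expr0z.
by rewrite exprz_ge0 // divr_ge0 // ltW.
Qed.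

Lemma sqr_mul_expr_cvg (c : R) : 0 < c -> c < 1 -> n%:R ^+ 2 * c ^+ n.+1 @[n --> \oo] --> 0.
Proof.
move=> c0 c1; pose a := - ln c; have a0 : 0 < a by rewrite oppr_gt0 ln_lt0 // c0.
have h : 6 / a ^+ 3 * harmonic n @[n --> \oo] --> (0 : R).
  by rewrite -[X in _ --> X](mulr0 (6 / a ^+ 3)); apply: cvgMr; exact: cvg_harmonic.
apply: (squeeze_cvgr _ (cvg_cst 0) h); apply: nearW => n.
apply/andP; split; first by rewrite mulr_ge0 ?sqr_ge0 // exprn_ge0 // ltW.
have -> : c ^+ n.+1 = expR (- (a * n.+1%:R)).
  by rewrite /a mulNr opprK mulrC expRM_natl lnK.
set N : R := n.+1%:R; have N0 : 0 < N by rewrite ltr0n.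
have aN : 0 < a * N by rewrite mulr_gt0.
have := @expR_ge1Dxn R _ 2 (ltW aN) => e3.
have {e3} e3 : (a * N) ^+ 3 / 6 <= expR (a * N) by apply: le_trans e3; rewrite lerDr.
have nN : n%:R ^+ 2 <= N ^+ 2 by rewrite lerXn2r ?nnegrE ?ler0n // ler_nat.
apply: (le_trans (ler_wpM2r (expR_ge0 _) nN)).
rewrite expRN ler_pdivrMr ?expR_gt0 // /harmonic /= -/N.
have k0 : 0 <= 6 / a ^+ 3 / N by rewrite !divr_ge0 ?exprn_ge0 ?(ltW a0) ?(ltW N0).
apply: le_trans (ler_wpM2l k0 e3).
by rewrite le_eqVlt; apply/orP; left; apply/eqP; field; rewrite !gt_eqF.
Qed.

Lemma prob_double1_cvg : p (inord 0) != p (inord 2) ->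
  n%:R ^+ 2 * prob_double1 n @[n --> \oo] --> 0.
Proof.
move=> p02; have b0 : 0 < b by rewrite /b !mulr_gt0 ?sqrtr_gt0.
have b1 : b < 1.
  rewrite -(ltr_pXn2r (n := 2)) ?nnegrE ?(ltW b0) // expr1n /b !exprMn !sqr_sqrtr ?ltW //.
  have := p_sum1; rewrite sum3E p10 addr0 => e.
  have : 0 < (p (inord 0) - p (inord 2)) ^+ 2 by rewrite exprn_even_gt0 //= subr_eq0.
  have -> : p (inord 2) = 1 - p (inord 0) by lra.
  nra.
apply: (squeeze_cvgr _ (cvg_cst 0) (sqr_mul_expr_cvg b0 b1)); apply: nearW => n.
rewrite mulr_ge0 ?sqr_ge0 ?Pr_ge0 //=; apply: ler_wpM2l; first exact: sqr_ge0.
by apply: le_trans (Pr_sum0_le n); apply: Pr_le => // x /iroot2_1[].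
Qed.

Lemma var3E : var3 p = spread p.
Proof.
rewrite (spreadE p_sum1 p10) /var3 /mean3 !sum3E p10 !mul0r !addr0.
have -> : val3 (inord 0) = -1 by rewrite /val3 inordK.
have -> : val3 (inord 2) = 1 by rewrite /val3 inordK.
have := p_sum1; rewrite sum3E p10 addr0 => e.
have -> : p (inord 2) = 1 - p (inord 0) by lra.
by rewrite mulrN1z mulr1z; ring.
Qed.

Lemma mean3_eq0 : (mean3 p == 0) = (p (inord 0) == p (inord 2)).
Proof.
rewrite /mean3 sum3E p10 mul0r addr0.
have -> : val3 (inord 0) = -1 by rewrite /val3 inordK.
have -> : val3 (inord 2) = 1 by rewrite /val3 inordK.
by rewrite mulrN1z mulr1z mulrN1 mulr1 addrC subr_eq0 eq_sym.
Qed.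

Hypothesis spread_gt0 : 0 < spread p.

Lemma sqr_prob0_cvg : (4 * k + 3)%N%:R ^+ 2 * prob0 p (4 * k + 3)%N @[k --> \oo] -->
  4 * Num.sqrt 3 / (pi * spread p).
Proof.
have inv0 : ((4 * k + 3)%N.+1%:R : R)^-1 @[k --> \oo] --> 0.
  rewrite -[X in _ --> X](mulr0 0).
  have -> : (fun k => ((4 * k + 3)%N.+1%:R : R)^-1) = (fun k => (rootN R (4 * k +
    3)%N)^-1 * (rootN R (4 * k + 3)%N)^-1).
    by apply/funext => k; rewrite -invfM -expr2 sqr_rootN.
  by apply: cvgM; exact: cvg_inv_rootN.
have h0 : 1 - ((4 * k + 3)%N.+1%:R : R)^-1 @[k --> \oo] --> (1 - 0 : R).
  by apply: cvgB => //; exact: cvg_cst.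
have := cvgM (cvgM h0 h0) (prob0_cvg p_ge0 p_sum1 p10 spread_gt0).
have E k : (4 * k + 3)%N%:R = (1 - (4 * k + 3)%N.+1%:R^-1) * (4 * k + 3)%N.+1%:R :> R.
  by rewrite mulrBl mul1r mulVf ?pnatr_eq0 // -natr1 addrK.
have -> : (fun k => (4 * k + 3)%N%:R ^+ 2 * prob0 p (4 * k + 3)%N) =
   (fun k => (1 - (4 * k + 3)%N.+1%:R^-1) * (1 - (4 * k + 3)%N.+1%:R^-1) *
      ((4 * k + 3)%N.+1%:R ^+ 2 * prob0 p (4 * k + 3)%N)).
  apply/funext => k; rewrite {1}E; ring.
by rewrite subr0 !mul1r; apply.
Qed.

Lemma unit_roots_cvg : n%:R ^+ 2 * (prob_double1 n + prob_doubleN1 n) - L_seq p n @[n -->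
  \oo] --> 0.
Proof.
pose u n := n%:R ^+ 2 * (prob_double1 n + prob_doubleN1 n) - L_seq p n.
have k4 k : (4 %| (4 * k + 3)%N.+1)%N by lia.
have ucvg : u (4 * k + 3)%N @[k --> \oo] --> 0.
  pose l := 4 * Num.sqrt 3 / (pi * spread p).
  have h0 : (4 * k + 3)%N%:R ^+ 2 * prob0 p (4 * k + 3)%N - l @[k --> \oo] --> 0.
    by rewrite -(subrr l); apply: cvgB => //; [exact: sqr_prob0_cvg|exact: cvg_cst].
  case: (eqVneq (p (inord 0)) (p (inord 2))) => [p02|p02].
    have -> : (fun k => u (4 * k + 3)%N) = (fun k => 2 * ((4 * k + 3)%N%:R ^+
      2 * prob0 p (4 * k + 3)%N - l)).
      apply/funext => k; rewrite /u /L_seq k4 var3E mean3_eq0 p02 eqxx.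
      by rewrite prob_double1_sym // prob_doubleN1E /l; ring.
    by rewrite -[X in _ --> X](mulr0 2); apply: cvgMr.
  have -> : (fun k => u (4 * k + 3)%N) = (fun k => (4 * k + 3)%N%:R ^+ 2 * prob_double1 (4 * k +
    3)%N
      + ((4 * k + 3)%N%:R ^+ 2 * prob0 p (4 * k + 3)%N - l)).
    apply/funext => k; rewrite /u /L_seq k4 var3E mean3_eq0 (negPf p02).
    by rewrite prob_doubleN1E /l; ring.
  rewrite -[X in _ --> X](addr0 0); apply: cvgD => //.
  have := prob_double1_cvg p02; apply: cvg_comp; move=> A [M _ HM].
  by exists M => // k /= Mk; apply: HM => /=; lia.
(* Outside the class n = 4 k + 3 the expression is identically 0, so the subsequence decides. *)
apply/cvgrPdist_lt => e e0; move/cvgrPdist_lt : ucvg => /(_ e e0)[M _ HM].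
exists (4 * M + 3)%N => // n /= Mn; have [n4|n4] := boolP (4 %| n.+1)%N.
  have -> : n = (4 * (n %/ 4) + 3)%N by lia.
  by apply: HM => /=; lia.
by rewrite prob_double1_eq0 // prob_doubleN1_eq0 // /L_seq (negPf n4) addr0 mulr0 !subr0 normr0.
Qed.

End SignedRoots.

(** * Uniform atom bound and combination of the estimates *)

Lemma atom_bound (R : realType) (p : 'I_3 -> R) : (forall i, p i < 1 / Num.sqrt 3) ->
  exists q, (forall i, p i <= q) /\ q * Num.sqrt 3 < 1.
Proof.
move=> p_max; case: (@arg_maxP _ _ _ (ord0 : 'I_3) predT p isT) => i _ H.
exists (p i); split=> [j|]; first exact: H.
by have := p_max i; rewrite ltr_pdivlMr // sqrtr_gt0.
Qed.

Lemma spread_gt0 (R : realType) (p : 'I_3 -> R) (p_ge0 : forall i, 0 <= p i)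
  (p_sum1 : \sum_(i < 3) p i = 1) : (forall i, p i < 1) -> 0 < spread p.
Proof.
move=> lt1; have := p_sum1; rewrite sum3E /spread => e.
have h0 := p_ge0 (inord 0); have h1 := p_ge0 (inord 1); have h2 := p_ge0 (inord 2).
have l0 := lt1 (inord 0); have l1 := lt1 (inord 1); have l2 := lt1 (inord 2).
case: (ltP 0 (p (inord 1))) => h.
  by rewrite ltr_wpDr ?mulr_gt0 ?mulr_ge0 //; lra.
have -> : p (inord 1) = 0 by lra.
by rewrite mul0r add0r !mulr_gt0 //; lra.
Qed.

Theorem theorem1p2 (R : realType) (p : 'I_3 -> R)
  (p_ge0 : forall i, 0 <= p i)
  (p_sum1 : \sum_(i < 3) p i = 1)
  (p_max : forall i, p i < 1 / Num.sqrt 3) :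
  (prob_double_root p n @[n --> \oo] --> p (inord 1) ^+ 2) /\
  (p (inord 1) = 0 ->
     ((n%:R ^+ 2 * prob_double_root p n - L_seq p n) @[n --> \oo] --> (0 : R))).
Proof.
have [q [p_le q_lt]] := atom_bound p_max.
have s3 : 1 <= Num.sqrt 3 :> R.
  by rewrite -(ler_pXn2r (ltn0Sn 1)) ?nnegrE ?sqrtr_ge0 // expr1n sqr_sqrtr // ler1n.
have lt1 i : p i < 1.
  by apply: lt_le_trans (p_max i) _; rewrite ler_pdivrMr ?mul1r // (lt_le_trans ltr01 s3).
have spread0 := spread_gt0 p_ge0 p_sum1 lt1.
have exc := exceptional_cvg p_ge0 p_sum1 p_le q_lt spread0.
have exc_ge0 n : 0 <= Pr p (@exceptional n R) by exact: Pr_ge0.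
split.
  have c1 := double_root1_cvg p_ge0 p_sum1 p_le q_lt spread0.
  have cN1 := double_rootN1_cvg p_ge0 p_sum1 p_le q_lt spread0.
  (* The exceptional probability is known to be small after multiplication by n^2; for n >= 1 that
     factor may simply be kept in the upper bound. *)
  have h : p (inord 1) ^+ 2 + (prob_double1 p n + prob_doubleN1 p n) +
      n%:R ^+ 2 * Pr p (@exceptional n R) @[n --> \oo] --> p (inord 1) ^+ 2 + (0 + 0) + 0.
    by apply: cvgD => //; apply: cvgD; [exact: cvg_cst|exact: cvgD].
  rewrite !addr0 in h.
  apply: (squeeze_cvgr _ (cvg_cst (p (inord 1) ^+ 2)) h).
  exists 1%N => // n /= n0; rewrite prob_double_rootE -(Pr_iroot2_0 p_ge0 p_sum1 n0).
  rewrite Pr_double_root_ge0 //=; apply: le_trans (Pr_double_root_le n p_ge0) _.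
  by rewrite lerD2l ler_peMl // -natrX ler1n expn_gt0 n0.
move=> p10.
have p0_gt0 : 0 < p (inord 0).
  have := p_sum1; rewrite sum3E p10 addr0 => e; have := lt1 (inord 2); lra.
have p2_gt0 : 0 < p (inord 2).
  have := p_sum1; rewrite sum3E p10 addr0 => e; have := lt1 (inord 0); lra.
have main := unit_roots_cvg p_ge0 p_sum1 p10 p0_gt0 p2_gt0 spread0.
(* The deviation from the contribution of 1 and -1 is at most the exceptional probability in
   modulus, since a double root at 0 has probability p(0)^2 = 0 here. *)
pose d n := prob_double_root p n - (prob_double1 p n + prob_doubleN1 p n).
have dcvg : n%:R ^+ 2 * d n @[n --> \oo] --> 0.
  apply/norm_cvg0P; apply: (squeeze_cvgr _ (cvg_cst 0) exc); exists 1%N => // n /= n0.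
  rewrite normr_ge0 normrM ger0_norm ?sqr_ge0 //=; apply: ler_wpM2l; first exact: sqr_ge0.
  rewrite ler_norml /d prob_double_rootE; apply/andP; split.
    by rewrite lerBrDl; have := Pr_double_root_ge n p_ge0; rewrite /prob_double1.
  rewrite lerBlDl; apply: le_trans (Pr_double_root_le n p_ge0) _.
  by rewrite (Pr_iroot2_0 p_ge0 p_sum1 n0) p10 expr0n add0r.
have -> : (fun n => n%:R ^+ 2 * prob_double_root p n - L_seq p n) =
  (fun n => n%:R ^+ 2 * d n + (n%:R ^+ 2 * (prob_double1 p n + prob_doubleN1 p n) - L_seq p n)).
  by apply/funext => n; rewrite /d mulrBr; ring.
by rewrite -[X in _ --> X](addr0 0); apply: cvgD.
Qed.
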